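(* Let $K$ be an almost classical knot such that $\Delta_K$ is not trivial (i.e. $\Delta_K$ is not of the form $\pm t^m$). If $K$ has prime period $p$, then $p$ divides a non-zero coefficient of $\Delta_K$, or $\operatorname{span}\Delta_K\ge p-1$. In particular, there are at most finitely many primes $p$ for which $K$ has period $p$.
   Context: A virtual knot diagram is an immersed oriented circle in the plane with transverse double points marked classical (with over/under information) or virtual; virtual knots are equivalence classes of such diagrams under planar isotopy, Reidemeister moves and detour moves (an arc all of whose crossings are virtual may be replaced by any other arc with the same endpoints, all of whose new crossings are virtual). A virtual knot has period $q\ge2$ if it is represented by a virtual knot diagram that misses the origin and is invariant under rotation of the plane by $2\pi/q$ about the origin. A virtual knot is almost classical if it has a diagram admitting an Alexander numbering: an integer-valued function on its short arcs (arcs between consecutive classical crossing points) such that at each classical crossing, drawn with both strands oriented downwards, the two left-hand arcs have a common number $\lambda$ and the two right-hand arcs have number $\lambda+1$ (numbers are unchanged through virtual crossings). Alexander polynomial: for a diagram with $n$ classical crossings, label the arcs running from one undercrossing to the next $x_1,\dots,x_n$ consecutively, so that at the $i$-th crossing (of sign $\varepsilon_i$) $x_i$ is the incoming under-arc, $x_{i+1}$ (indices mod $n$) the outgoing under-arc and $x_{k(i)}$ the over-arc. Let $A$ be the $n\times n$ matrix over $\mathbb{Z}[t^{\pm1}]$ whose $i$-th row is the sum of $t^{-\varepsilon_i}$ in column $i$, $-1$ in column $i+1$, and $1-t^{-\varepsilon_i}$ in column $k(i)$. For an almost classical knot $K$ the ideal generated by the $(n-1)\times(n-1)$ minors of $A$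 is principal, and $\Delta_K(t)$ is a generator (well defined up to $\pm t^m$; equal to $1$ if $n=0$). One has $\Delta_K(1)=\pm1$. For a nonzero Laurent polynomial $g=\sum_{j=m}^na_jt^j$ with $a_m,a_n\ne0$, $\operatorname{span}g=n-m$. *)

(* Defs.v *)
From HB Require Import structures.
From Stdlib Require Import Relation_Operators.
From mathcomp Require Import all_boot all_order all_algebra finmap zify.
From mathcomp Require Import all_classical all_reals all_analysis.

Set Implicit Arguments.
Unset Strict Implicit.
Unset Printing Implicit Defensive.
Import Order.TTheory GRing.Theory Num.Theory.
Import numFieldNormedType.Exports.
Local Open Scope classical_set_scope.
Local Open Scope ring_scope.

(** Z[t, t^-1] is realized as a subring of the fraction field of Z[X]. *)

Local Notation tofrac := (@FracField.tofrac _).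

Definition is_laurent (x : {fraction {poly int}}) : bool :=
  `[< exists (n : nat) (P : {poly int}), x = tofrac P / tofrac 'X ^+ n >].

Lemma tofracX_neq0 : tofrac ('X : {poly int}) != 0.
Proof. by rewrite tofrac_eq0 polyX_eq0. Qed.

Lemma is_laurent_subring : subring_closed is_laurent.
Proof.
split.
- by apply/asboolP; exists 0%N, 1; rewrite expr0 divr1 tofrac1.
- move=> x y /asboolP[n [P ->]] /asboolP[m [Q ->]]; apply/asboolP.
  exists (n + m)%N, (P * 'X^m - Q * 'X^n).
  have X0 k : tofrac ('X : {poly int}) ^+ k != 0 by rewrite expf_neq0 ?tofracX_neq0.
  by rewrite -mulNr addf_div ?X0// tofracB !tofracM !tofracXn mulNr exprD.
- move=> x y /asboolP[n [P ->]] /asboolP[m [Q ->]]; apply/asboolP.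
  by exists (n + m)%N, (P * Q); rewrite mulf_div tofracM exprD.
Qed.

HB.instance Definition _ :=
  GRing.isSubringClosed.Build {fraction {poly int}} is_laurent is_laurent_subring.

Record laurent := Laurent {
  laurent_val :> {fraction {poly int}};
  laurentP : laurent_val \in is_laurent }.

HB.instance Definition _ := [isSub for laurent_val].
HB.instance Definition _ := [Choice of laurent by <:].
HB.instance Definition _ := [SubChoice_isSubComNzRing of laurent by <:].

Lemma tpow_subproof (z : int) : tofrac ('X : {poly int}) ^ z \in is_laurent.
Proof.
apply/asboolP; case: z => k.
  by exists 0%N, 'X^k; rewrite expr0 divr1 tofracXn.
by exists k.+1, 1; rewrite tofrac1 mul1r.
Qed.

Definition tpow (z : int) : laurent := Laurent (tpow_subproof z).

(** [lcoef g j] is the coefficient of t^j in g; by [lcoefE] it does not depend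
    on the way g is written as P / t^n. *)
Definition lcoef (g : laurent) (j : int) : int :=
  let: (n, P) := xget (0%N, 0)
    [set nP : nat * {poly int} | laurent_val g = tofrac nP.2 / tofrac 'X ^+ nP.1] in
  if j + n%:Z is Posz k then P`_k else 0.

Lemma lcoefE (g : laurent) (n : nat) (P : {poly int}) (j : int) :
  laurent_val g = tofrac P / tofrac 'X ^+ n ->
  lcoef g j = if j + n%:Z is Posz k then P`_k else 0.
Proof.
move=> gE; rewrite /lcoef.
case: xgetP => [[m Q] _ /= gE'|/(_ (n, P))/(_ gE)//].
have X0 k : tofrac ('X : {poly int}) ^+ k != 0 by rewrite expf_neq0 ?tofracX_neq0.
have : P * 'X^m = Q * 'X^n.
  apply/eqP; rewrite -tofrac_eq !tofracM !tofracXn.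
  by rewrite -eqr_div ?X0// -gE -gE'.
move=> /polyP PQ.
case jm : (j + m%:Z) => [a|a]; case jn : (j + n%:Z) => [b|b] //.
- have := PQ (a + n)%N; rewrite !coefMXn.
  have -> : (a + n < m)%N = false by lia.
  have -> : (a + n < n)%N = false by lia.
  have -> : (a + n - m = b)%N by lia.
  by rewrite addnK.
- have := PQ (a + n)%N; rewrite !coefMXn.
  have -> : (a + n < m)%N by lia.
  have -> : (a + n < n)%N = false by lia.
  by rewrite addnK.
- have := PQ (b + m)%N; rewrite !coefMXn.
  have -> : (b + m < m)%N = false by lia.
  have -> : (b + m < n)%N by lia.
  by rewrite addnK.
Qed.

(** 0 by convention if g = 0. *)
Definition lspan (g : laurent) : nat :=
  xget 0%N [set d : nat | exists m : int,
    [/\ lcoef g m != 0, lcoef g (m + d%:Z) != 0 &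
        forall j, lcoef g j != 0 -> m <= j <= m + d%:Z]].

(** The circle is R / Z: curves are 1-periodic functions of a real parameter,
    and parameters are to be read modulo the integers. *)

Section Diagrams.
Variable R : realType.

Local Notation plane := (R * R)%type.

Definition same_param (s t : R) : Prop := t - s \is a Num.int.

Definition same_pair (u v s t : R) : Prop :=
  same_param u s /\ same_param v t \/ same_param u t /\ same_param v s.

Definition wedge (u v : plane) : R := u.1 * v.2 - u.2 * v.1.

Definition is_double (g : R -> plane) (s t : R) : Prop :=
  g s = g t /\ ~ same_param s t.

(** [is_over s t]: at the classical crossing g(s) = g(t), the strand through the
    parameter s passes over the strand through t.  The double points that are
    related by [is_over] in neither direction are the virtual crossings. *)
Record diagram := Diagram {
  curve : R -> plane;
  is_over : R -> R -> Prop;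
  curve_periodic : forall t, curve (t + 1) = curve t;
  curve_derivable : forall t, derivable curve t 1;
  curve_C1 : continuous (derive1 curve);
  curve_immersed : forall t, derive1 curve t != 0;
  curve_finite :
    finite_set [set t | 0 <= t < 1 /\ exists s, is_double curve s t];
  curve_double : forall s t u,
    is_double curve s t -> is_double curve s u -> same_param t u;
  curve_transverse : forall s t,
    is_double curve s t -> wedge (derive1 curve s) (derive1 curve t) != 0;
  over_double : forall s t, is_over s t -> is_double curve s t;
  over_asym : forall s t, is_over s t -> ~ is_over t s;
  over_same_param : forall s t s' t',
    same_param s s' -> same_param t t' -> is_over s t -> is_over s' t' }.

Definition classical_crossing (D : diagram) (s t : R) : Prop :=
  is_over D s t \/ is_over D t s.

(** Positive iff the tangent vectors at s and t, in this order, form a positively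
    oriented basis.  If s is the over-strand, its sign is the crossing sign. *)
Definition crossing_det (D : diagram) (s t : R) : R :=
  wedge (derive1 (curve D) s) (derive1 (curve D) t).

(** Lifts to R of the orientation preserving homeomorphisms of R / Z. *)
Definition reparametrization (phi : R -> R) : Prop :=
  [/\ continuous phi, forall s t, s < t -> phi s < phi t
    & forall t, phi (t + 1) = phi t + 1].

Definition same_diagram (D D' : diagram) : Prop :=
  exists phi, [/\ reparametrization phi,
    forall t, curve D' t = curve D (phi t)
  & forall s t, is_over D' s t <-> is_over D (phi s) (phi t)].

(** Ambient isotopies by C^1 diffeomorphisms.  Letting the time range over R
    instead of [0, 1] is no restriction: an isotopy over [0, 1] extends by being
    constant on both sides. *)
Definition ambient_isotopy (H : R -> plane -> plane) : Prop :=
  [/\ [/\ forall x, H 0 x = x,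
          forall s, bijective (H s)
        & continuous (fun z : R * plane => H z.1 z.2)],
      forall s x, differentiable (H s) x,
      forall v : plane, continuous (fun z : R * plane => 'D_v (H z.1) z.2)
    & forall s x (v : plane), v != 0 -> 'D_v (H s) x != 0].

Definition isotopy_move (D D' : diagram) : Prop :=
  exists H, [/\ ambient_isotopy H,
    forall t, curve D' t = H 1 (curve D t)
  & forall s t, is_over D' s t <-> is_over D s t].

Definition open_arc (a b : R) : set R :=
  [set t | exists k : int, a < t + k%:~R < b].

Definition closed_arc (a b : R) : set R :=
  [set t | exists k : int, a <= t + k%:~R <= b].

Definition agree_off (a b : R) (D D' : diagram) : Prop :=
  (forall t, ~ open_arc a b t -> curve D' t = curve D t) /\
  (forall s t, ~ open_arc a b s -> ~ open_arc a b t ->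
     is_over D' s t <-> is_over D s t).

Definition detour_move (D D' : diagram) : Prop :=
  exists a b, [/\ a < b < a + 1, agree_off a b D D' &
    forall s t, open_arc a b s ->
      ~ classical_crossing D s t /\ ~ classical_crossing D' s t].

Definition is_disc (B : set plane) : Prop :=
  exists h h' : plane -> plane,
    [/\ continuous h, continuous h', cancel h h', cancel h' h
      & B = h @` [set x : plane | x.1 ^+ 2 + x.2 ^+ 2 <= 1]].

(** The part of D inside B is exactly the image of the parameters in A. *)
Definition meets_in (D : diagram) (B : set plane) (A : set R) : Prop :=
  forall t, B (curve D t) <-> A t.

Definition doubles_in (D : diagram) (B : set plane) (P : R -> R -> Prop) : Prop :=
  forall u v, is_double (curve D) u v -> B (curve D u) -> P u v.

(** A strand without double points is replaced by a strand with a single, classical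
    one; since [is_over] is unconstrained, both kinds of crossing are allowed. *)
Definition reidemeister1 (D D' : diagram) : Prop :=
  exists a b B, [/\ a < b < a + 1, is_disc B, agree_off a b D D',
    meets_in D B (closed_arc a b) /\ meets_in D' B (closed_arc a b) &
    doubles_in D B (fun _ _ => False) /\
    exists s t, [/\ a < s < b, a < t < b, is_over D' s t
      & doubles_in D' B (fun u v => same_pair u v s t)]].

(** The strand [a, b] is pushed over or under the strand [c, d].  The requirement
    that the two new crossings have opposite signs holds in any disc. *)
Definition reidemeister2 (D D' : diagram) : Prop :=
  exists a b c d B, let A := closed_arc a b `|` closed_arc c d in
    [/\ [/\ a < b, b < c, c < d & d < a + 1], is_disc B, agree_off a b D D',
        meets_in D B A /\ meets_in D' B A &
    doubles_in D B (fun _ _ => False) /\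
    exists s1 s2 t1 t2,
      [/\ [/\ a < s1, s1 < s2 & s2 < b], c < t1 < d /\ c < t2 < d,
          is_over D' s1 t1 /\ is_over D' s2 t2 \/ is_over D' t1 s1 /\ is_over D' t2 s2,
          crossing_det D' s1 t1 * crossing_det D' s2 t2 < 0
        & doubles_in D' B
            (fun u v => same_pair u v s1 t1 \/ same_pair u v s2 t2)]].

(** Three strands which cross pairwise once, the first one at the parameters s2, s3,
    the second one at t2, u, and the third one at t3, v.  They bound a triangle:
    the sides issuing from the two crossings on a given strand and leading to the
    third crossing lie on the same side of this strand. *)
Definition bound_triangle (D : diagram) (s2 s3 t2 u t3 v : R) : Prop :=
  [/\ 0 < ((u - t2) * crossing_det D s2 t2) * ((v - t3) * crossing_det D s3 t3),
      0 < ((s3 - s2) * crossing_det D t2 s2) * ((t3 - v) * crossing_det D u v)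
    & 0 < ((s2 - s3) * crossing_det D t3 s3) * ((t2 - u) * crossing_det D v u)].

(** The strand [a, b], which is above the strands [c, d] and [e, f], is pushed over
    their crossing; the order of the two crossings on each strand is reversed.
    The requirements on signs and on triangles hold in any disc. *)
Definition reidemeister3 (D D' : diagram) : Prop :=
  exists a b c d e f B,
  let A := closed_arc a b `|` closed_arc c d `|` closed_arc e f in
    [/\ [/\ a < b, b < c, c < d, d < e & e < f < a + 1], is_disc B,
        agree_off a b D D', meets_in D B A /\ meets_in D' B A &
    exists u v s2 t2 s3 t3 s2' t2' s3' t3',
      [/\ [/\ c < u < d, e < v < f & classical_crossing D u v],
          [/\ a < s2 < b, c < t2 < d, a < s3 < b & e < t3 < f] /\
          [/\ a < s2' < b, c < t2' < d, a < s3' < b & e < t3' < f],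
          [/\ is_over D s2 t2, is_over D s3 t3, bound_triangle D s2 s3 t2 u t3 v &
            doubles_in D B (fun x y =>
              [\/ same_pair x y u v, same_pair x y s2 t2 | same_pair x y s3 t3])],
          [/\ is_over D' s2' t2', is_over D' s3' t3', bound_triangle D' s2' s3' t2' u t3' v &
            doubles_in D' B (fun x y =>
              [\/ same_pair x y u v, same_pair x y s2' t2' | same_pair x y s3' t3'])]
        & [/\ (s3 - s2) * (s3' - s2') < 0,
              (u - t2) * (u - t2') < 0,
              (v - t3) * (v - t3') < 0,
              0 < crossing_det D s2 t2 * crossing_det D' s2' t2'
            & 0 < crossing_det D s3 t3 * crossing_det D' s3' t3']]].

Definition diagram_move (D D' : diagram) : Prop :=
  [\/ same_diagram D D' \/ isotopy_move D D', detour_move D D',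
      reidemeister1 D D' | reidemeister2 D D' \/ reidemeister3 D D'].

Definition virtually_equivalent : diagram -> diagram -> Prop :=
  clos_refl_sym_trans diagram diagram_move.

Record virtual_knot := VirtualKnot {
  diagram_of : set diagram;
  diagram_ofP : exists D, diagram_of = virtually_equivalent D }.

Definition rotation (theta : R) (x : plane) : plane :=
  (cos theta * x.1 - sin theta * x.2, sin theta * x.1 + cos theta * x.2).

Definition rotation_invariant (theta : R) (D : diagram) : Prop :=
  exists phi, [/\ reparametrization phi,
    forall t, rotation theta (curve D t) = curve D (phi t)
  & forall s t, is_over D s t <-> is_over D (phi s) (phi t)].

Definition has_period (K : virtual_knot) (q : nat) : Prop :=
  (2 <= q)%N /\ exists D, [/\ diagram_of K D, forall t, curve D t != 0
    & rotation_invariant (2 * pi / q%:R) D].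

(** An Alexander numbering is a function of the parameter which is constant on short
    arcs; its values at the crossings are irrelevant.  If (s, t) is a positive basis
    and both strands are oriented downwards, then s runs from the upper right to
    the lower left and t from the upper left to the lower right. *)
Definition alexander_numbering (D : diagram) (f : R -> int) : Prop :=
  [/\ forall t, f (t + 1) = f t,
      forall s t, s <= t ->
        (forall u w, s <= u <= t -> ~ classical_crossing D u w) -> f s = f t
    & forall s t, classical_crossing D s t -> 0 < crossing_det D s t ->
        exists l : int,
          [/\ \forall x \near s^'-, f x = l + 1, \forall x \near s^'+, f x = l,
              \forall x \near t^'-, f x = l & \forall x \near t^'+, f x = l + 1]].

Definition almost_classical (K : virtual_knot) : Prop :=
  exists D, diagram_of K D /\ exists f, alexander_numbering D f.

(** The parameters of the undercrossings in [0, 1[, in increasing order. *)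
Definition under_params (D : diagram) : seq R :=
  sort <=%R (fset_set [set t | 0 <= t < 1 /\ exists s, is_over D s t]).

Definition n_crossings (D : diagram) : nat := size (under_params D).

Definition under_param (D : diagram) (i : nat) : R := nth 0 (under_params D) i.

Definition over_param (D : diagram) (i : nat) : R :=
  xget 0 [set s | 0 <= s < 1 /\ is_over D s (under_param D i)].

Definition crossing_sign (D : diagram) (i : nat) : int :=
  sgz (crossing_det D (over_param D i) (under_param D i)).

(** The i-th arc ends at the i-th undercrossing (both counted from 0), so the index of
    the arc containing the parameter s is the number of undercrossings before s;
    the parameters after the last undercrossing belong to the arc 0. *)
Definition over_arc (D : diagram) (i : nat) : nat :=
  (count (fun u => (u < over_param D i)%R) (under_params D) %% n_crossings D)%N.

Definition alexander_matrix (D : diagram) : 'M[laurent]_(n_crossings D) :=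
  \matrix_(i, j)
    (tpow (- crossing_sign D i) *+ (j == i)
     - 1 *+ (j == (i.+1 %% n_crossings D)%N :> nat)
     + (1 - tpow (- crossing_sign D i)) *+ (j == over_arc D i :> nat)).

(** The ideal generated by the (n-1) x (n-1) minors.  Letting f and g be arbitrary maps
    only adds minors with repeated rows or columns, which are 0, and permutations
    of minors.  For n = 0 the only minor is the empty one, equal to 1. *)
Definition alexander_ideal (D : diagram) : set laurent :=
  [set x | exists c : {ffun 'I_(n_crossings D).-1 -> 'I_(n_crossings D)} ->
                      {ffun 'I_(n_crossings D).-1 -> 'I_(n_crossings D)} -> laurent,
     x = \sum_f \sum_g c f g * \det (mxsub f g (alexander_matrix D))].

Definition is_alexander_polynomial (K : virtual_knot) (Delta : laurent) : Prop :=
  exists D, diagram_of K D /\ alexander_ideal D = [set x | exists y, x = y * Delta].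

End Diagrams.

Definition trivial_laurent (g : laurent) : Prop :=
  exists m : int, g = tpow m \/ g = - tpow m.

(* Main.v *)
(** The Alexander ideal of a diagram is the Fitting ideal of the module generated by
    the arcs, pointed at one arc.  It only depends on the maps from the arcs to
    Z[t, t^-1]-modules that satisfy the crossing relations, the colorings; a move
    transports the colorings of a diagram to those of the other one, without change
    at the parameters away from the move, and these generate both modules.  Hence
    the ideal is an invariant of the virtual knot.

    On a diagram with a symmetry of prime order p, a power of the symmetry, composed
    with a turn of the circle, shifts the n undercrossings by m = n / p, so that the
    Alexander matrix is block circulant.  Modulo p, the group algebra of Z/p is
    local, and each cofactor of this matrix equals a cofactor of the quotient matrix
    times the same power delta^(p-1).  Here delta(1) = -1, so delta is not 0.  If p
    divides no non-zero coefficient of Delta and span Delta < p - 1, then delta^(p-1)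
    divides Delta mod p only if delta is a monomial, and then Delta mod p divides a
    monomial.  So Delta has a single coefficient, which is Delta(1) = 1 or -1. *)
From HB Require Import structures.
From Stdlib Require Import Relation_Operators.
Require Import Defs.
From mathcomp Require Import all_boot all_order all_algebra finmap.
From mathcomp Require Import perm zify ring lra.
From mathcomp Require Import all_classical all_reals all_analysis.

Set Implicit Arguments.
Unset Strict Implicit.
Unset Printing Implicit Defensive.
Import Order.TTheory GRing.Theory Num.Theory.
Import numFieldNormedType.Exports.
Local Open Scope classical_set_scope.
Local Open Scope ring_scope.

(** * Block circulant matrices *)

(** The matrix is singular, so the formula det C = (det A)^p for a block circulant matrix only says
    0 = 0. It is applied to a deformation instead: the k-th block is multiplied by X^k, which makes
    the row sums multiples of X - 1 in the quotient and, after a conjugation, of X^p - 1 in the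
    circulant matrix. Since (X - 1)^p = X^p - 1 in characteristic p, these factors cancel. Putting X
    = 1 relates weighted sums of cofactors, and a left kernel vector lifted from the quotient
    separates the single cofactors. The weighted sum of the quotient is delta; its value -1 at t = 1
    comes from the one passage between consecutive blocks. Colorings take values in arbitrary
    modules so that a linear relation between arcs can be tested on the tautological coloring in a
    quotient of a free module. On the line, the p-th iterate of the symmetry is t -> t + r. If p
    divided r, the symmetry would fix a point of the curve, which could only be the origin. So r is
    invertible mod p, and a power of the symmetry, corrected by an integer, has p-th iterate t -> t
    + 1. *)

Lemma sum_blocks (V : nmodType) (p m : nat) (F : nat -> nat -> V) :
  \sum_(l < p * m) F (l %/ m)%N (l %% m)%N = \sum_(c < p) \sum_(d < m) F c d.
Proof.
elim: p F => [|p IHp] F; first by rewrite !big_ord0.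
rewrite big_ord_recl -(IHp (fun c => F c.+1)) /= -[(p.+1 * m)%N]/(m + p * m)%N.
rewrite big_split_ord /=; congr (_ + _).
  by apply: eq_bigr => i _; rewrite divn_small ?modn_small.
apply: eq_bigr => i _; have m0 : (0 < m)%N by case: (m) i => // -[? ]; rewrite muln0.
by rewrite divnDl ?dvdnn// divnn m0 modnDl add1n.
Qed.

Lemma det_block_triangular (S : comNzRingType) (p m : nat) (T d : nat -> nat -> S) :
  (forall i j, (j %/ m < i %/ m)%N -> T i j = 0) ->
  (forall k i j, (i < m)%N -> (j < m)%N -> T (k * m + i)%N (k * m + j)%N = d i j) ->
  \det (\matrix_(i < p * m, j < p * m) T i j) = \det (\matrix_(i < m, j < m) d i j) ^+ p.
Proof.
elim: p T => [|p IHp] T Ttri Tdiag; first by rewrite expr0 det_mx00.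
rewrite exprS -[(p.+1 * m)%N]/(m + p * m)%N.
rewrite -[X in \det X]submxK.
set dl := dlsubmx _; have -> : dl = 0.
  apply/matrixP => i j; rewrite !mxE /= Ttri// divn_small//.
  have m0 : (0 < m)%N by apply: leq_ltn_trans (ltn_ord j).
  by rewrite divn_gt0// leq_addr.
rewrite det_ublock; congr (_ * _).
  by congr (\det _); apply/matrixP => i j; rewrite !mxE /= -(Tdiag 0%N).
have m0 (i : 'I_(p * m)) : (0 < m)%N by case: (m) i => // -[? ]; rewrite muln0.
rewrite -(IHp (fun i j => T (m + i)%N (m + j)%N)).
- by congr (\det _); apply/matrixP => i j; rewrite !mxE.
- move=> i j ij; have m1 : (0 < m)%N by case: (m) ij => //; rewrite divn0.
  by apply: Ttri; rewrite !divnDl// ?dvdnn// ltn_add2l.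
- by move=> k i j im jm; rewrite !addnA -mulSn Tdiag.
Qed.

(** In Vandermonde's convolution every term but the first contains C(p, i) with 0 < i < p. Hence the
    coefficients of g^c at the powers of g - 1 below the p-th depend only on c mod p. *)
Lemma bin_add_prime p c b : prime p -> (b < p)%N ->
  'C(p + c, b) = 'C(c, b) %[mod p].
Proof.
move=> pp bp; rewrite -binomial.Vandermonde big_ord_recl bin0 mul1n subn0.
rewrite -[X in _ = (X %% p)%N]addn0; apply/eqP; rewrite eqn_modDl mod0n.
apply/dvdn_sum => i _; apply: dvdn_mulr; apply: prime_dvd_bin => //=.
by rewrite (leq_ltn_trans _ bp)// /bump add1n (leq_trans (ltn_ord i)).
Qed.

Section Circulant.
Variables (S : comNzRingType) (p : nat) (pS : p \in [pchar S]) (m : nat).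
Variable a : nat -> nat -> nat -> S.

Let pp : prime p. Proof. by case/andP: pS. Qed.

Lemma natr_mod (x y : nat) : x = y %[mod p] -> x%:R = y%:R :> S.
Proof.
move=> xy; have h z : z%:R = (z %% p)%N%:R :> S.
  by rewrite {1}(divn_eq z p) natrD natrM (pcharf0 pS) mulr0 add0r.
by rewrite h xy -h.
Qed.

(** Change of basis from the powers of a generator [g] of [Z/p] to those of
    [g - 1], in which the circulant matrix is block triangular. *)
Lemma det_block_circulant :
  \det (\matrix_(i < p * m, j < p * m)
      a ((j %/ m + (p - i %/ m)) %% p)%N (i %% m)%N (j %% m)%N) =
  \det (\matrix_(i < m, j < m) \sum_(k < p) a k i j) ^+ p.
Proof.
(* Row block c of [Q] holds the coefficients of g^c in the powers of g - 1. [T] is multiplication by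
   the sum of the g^k a_k in the new basis; since (g - 1)^p = 0, nothing wraps around and [T] is
   block triangular. *)
pose Q := \matrix_(i < p * m, j < p * m)
  (('C(i %/ m, j %/ m) * (i %% m == j %% m))%N%:R : S).
pose T (i j : nat) := \sum_(k < p) ((i %/ m <= j %/ m) * 'C(k, j %/ m - i %/ m))%N%:R
   * a k (i %% m)%N (j %% m)%N.
have m0 (i : 'I_(p * m)) : (0 < m)%N by case: (m) i => // -[? ]; rewrite muln0.
have dQ : \det Q = 1.
  rewrite det_trig.
    by rewrite big1// => i _; rewrite mxE binn eqxx.
  apply/is_trig_mxP => i j ij; rewrite mxE.
  have [eqm|] := eqVneq (i %% m)%N (j %% m)%N; last by rewrite muln0.
  rewrite bin_small//; have := ij; rewrite {1}(divn_eq i m) {1}(divn_eq j m) eqm.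
  by rewrite ltn_add2r ltn_mul2r => /andP[].
set C := \matrix_(i, j) _.
have CQ : C *m Q = Q *m \matrix_(i < p * m, j < p * m) T i j.
  apply/matrixP => i j; rewrite !mxE.
  set x := (i %/ m)%N; set y := (j %/ m)%N.
  have xp : (x < p)%N by rewrite ltn_divLR ?(m0 i).
  have yp : (y < p)%N by rewrite ltn_divLR ?(m0 i).
  transitivity (\sum_(k < p) a k (i %% m)%N (j %% m)%N * ('C(x + k, y))%N%:R).
    under eq_bigr do rewrite !mxE -/x -/y.
    rewrite (sum_blocks _ _ (fun c d => a ((c + (p - x)) %% p)%N (i %% m)%N d *
       ('C(c, y) * (d == j %% m)%N)%N%:R)).
    have jm : (j %% m < m)%N by rewrite ltn_mod (m0 i).
    under eq_bigr => c _.
      rewrite (bigD1 (Ordinal jm))//= big1 ?addr0 ?eqxx ?muln1; last first.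
        by move=> d; rewrite -val_eqE /= => /negPf ->; rewrite muln0 mulr0.
      over.
    have p0 := prime_gt0 pp.
    pose h (k : 'I_p) := Ordinal (ltn_pmod (x + k) p0).
    have hinj : injective h.
      move=> k k' /(congr1 val)/= /eqP; rewrite eqn_modDl !modn_small// => /eqP.
      exact: val_inj.
    rewrite (reindex_inj hinj) /=; apply: eq_bigr => k _.
    congr (_ * _).
      congr (a _ _ _); rewrite modnDml addnAC subnKC ?(ltnW xp)//.
      by rewrite modnDl modn_small.
    (* The block index x + k may exceed p - 1 and wrap around; its binomial coefficient is the same
       mod p because y < p. *)
    apply: natr_mod; have := divn_eq (x + k) p.
    have xk : (x + k < p + p)%N by have := ltn_ord k; lia.
    have [lt|ge] := ltnP (x + k) p; first by rewrite modn_small.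
    have -> : ((x + k) %% p = x + k - p)%N.
      by rewrite -{1}(subnKC ge) modnDl modn_small//; lia.
    by have := bin_add_prime (x + k - p) pp yp; rewrite subnKC.
  under [RHS]eq_bigr do rewrite !mxE -/x /T -/y.
  rewrite (sum_blocks _ _ (fun c d => ('C(x, c) * (i %% m == d))%N%:R *
     \sum_(k < p) ((c <= y) * 'C(k, y - c))%N%:R * a k d (j %% m)%N)).
  have im : (i %% m < m)%N by rewrite ltn_mod (m0 i).
  under [RHS]eq_bigr => c _.
    rewrite (bigD1 (Ordinal im))//= eqxx muln1.
    rewrite [X in _ + X]big1 ?addr0; last first.
      move=> d; rewrite -val_eqE /= eq_sym => /negPf ->.
      by rewrite muln0 mul0r.
    rewrite mulr_sumr; over.
  rewrite /= exchange_big /=; apply: eq_bigr => k _.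
  under [RHS]eq_bigr do rewrite mulrA -natrM.
  rewrite -mulr_suml mulrC; congr (_ * _).
  rewrite -natr_sum -binomial.Vandermonde; congr _%:R.
  rewrite (big_ord_widen p (fun j0 => 'C(x, j0) * 'C(k, y - j0))%N yp).
  rewrite big_mkcond /=; apply: eq_bigr => c _.
  by rewrite ltnS; case: (c <= y)%N; rewrite ?mul1n ?mul0n ?muln0.
have := congr1 determinant CQ; rewrite !det_mulmx dQ mulr1 mul1r => ->.
apply: (@det_block_triangular S p m T (fun i j => \sum_(k < p) a k i j)) => [i j ij|k i j im jm].
  by rewrite /T big1// => k _; rewrite leqNgt ij mul0n mul0r.
rewrite /T; apply: eq_bigr => l _.
have m1 : (0 < m)%N by apply: leq_ltn_trans im.
by rewrite !divnMDl// (divn_small im) (divn_small jm) !addn0 leqnn subnn bin0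
   !modnMDl !modn_small// mul1r.
Qed.

End Circulant.

(** Adding all columns to column [j0] leaves the determinant unchanged; this is the expansion along
    the new column. It splits a common factor of the row sums off the determinant. *)
Lemma det_row_sums (S : comNzRingType) (n : nat) (M : 'M[S]_n) (j0 : 'I_n) :
  \det M = \sum_i (\sum_j M i j) * cofactor M i j0.
Proof.
under eq_bigr do rewrite mulr_suml.
rewrite exchange_big /= (bigD1 j0)//= -expand_det_col big1 ?addr0// => j jj0.
have := congr1 (fun N : 'M[S]_n => N j0 j) (mul_adj_mx M).
rewrite !mxE eq_sym (negPf jj0) mulr0n => {2}<-.
by apply: eq_bigr => i _; rewrite mxE mulrC.
Qed.

Definition replace_col (S : comNzRingType) (n : nat) (M : 'M[S]_n) (v : 'cV[S]_n)
  (k : 'I_n) : 'M[S]_n := \matrix_(i, j) if j == k then v i 0 else M i j.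

Lemma cofactor_replace_col (S : comNzRingType) (n : nat) (M : 'M[S]_n) v k i :
  cofactor (replace_col M v k) i k = cofactor M i k.
Proof.
rewrite /cofactor; congr (_ * \det _); apply/matrixP => x y; rewrite !mxE.
by rewrite eq_sym (negPf (neq_lift _ _)).
Qed.

(** Cramer's rule, without any assumption on the rank: with column k replaced by the i-th unit
    vector, M has determinant [cofactor M i k], and v maps it to v_i times the k-th unit row.
    Multiplying by the adjugate gives the identity. *)
Lemma cofactor_left_kernel (S : comNzRingType) (n : nat) (M : 'M[S]_n) (v : 'rV[S]_n) i j k :
  v *m M = 0 -> v 0 j * cofactor M i k = v 0 i * cofactor M j k.
Proof.
move=> vM; pose M1 := replace_col M (delta_mx i 0) k.
have vM1 : v *m M1 = v 0 i *: delta_mx 0 k.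
  apply/rowP => l; rewrite !mxE eqxx /=.
  have [->|lk] := eqVneq l k.
    rewrite mulr1 (bigD1 i)//= !mxE !eqxx mulr1 big1 ?addr0// => x xi.
    by rewrite !mxE eqxx (negPf xi) mulr0.
  have := congr1 (fun N : 'rV[S]_n => N 0 l) vM; rewrite !mxE mulr0 => {2}<-.
  by apply: eq_bigr => x _; rewrite mxE (negPf lk).
have dM1 : \det M1 = cofactor M i k.
  rewrite (expand_det_col _ k) (bigD1 i)//= !mxE !eqxx mul1r.
  rewrite cofactor_replace_col big1 ?addr0// => x xi.
  by rewrite !mxE eqxx (negPf xi) mul0r.
have := congr1 (fun N : 'rV[S]_n => N 0 j) (mulmxA v M1 (\adj M1)).
rewrite mul_mx_adj mul_mx_scalar vM1 -scalemxAl -rowE !mxE dM1 mulrC.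
by rewrite cofactor_replace_col.
Qed.

Lemma cofactor_kernel_row (S : comNzRingType) (n : nat) (M : 'M[S]_n) (k : 'I_n) :
  \det M = 0 -> (\row_i cofactor M i k) *m M = 0.
Proof.
move=> dM; apply/rowP => j; rewrite !mxE.
have := congr1 (fun N : 'M[S]_n => N k j) (mul_adj_mx M).
rewrite !mxE dM mul0rn => {2}<-.
by apply: eq_bigr => i _; rewrite !mxE.
Qed.

(** * Cofactors of singular block circulant matrices in characteristic p *)

Section Murasugi.
Variables (R : idomainType) (p : nat) (pR : p \in [pchar R]) (m : nat).
Variable a : nat -> nat -> nat -> R.
Hypothesis a_rowsum : forall i, (i < m)%N -> \sum_(k < p) \sum_(j < m) a k i j = 0.

Let circ (S : comNzRingType) (f : nat -> nat -> nat -> S) := \matrix_(i < p * m, j < p * m)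
  f ((j %/ m + (p - i %/ m)) %% p)%N (i %% m)%N (j %% m)%N.
Let quo := \matrix_(i < m, j < m) \sum_(k < p) a k i j.

Let m0 (i : 'I_(p * m)) : (0 < m)%N.
Proof. by case: (m) i => // -[? ]; rewrite muln0. Qed.

Let divp (i : 'I_(p * m)) : (i %/ m < p)%N.
Proof. by rewrite ltn_divLR ?(m0 i). Qed.

Let modm (i : 'I_(p * m)) : (i %% m < m)%N.
Proof. by rewrite ltn_mod (m0 i). Qed.

Let p0 : (0 < p)%N. Proof. by case/andP: pR => /prime_gt0. Qed.

Lemma sum_shift (V : nmodType) (x : nat) (F : nat -> V) : (x < p)%N ->
  \sum_(c < p) F ((c + (p - x)) %% p)%N = \sum_(k < p) F k.
Proof.
move=> xp; pose h (k : 'I_p) := Ordinal (ltn_pmod (k + (p - x)) p0).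
have hinj : injective h.
  move=> k k' /(congr1 val)/= /eqP; rewrite eqn_modDr !modn_small// => /eqP.
  exact: val_inj.
by rewrite [RHS](reindex_inj hinj).
Qed.

Lemma circ_rowsum (i : 'I_(p * m)) : \sum_j circ a i j = 0.
Proof.
under eq_bigr do rewrite mxE.
rewrite (sum_blocks _ _ (fun c d => a ((c + (p - i %/ m)) %% p)%N (i %% m)%N d)).
by rewrite (sum_shift (fun k => \sum_(d < m) a k (i %% m)%N d)) ?a_rowsum.
Qed.

(** A left kernel vector of the quotient, repeated over the p blocks, is one of the circulant
    matrix, since a block column contains every [a k] exactly once. *)
Lemma circ_mul (v : 'I_m -> R) (j : 'I_(p * m)) : (forall j, \sum_i v i * quo i j = 0) ->
  \sum_(i < p * m) v (Ordinal (modm i)) * circ a i j = 0.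
Proof.
move=> vA; pose v' (i : nat) := if insub i is Some i' then v i' else 0.
have v'E (i : 'I_m) : v' i = v i by rewrite /v' valK.
transitivity (\sum_(i < p * m) v' (i %% m)%N * 
    a ((j %/ m + (p - i %/ m)) %% p)%N (i %% m)%N (j %% m)%N).
  by apply: eq_bigr => i _; rewrite mxE -v'E.
rewrite (sum_blocks _ _ (fun c d => v' d * a ((j %/ m + (p - c)) %% p)%N d (j %% m)%N)).
rewrite exchange_big /= -[RHS](vA (Ordinal (modm j))).
apply: eq_bigr => d _; rewrite -mulr_sumr v'E; congr (_ * _); rewrite mxE /=.
pose h (c : 'I_p) := Ordinal (ltn_pmod (j %/ m + (p - c)) p0).
have hinj : injective h.
  move=> k k' /(congr1 val)/= /eqP; rewrite eqn_modDl.
  rewrite -(eqn_modDr (k + k')).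
  have -> : (p - k + (k + k') = p + k')%N by have := ltn_ord k; lia.
  have -> : (p - k' + (k + k') = p + k)%N by have := ltn_ord k'; lia.
  by rewrite !modnDl !modn_small// => /eqP e; apply: val_inj.
by rewrite [RHS](reindex_inj hinj).
Qed.

(** [wrap] sums the blocks to the left of the diagonal one, and [speed] is the derivative at X = 1
    of the row sum when block k carries X^k. They are the values at X = 1 of the row sums of the two
    deformed matrices, divided by X^p - 1 and X - 1 respectively. *)
Let wrap (i : 'I_(p * m)) := \sum_(j < p * m | (j %/ m < i %/ m)%N) circ a i j.
Let speed (i : nat) := \sum_(k < p) (\sum_(j < m) a k i j) *+ k.

(** Block k lies left of the diagonal exactly in the k row blocks x with p <= x + k; this explains
    the weight k in [speed]. *)
Lemma sum_wrap (v : 'I_m -> R) :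
  \sum_i v (Ordinal (modm i)) * wrap i = \sum_(i < m) v i * speed i.
Proof.
pose v' (i : nat) := if insub i is Some i' then v i' else 0.
have v'E (i : 'I_m) : v' i = v i by rewrite /v' valK.
pose F x d := \sum_(c < p | (c < x)%N) \sum_(j < m) a ((c + (p - x)) %% p)%N d j.
transitivity (\sum_(i < p * m) v' (i %% m)%N * F (i %/ m)%N (i %% m)%N).
  apply: eq_bigr => i _; rewrite -v'E /=; congr (_ * _); rewrite /wrap /F.
  rewrite [RHS]big_mkcond/= [LHS]big_mkcond/=.
  transitivity (\sum_(c < p) \sum_(d < m) if (c < i %/ m)%N then
    a ((c + (p - i %/ m)) %% p)%N (i %% m)%N d else 0); last first.
    by apply: eq_bigr => c _; case: ifP => // _; rewrite big1.
  rewrite -(sum_blocks p m (fun c d => if (c < i %/ m)%N then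
    a ((c + (p - i %/ m)) %% p)%N (i %% m)%N d else 0)).
  by apply: eq_bigr => j _; rewrite mxE.
rewrite (sum_blocks _ _ (fun c d => v' d * F c d)) exchange_big /=.
apply: eq_bigr => d _; rewrite -mulr_sumr v'E; congr (_ * _).
pose G k := \sum_(j < m) a k d j.
transitivity (\sum_(x < p) \sum_(k < p | (p <= x + k)%N) G k).
  apply: eq_bigr => x _; rewrite /F -/(G _).
  rewrite [LHS]big_mkcond/= [RHS]big_mkcond/=.
  rewrite -(sum_shift (fun k => if (p <= x + k)%N then G k else 0) (ltn_ord x)).
  apply: eq_bigr => c _; have cp := ltn_ord c; have xp := ltn_ord x.
  have [cx|xc] := ltnP c x.
    by rewrite modn_small ?ifT//; lia.
  have -> : (c + (p - x) = c - x + p)%N by lia.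
  rewrite modnDr modn_small; last by lia.
  by rewrite ifF//; apply/negbTE; lia.
rewrite (exchange_big_dep predT)//=; apply: eq_bigr => k _.
rewrite sumr_const; congr (_ *+ _).
rewrite -sum1_card big_mkcond /= -(big_mkord xpredT (fun x => if (p <= x + k)%N then 1%N else 0%N)).
rewrite (@big_cat_nat _ _ _ (p - k))//=; last by lia.
rewrite big_nat big1 ?add0n; last first.
  by move=> x xk; rewrite ifF//; apply/negbTE; lia.
rewrite big_nat (eq_bigr (fun=> 1%N)); last by move=> x xk; rewrite ifT//; lia.
by rewrite -big_nat sum_nat_const_nat; have := ltn_ord k; lia.
Qed.

(** Both sides are values at X = 1 of quotients of determinants. The matrix [A'] carries X^k on
    block k, and [C'] carries X^p on the entries left of the diagonal blocks. The determinant of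
    [C'] is the p-th power of that of [A']; it remains to divide by X^p - 1 = (X - 1)^p. *)
Lemma cofactor_circ (k : 'I_(p * m)) (l : 'I_m) :
  \sum_i wrap i * cofactor (circ a) i k =
  (\sum_(i < m) speed i * cofactor quo i l) ^+ p.
Proof.
have pP : p \in [pchar {poly R}] by rewrite pchar_poly.
pose a' k i j := (a k i j)%:P * 'X^k : {poly R}.
pose C' := \matrix_(i < p * m, j < p * m)
  ((circ a i j)%:P * (if (j %/ m < i %/ m)%N then 'X^p else 1)).
pose A' := \matrix_(i < m, j < m) \sum_(k < p) a' k i j.
have detC' : \det C' = \det A' ^+ p.
  rewrite -(det_block_circulant pP).
  (* Conjugation by [D] turns the exponent of a block, y - x mod p, into p if the block wraps around
     and into 0 otherwise. *)
  pose D := diag_mx (\row_(i < p * m) ('X^(i %/ m)%N : {poly R})).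
  have D0 : \det D != 0.
    by rewrite det_diag prodf_seq_neq0; apply/allP => i _; rewrite mxE -size_poly_eq0 size_polyXn.
  apply: (mulIf D0); rewrite -det_mulmx [RHS]mulrC -det_mulmx; congr (\det _).
  apply/matrixP => i j; rewrite mul_mx_diag mul_diag_mx !mxE /a' mulrCA -mulrA.
  congr (_ * _); have := divp i; have := divp j; move: (nat_of_ord j %/ m)%N (nat_of_ord i %/ m)%N => y x jp ip; case: (ltnP y x) => [ji|ij].
    rewrite -!exprD modn_small; last by lia.
    by congr 'X^_; lia.
  have -> : (y + (p - x) = y - x + p)%N by lia.
  rewrite modnDr modn_small; last by lia.
  by rewrite mul1r -exprD; congr 'X^_; lia.
pose q1 := \sum_i (wrap i)%:P * cofactor C' i k.
have dC' : \det C' = ('X^p - 1) * q1.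
  rewrite (det_row_sums _ k) mulr_sumr; apply: eq_bigr => i _; rewrite [RHS]mulrA.
  congr (_ * _); have := congr1 polyC (circ_rowsum i); rewrite polyC0 rmorph_sum /=.
  rewrite (bigID (fun j : 'I_(p * m) => (j %/ m < i %/ m)%N))/= => /eqP.
  rewrite addr_eq0 => /eqP e.
  rewrite (bigID (fun j : 'I_(p * m) => (j %/ m < i %/ m)%N))/= mulrBl mul1r mulrC.
  rewrite rmorph_sum /=; congr (_ + _).
    by rewrite mulr_suml; apply: eq_bigr => j ji; rewrite !mxE ji.
  rewrite e opprK.
  by apply: eq_bigr => j /negPf ji; rewrite !mxE ji mulr1.
pose q2 := \sum_(i < m) (\sum_(k < p) (\sum_(j < m) a k i j)%:P * \sum_(s < k) 'X^s) * cofactor A' i l.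
have dA' : \det A' = ('X - 1) * q2.
  rewrite (det_row_sums _ l) mulr_sumr; apply: eq_bigr => i _; rewrite [RHS]mulrA.
  congr (_ * _); under eq_bigr do rewrite mxE.
  rewrite exchange_big /= mulr_sumr.
  (* Subtracting this vanishing total replaces X^k by X^k - 1, a multiple of X - 1. *)
  have e : \sum_(k0 < p) (\sum_(j < m) a k0 i j)%:P = 0.
    by rewrite -rmorph_sum a_rowsum.
  rewrite -[LHS]subr0 -[X in _ - X]e -sumrB; apply: eq_bigr => k0 _.
  by rewrite -mulr_suml -rmorph_sum /= mulrCA -subrX1 mulrBr mulr1.
have X1 : ('X - 1 : {poly R}) ^+ p = 'X^p - 1.
  rewrite -!(pFrobenius_autE pP) pFrobenius_autB_comm ?pFrobenius_aut1//.
  exact: mulrC.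
have q12 : q1 = q2 ^+ p.
  have X10 : ('X^p - 1 : {poly R}) != 0 by rewrite -X1 expf_neq0 ?polyXsubC_eq0.
  by apply: (mulfI X10); rewrite -dC' detC' dA' exprMn X1.
have := congr1 (horner_eval 1) q12; rewrite /q1 /q2 rmorphXn !rmorph_sum /=.
have mapC : map_mx (horner_eval 1) C' = circ a.
  apply/matrixP => i j; rewrite !mxE /= horner_evalE hornerM hornerC.
  by case: ifP => _; rewrite ?hornerXn ?expr1n ?hornerC mulr1.
have mapA : map_mx (horner_eval 1) A' = quo.
  apply/matrixP => i j; rewrite !mxE rmorph_sum /=; apply: eq_bigr => k0 _.
  by rewrite horner_evalE hornerM hornerC hornerXn expr1n mulr1.
under eq_bigr do rewrite rmorphM /= -cofactor_map_mx mapC horner_evalE hornerC.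
move=> ->; congr (_ ^+ _); apply: eq_bigr => i _.
rewrite rmorphM /= -cofactor_map_mx mapA; congr (_ * _); rewrite rmorph_sum.
apply: eq_bigr => k0 _; rewrite rmorphM /= !horner_evalE hornerC -mulr_natr.
congr (_ * _).
rewrite horner_sum (eq_bigr (fun=> 1)) ?sumr_const ?card_ord//.
by move=> s _; rewrite hornerXn expr1n.
Qed.

(** The cofactors w of a column of the quotient form a left kernel vector. Lifted to the circulant
    matrix, it makes the cofactors in column k proportional to the repeated w. Weighting this by
    [wrap] and summing gives [delta] times one cofactor on one side and w_j [delta]^p on the other;
    in a domain one [delta] cancels. *)
Theorem cofactor_murasugi (k j : 'I_(p * m)) (l : 'I_m) :
  let delta := \sum_(i < m) speed i * cofactor quo i l in
  delta != 0 ->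
  cofactor (circ a) j k = cofactor quo (Ordinal (modm j)) l * delta ^+ p.-1.
Proof.
move=> delta d0.
have dA : \det quo = 0.
  rewrite (det_row_sums _ l) big1// => i _; under eq_bigr do rewrite mxE.
  by rewrite exchange_big /= a_rowsum// mul0r.
pose w := fun i => cofactor quo i l.
have wA j' : \sum_i w i * quo i j' = 0.
  have := congr1 (fun N : 'rV[R]_m => N 0 j') (cofactor_kernel_row l dA).
  by rewrite !mxE => e; rewrite -[RHS]e; apply: eq_bigr => i _; rewrite !mxE.
pose v := \row_(i < p * m) w (Ordinal (modm i)).
have vC : v *m circ a = 0.
  apply/rowP => x; rewrite [LHS]mxE mxE -[RHS](circ_mul x wA).
  by apply: eq_bigr => i _; rewrite mxE.
have cross i : wrap i * cofactor (circ a) i k * w (Ordinal (modm j)) =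
    w (Ordinal (modm i)) * wrap i * cofactor (circ a) j k.
  have := cofactor_left_kernel i j k vC; rewrite !mxE => e.
  by rewrite -mulrA [_ * w _]mulrC e mulrCA mulrA.
have : \sum_i wrap i * cofactor (circ a) i k * w (Ordinal (modm j)) =
   \sum_i w (Ordinal (modm i)) * wrap i * cofactor (circ a) j k.
  by apply: eq_bigr => i _; exact: cross.
rewrite -!mulr_suml (cofactor_circ k l) sum_wrap.
have -> : \sum_(i < m) w i * speed i = delta by rewrite /delta; apply: eq_bigr => i _; rewrite mulrC.
have -> : delta ^+ p = delta * delta ^+ p.-1 by rewrite -exprS prednK.
by rewrite -mulrA => /(mulfI d0) <-; rewrite mulrC.
Qed.

End Murasugi.

(** * Fitting ideals *)

(** Encoded as the intersection of all ideals containing [G], so that membership can be used by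
    induction. *)
Definition ideal_gen (S : comNzRingType) (G : S -> Prop) (x : S) : Prop :=
  forall I : S -> Prop, I 0 -> (forall u v, I u -> I v -> I (u + v)) ->
    (forall r u, I u -> I (r * u)) -> (forall g, G g -> I g) -> I x.

Section IdealGen.
Variables (S : comNzRingType) (G : S -> Prop).

Lemma ideal_gen_in x : G x -> ideal_gen G x.
Proof. by move=> Gx I _ _ _; apply. Qed.

Lemma ideal_gen0 : ideal_gen G 0.
Proof. by move=> I. Qed.

Lemma ideal_genD x y : ideal_gen G x -> ideal_gen G y -> ideal_gen G (x + y).
Proof. by move=> xG yG I I0 ID IM GI; apply: (ID); [apply: xG|apply: yG]. Qed.

Lemma ideal_genM r x : ideal_gen G x -> ideal_gen G (r * x).
Proof. by move=> xG I I0 ID IM GI; apply: (IM); apply: xG. Qed.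

Lemma ideal_genMr r x : ideal_gen G x -> ideal_gen G (x * r).
Proof. by rewrite mulrC; exact: ideal_genM. Qed.

Lemma ideal_gen_sum (I : Type) (r : seq I) (P : pred I) (F : I -> S) :
  (forall i, P i -> ideal_gen G (F i)) -> ideal_gen G (\sum_(i <- r | P i) F i).
Proof. by move=> FG; apply: (big_ind (ideal_gen G)) => //; exact: ideal_genD. Qed.

End IdealGen.

Lemma ideal_gen_sub (S : comNzRingType) (G G' : S -> Prop) x :
  (forall g, G g -> ideal_gen G' g) -> ideal_gen G x -> ideal_gen G' x.
Proof.
move=> GG' xG; apply: (xG (ideal_gen G')).
- exact: ideal_gen0.
- by move=> u v; exact: ideal_genD.
- by move=> r u; exact: ideal_genM.
- exact: GG'.
Qed.
(** Multilinearity in the rows. All maps f occur, not only the increasing ones of the Cauchy-Binet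
    formula; this is enough for membership in an ideal. *)
Lemma det_mulmx_rect (S : comNzRingType) (k n : nat) (P : 'M[S]_(k, n)) (B : 'M[S]_(n, k)) :
  \det (P *m B) = \sum_(f : {ffun 'I_k -> 'I_n}) (\prod_i P i (f i)) * \det (rowsub f B).
Proof.
rewrite /determinant; under [RHS]eq_bigr do rewrite mulr_sumr.
rewrite exchange_big; apply: eq_bigr => /= s _.
transitivity ((-1) ^+ s * \sum_(f : {ffun 'I_k -> 'I_n}) \prod_i (P i (f i) * B (f i) (s i))).
  congr (_ * _).
  rewrite -(bigA_distr_bigA (fun i j => P i j * B j (s i))) /=.
  by apply: eq_bigr => x _; rewrite mxE.
rewrite mulr_sumr; apply: eq_bigr => f _; rewrite mulrCA big_split /=.
by congr (_ * (_ * _)); apply: eq_bigr => i _; rewrite mxE.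
Qed.

(** The injection misses a single point i. So a minor of size n in a matrix of size n + 1 is a
    cofactor, up to sign and permutations. *)
Lemma ord_inj_lift (n : nat) (f : 'I_n -> 'I_n.+1) : injective f ->
  exists (i : 'I_n.+1) (s : {perm 'I_n}), forall j, f j = lift i (s j).
Proof.
move=> finj.
have [i iP] : exists i, i \notin codom f.
  apply/existsP; rewrite -negb_forall; apply/negP => /forallP all_codom.
  have : (#|'I_n.+1| <= #|codom f|)%N.
    by apply: subset_leq_card; apply/fintype.subsetP => i _; exact: all_codom.
  by rewrite card_codom// !card_ord ltnn.
have fi j : f j != i by apply: contra iP => /eqP <-; exact: codom_f.
pose g j := odflt j (unlift i (f j)).
have gE j : f j = lift i (g j).
  by rewrite /g; case: unliftP (fi j) => [k -> //|->]; rewrite eqxx.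
have ginj : injective g by move=> x y gxy; apply: finj; rewrite !gE gxy.
by exists i, (perm ginj) => j; rewrite /= permE.
Qed.

Section Minors.
Variables (S : comNzRingType) (n : nat) (A : 'M[S]_n.+1) (k : 'I_n.+1).
Hypothesis A1 : forall i, \sum_j A i j = 0.

Lemma det_rowsum0 : \det A = 0.
Proof. by rewrite (det_row_sums A k) big1// => i _; rewrite A1 mul0r. Qed.

(** The constant vector is a left kernel vector of the transpose. *)
Lemma cofactor_rowsum0 i j : cofactor A i j = cofactor A i k.
Proof.
pose v := \row_(j < n.+1) (1 : S).
have vA : v *m A^T = 0.
  by apply/rowP => l; rewrite !mxE -[RHS](A1 l); apply: eq_bigr => x _; rewrite !mxE mul1r.
have := cofactor_left_kernel j k i vA; rewrite !mxE !mul1r.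
by rewrite !cofactor_tr.
Qed.

Lemma minor_in_cofactors (f g : 'I_n -> 'I_n.+1) :
  ideal_gen (fun x => exists i, x = cofactor A i k) (\det (mxsub f g A)).
Proof.
have [/injectiveP finj|] := boolP (injectiveb f); last first.
  case/injectivePn => x [y xy fxy].
  rewrite (determinant_alternate xy); first exact: ideal_gen0.
  by move=> z; rewrite !mxE fxy.
have [/injectiveP ginj|] := boolP (injectiveb g); last first.
  case/injectivePn => x [y xy gxy].
  rewrite -det_tr (determinant_alternate xy); first exact: ideal_gen0.
  by move=> z; rewrite !mxE gxy.
have [i [s fE]] := ord_inj_lift finj; have [j [r gE]] := ord_inj_lift ginj.
have -> : mxsub f g A = row_perm s (col_perm r (row' i (col' j A))).
  by apply/matrixP => x y; rewrite !mxE fE gE.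
rewrite row_permE det_mulmx col_permE det_mulmx.
have e : \det (row' i (col' j A)) = (-1) ^+ (i + j) * cofactor A i k.
  by rewrite -(cofactor_rowsum0 i j) /cofactor mulrA -signr_odd -expr2 sqrr_sign mul1r.
apply: ideal_genM; apply: ideal_genMr; rewrite e.
by apply: ideal_genM; apply: ideal_gen_in; exists i.
Qed.

(** In the expansion along column k, the contribution of [P *m A] to that column sums to det P det A
    = 0. What is left are minors of [P *m A] avoiding column k, and these are combinations of minors
    of A. *)
Lemma det_rowspan (M : 'M[S]_n.+1) :
  (forall i, exists (P : 'rV_n.+1) q, row i M = P *m A + q *: delta_mx 0 k) ->
  ideal_gen (fun x => exists i, x = cofactor A i k) (\det M).
Proof.
move=> MA; have [h hP] : exists h : 'I_n.+1 -> 'rV[S]_n.+1 * S,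
    forall i, row i M = (h i).1 *m A + (h i).2 *: delta_mx 0 k.
  apply: (@fin_all_exists _ (fun=> 'rV[S]_n.+1 * S)%type
    (fun i z => row i M = z.1 *m A + z.2 *: delta_mx 0 k)) => i.
  by have [P [q e]] := MA i; exists (P, q).
pose P := \matrix_i (h i).1.
have PA i j : M i j = (P *m A) i j + (h i).2 *+ (j == k).
  have := congr1 (fun N : 'rV_n.+1 => N 0 j) (hP i); rewrite !mxE => ->.
  rewrite eqxx /= mulr_natr; congr (_ + _).
  by apply: eq_bigr => x _; rewrite !mxE.
rewrite (expand_det_col _ k); under eq_bigr do rewrite PA eqxx mulrDl.
have cE i : cofactor M i k = cofactor (P *m A) i k.
  rewrite /cofactor; congr (_ * \det _); apply/matrixP => x y; rewrite !mxE.
  by rewrite PA eq_sym (negPf (neq_lift _ _)) mulr0n addr0 mxE.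
rewrite big_split /= (eq_bigr (fun i => (P *m A) i k * cofactor (P *m A) i k)); last first.
  by move=> i _; rewrite cE.
rewrite -expand_det_col det_mulmx det_rowsum0 mulr0 add0r.
apply: ideal_gen_sum => i _; apply: ideal_genM; rewrite cE /cofactor.
apply: ideal_genM.
have -> : row' i (col' k (P *m A)) = row' i P *m col' k A.
  by apply/matrixP => x y; rewrite !mxE; apply: eq_bigr => z _; rewrite !mxE.
rewrite det_mulmx_rect; apply: ideal_gen_sum => f _; apply: ideal_genM.
have -> : rowsub f (col' k A) = mxsub f (lift k) A.
  by apply/matrixP => x y; rewrite !mxE.
exact: minor_in_cofactors.
Qed.

(** The witness is A with row i replaced by the k-th unit row. *)
Lemma cofactor_rowspan i : exists M : 'M[S]_n.+1, \det M = cofactor A i k /\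
  forall j, exists (P : 'rV_n.+1) q, row j M = P *m A + q *: delta_mx 0 k.
Proof.
exists (\matrix_j if j == i then delta_mx 0 k else row j A); split.
  rewrite (expand_det_row _ i) (bigD1 k)//= big1 ?addr0; last first.
    by move=> x xk; rewrite !mxE eqxx mxE eqxx (negPf xk) mul0r.
  rewrite !mxE eqxx mxE !eqxx mul1r /cofactor; congr (_ * \det _).
  by apply/matrixP => x y; rewrite !mxE eq_sym (negPf (neq_lift _ _)) !mxE.
move=> j; rewrite rowK; case: eqP => _.
  by exists 0, 1; rewrite mul0mx add0r scale1r.
by exists (delta_mx 0 j), 0; rewrite scale0r addr0 -rowE.
Qed.

End Minors.

Section Fitting.
Variables (S : comNzRingType) (T : Type).
(** A presented module is encoded by the class [C] of the maps from the set [T]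
    of its generators to arbitrary modules that satisfy the relations. *)
Variable C : forall X : lmodType S, (T -> X) -> Prop.

Definition relation (n : nat) (f : nat -> T) (a : 'rV[S]_n) : Prop :=
  forall (X : lmodType S) (c : T -> X), C c -> \sum_(j < n) a 0 j *: c (f j) = 0.

Definition generated (n : nat) (f : nat -> T) (y : T) : Prop :=
  exists g : 'rV[S]_n, forall (X : lmodType S) (c : T -> X), C c ->
    c y = \sum_(j < n) g 0 j *: c (f j).

(** The zeroth Fitting ideal. Rows range over all relations between the generators, so that no
    presentation has to be chosen. *)
Definition fitting (n : nat) (f : nat -> T) : S -> Prop :=
  ideal_gen (fun d => exists a : 'M[S]_n,
    (forall i, relation f (row i a)) /\ d = \det a).

Lemma fitting_redundant (n : nat) (f : nat -> T) (k : 'I_n.+1) :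
  generated n (f \o bump k) (f k) ->
  forall x, fitting n.+1 f x <-> fitting n (f \o bump k) x.
Proof.
move=> [g gP] x; split; apply: ideal_gen_sub => {}x [a [aR ->]].
  (* Column operations that substitute the expression g of generator k into the other columns. Off
     column k, the rows of [a *m U] are relations between the remaining generators, so the expansion
     along column k lies in the smaller ideal. *)
  pose U := \matrix_(i < n.+1, j < n.+1) if i == k then
    (if unlift k j is Some l then g 0 l else 1) else (i == j)%:R.
  have U1 : \det U = 1.
    rewrite (expand_det_col _ k) (bigD1 k)//= big1 ?addr0; last first.
      by move=> i ik; rewrite !mxE (negPf ik) mul0r.
    rewrite !mxE eqxx unlift_none mul1r /cofactor -signr_odd oddD addbb mul1r.
    rewrite -[RHS](det1 S n); congr (\det _); apply/matrixP => i j; rewrite !mxE.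
    by rewrite eq_sym (negPf (neq_lift _ _)) (inj_eq lift_inj).
  have aU i j : (a *m U) i j = if unlift k j is Some l then a i j + a i k * g 0 l else a i k.
    rewrite !mxE (bigD1 k)//= !mxE eqxx; case: unliftP => [l ->|->].
      rewrite (bigD1 (lift k l))//= ?[_ == k]eq_sym ?neq_lift// !mxE.
      rewrite [_ == k]eq_sym (negPf (neq_lift _ _)) eqxx mulr1 big1 ?addr0 1?addrC//.
      by move=> y /andP[yk yl]; rewrite !mxE (negPf yk) (negPf yl) mulr0.
    rewrite mulr1 big1 ?addr0// => y yk; rewrite !mxE (negPf yk) mulr0//.
  rewrite -[\det a]mulr1 -U1 -det_mulmx (expand_det_col _ k).
  apply: ideal_gen_sum => i _; do 2!apply: ideal_genM; apply: ideal_gen_in.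
  exists (row' i (col' k (a *m U))); split=> // l X c cC.
  have := aR (lift i l) X c cC; rewrite (bigD1_ord k)//= mxE gP// scaler_sumr -big_split /= => e.
  rewrite -[RHS]e; apply: eq_bigr => j _; rewrite ![in LHS]mxE.
  have := aU (lift i l) (lift k j); rewrite liftK mxE => ->.
  by rewrite scalerDl scalerA addrC mxE.
(* Conversely, a matrix of relations between the other generators is bordered by the relation
   expressing generator k, with coefficient -1 there. *)
pose b := \matrix_(i < n.+1, j < n.+1) if unlift k i is Some i' then
  (if unlift k j is Some j' then a i' j' else 0) else
  (if unlift k j is Some j' then g 0 j' else -1).
have -> : \det a = - \det b.
  rewrite (expand_det_col _ k) (bigD1 k)//= big1 ?addr0; last first.
    move=> i ik; rewrite !mxE unlift_none; case: unliftP ik => [i' _ _|->]; last by rewrite eqxx.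
    by rewrite mul0r.
  rewrite !mxE unlift_none mulN1r opprK /cofactor -signr_odd oddD addbb mul1r.
  by congr (\det _); apply/matrixP => i j; rewrite !mxE !liftK.
rewrite -mulN1r; apply: ideal_genM; apply: ideal_gen_in; exists b; split=> // i X c cC.
rewrite (bigD1_ord k)//= !mxE unlift_none.
case: (unliftP k i) => [i' ->|->].
  rewrite scale0r add0r -[RHS](aR i' X c cC); apply: eq_bigr => j _.
  by rewrite !mxE !liftK.
rewrite (gP X c cC) scaleN1r addrC; apply/eqP; rewrite subr_eq0; apply/eqP.
by apply: eq_bigr => j _; rewrite !mxE liftK unlift_none.
Qed.

Lemma eq_fitting (n : nat) (f f' : nat -> T) :
  (forall i, (i < n)%N -> f i = f' i) -> forall x, fitting n f x <-> fitting n f' x.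
Proof.
move=> ff' x; split; apply: ideal_gen_sub => y [a [aR ->]];
  apply: ideal_gen_in; exists a; split=> // i X c cC; rewrite -[RHS](aR i X c cC);
  by apply: eq_bigr => j _; rewrite ff'.
Qed.

Variable t0 : T.

Definition gen_by (s : seq T) (y : T) : Prop := generated (size s) (nth t0 s) y.

Lemma gen_byP s y : gen_by s y <->
  exists g : nat -> S, forall (X : lmodType S) (c : T -> X), C c ->
    c y = \sum_(j < size s) g j *: c (nth t0 s j).
Proof.
split=> [[g gP]|[g gP]].
  exists (fun j => if insub j is Some i then g 0 i else 0) => X c cC.
  by rewrite (gP X c cC); apply: eq_bigr => j _; rewrite valK.
exists (\row_j g j) => X c cC; rewrite (gP X c cC).
by apply: eq_bigr => j _; rewrite mxE.
Qed.

Lemma gen_by_catl s s' y : gen_by s y -> gen_by (s ++ s') y.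
Proof.
move=> /gen_byP[g gP]; apply/gen_byP; exists (fun j => if (j < size s)%N then g j else 0).
move=> X c cC; rewrite (gP X c cC) size_cat big_split_ord /=.
rewrite [X in _ + X]big1 ?addr0; last first.
  by move=> j _; rewrite ltnNge leq_addr scale0r.
by apply: eq_bigr => j _; rewrite nth_cat ltn_ord.
Qed.

Lemma gen_by_catr s s' y : gen_by s y -> gen_by (s' ++ s) y.
Proof.
move=> /gen_byP[g gP]; apply/gen_byP.
exists (fun j => if (j < size s')%N then 0 else g (j - size s')%N).
move=> X c cC; rewrite (gP X c cC) size_cat big_split_ord /=.
rewrite [X in _ = X + _]big1 ?add0r; last by move=> j _; rewrite ltn_ord scale0r.
apply: eq_bigr => j _; rewrite nth_cat ltnNge leq_addr /=.
by rewrite addnC addnK.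
Qed.

Lemma fitting_remove s1 y s2 x : gen_by (s1 ++ s2) y ->
  fitting (size (s1 ++ y :: s2)) (nth t0 (s1 ++ y :: s2)) x <->
  fitting (size (s1 ++ s2)) (nth t0 (s1 ++ s2)) x.
Proof.
move=> gy; have -> : size (s1 ++ y :: s2) = (size (s1 ++ s2)).+1.
  by rewrite !size_cat addnS.
have ks : (size s1 < (size (s1 ++ s2)).+1)%N by rewrite size_cat ltnS leq_addr.
have nE i : nth t0 (s1 ++ y :: s2) (bump (size s1) i) = nth t0 (s1 ++ s2) i.
  rewrite /bump !nth_cat; case: (leqP (size s1) i) => si.
    by rewrite add1n ltnNge (leq_trans si)//= subSn.
  by rewrite add0n si.
have yE : nth t0 (s1 ++ y :: s2) (size s1) = y by rewrite nth_cat ltnn subnn.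
pose f := nth t0 (s1 ++ y :: s2).
have gf : generated (size (s1 ++ s2)) (f \o bump (size s1)) (f (size s1)).
  rewrite /f yE; case: gy => g gP; exists g => X c cC; rewrite (gP X c cC).
  by apply: eq_bigr => j _; rewrite /= nE.
rewrite -/f (@fitting_redundant _ f (Ordinal ks) gf x).
by apply: eq_fitting => i _ /=; rewrite /f nE.
Qed.

Lemma fitting_catl s1 s2 x : (forall i, (i < size s2)%N -> gen_by s1 (nth t0 s2 i)) ->
  fitting (size (s1 ++ s2)) (nth t0 (s1 ++ s2)) x <-> fitting (size s1) (nth t0 s1) x.
Proof.
elim: s2 => [|y s2 IH] gen; first by rewrite cats0.
rewrite fitting_remove; first by apply: IH => i i2; exact: (gen i.+1).
by apply: gen_by_catl; exact: (gen 0%N).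
Qed.

Lemma fitting_catr s1 s2 x : (forall i, (i < size s1)%N -> gen_by s2 (nth t0 s1 i)) ->
  fitting (size (s1 ++ s2)) (nth t0 (s1 ++ s2)) x <-> fitting (size s2) (nth t0 s2) x.
Proof.
elim: s1 => [//|y s1 IH] gen.
rewrite (@fitting_remove [::]) /=; first by apply: IH => i i2; exact: (gen i.+1).
by apply: gen_by_catr; exact: (gen 0%N).
Qed.

(** Both lists are compared with their concatenation, from which the elements of either one can be
    removed one at a time. *)
Lemma fitting_generators s1 s2 x :
  (forall i, (i < size s2)%N -> gen_by s1 (nth t0 s2 i)) ->
  (forall i, (i < size s1)%N -> gen_by s2 (nth t0 s1 i)) ->
  fitting (size s1) (nth t0 s1) x <-> fitting (size s2) (nth t0 s2) x.
Proof. by move=> g1 g2; apply: iff_trans (iff_sym (fitting_catl _ g1)) (fitting_catr _ g2). Qed.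

End Fitting.

(** * Quotient modules *)

Section QuotientModule.
Variables (S : comNzRingType) (V : lmodType S) (N : V -> Prop).

Definition submodule : Prop :=
  [/\ N 0, forall u v, N u -> N v -> N (u + v) & forall a u, N u -> N (a *: u)].

Hypothesis subN : submodule.

(** [choose] returns the same element for equivalent predicates, so the representative depends on
    the coset only; the quotient is then the subtype of the vectors that represent themselves. *)
Definition coset_repr (v : V) : V := choose (fun u => `[<N (u - v)>]) v.

Let N0 : N 0. Proof. by case: subN. Qed.
Let ND u v : N u -> N v -> N (u + v). Proof. by case: subN => _ + _; apply. Qed.
Let NZ a u : N u -> N (a *: u). Proof. by case: subN => _ _; apply. Qed.
Let NN u : N u -> N (- u). Proof. by rewrite -scaleN1r; exact: NZ. Qed.

Lemma coset_reprP v : N (coset_repr v - v).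
Proof.
have Pv : (fun u => `[<N (u - v)>]) v by apply/asboolP; rewrite subrr.
by apply/asboolP; exact: (@chooseP _ (fun u => `[<N (u - v)>]) v Pv).
Qed.

Lemma coset_repr_eq u v : N (u - v) -> coset_repr u = coset_repr v.
Proof.
move=> uv; rewrite /coset_repr -(@eq_choose _ (fun w => `[<N (w - u)>])).
  by apply: choose_id; apply/asboolP; rewrite ?subrr// -opprB; exact: NN.
move=> w; apply/asbool_equiv_eq; split=> [wu|wv].
  by rewrite -(subrK u w) -addrA; exact: ND.
by rewrite -(subrK v w) -addrA; apply: ND => //; rewrite -opprB; exact: NN.
Qed.

(** The proof is a parameter so that instances can be inferred from the type. *)
Record quotient_module (subN : submodule) := QuotientModule {
  quotient_val  : V; quotient_valP : coset_repr quotient_val == quotient_val }.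

Local Notation Q := (quotient_module subN).

HB.instance Definition _ := [isSub of Q for @quotient_val subN].
HB.instance Definition _ := [Choice of Q by <:].

Lemma quotient_pi_subproof v : coset_repr (coset_repr v) == coset_repr v.
Proof. by apply/eqP/coset_repr_eq/coset_reprP. Qed.

Definition quotient_pi v : Q := QuotientModule subN (quotient_pi_subproof v).

Lemma quotient_valK q : quotient_pi (quotient_val q) = q.
Proof. by apply: val_inj; case: q => v /= /eqP. Qed.

Lemma quotient_pi_eq u v : N (u - v) -> quotient_pi u = quotient_pi v.
Proof. by move=> uv; apply: val_inj => /=; exact: coset_repr_eq. Qed.

Lemma quotient_pi_inj u v : quotient_pi u = quotient_pi v -> N (u - v).
Proof.
move=> /(congr1 (@quotient_val subN))/= uv; rewrite -(subrK (coset_repr u) u) -addrA.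
apply: ND; first by rewrite -opprB; apply/NN/coset_reprP.
by rewrite uv; exact: coset_reprP.
Qed.

Let add (p q : Q) : Q := quotient_pi (quotient_val p + quotient_val q).
Let opp (p : Q) : Q := quotient_pi (- quotient_val p).
Let scale a (p : Q) : Q := quotient_pi (a *: quotient_val p).

Let piD u v : add (quotient_pi u) (quotient_pi v) = quotient_pi (u + v).
Proof.
by apply: quotient_pi_eq => /=; rewrite opprD addrACA; apply: ND; exact: coset_reprP.
Qed.

Let piZ a u : scale a (quotient_pi u) = quotient_pi (a *: u).
Proof. by apply: quotient_pi_eq => /=; rewrite -scalerBr; apply/NZ/coset_reprP. Qed.

Let piN u : opp (quotient_pi u) = quotient_pi (- u).
Proof. by apply: quotient_pi_eq => /=; rewrite -opprD; apply/NN/coset_reprP. Qed.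

Let addA : associative add.
Proof.
move=> p q r; rewrite -(quotient_valK p) -(quotient_valK q) -(quotient_valK r).
by rewrite !piD addrA.
Qed.

Let addC : commutative add.
Proof. by move=> p q; rewrite /add addrC. Qed.

Let add0 : left_id (quotient_pi 0) add.
Proof. by move=> p; rewrite -(quotient_valK p) piD add0r. Qed.

Let addN : left_inverse (quotient_pi 0) opp add.
Proof. by move=> p; rewrite -(quotient_valK p) piN piD addNr. Qed.

HB.instance Definition _ := GRing.isZmodule.Build Q addA addC add0 addN.

Let scaleA a b p : scale a (scale b p) = scale (a * b) p.
Proof. by rewrite -(quotient_valK p) !piZ scalerA. Qed.

Let scale1 : left_id 1 scale.
Proof. by move=> p; rewrite -(quotient_valK p) piZ scale1r. Qed.

Let scaleDr : right_distributive scale +%R.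
Proof.
move=> a p q; rewrite -(quotient_valK p) -(quotient_valK q).
by rewrite [_ + _]piD !piZ [RHS]piD scalerDr.
Qed.

Let scaleDl p : {morph scale^~ p : a b / a + b}.
Proof. by move=> a b; rewrite -(quotient_valK p) !piZ [RHS]piD scalerDl. Qed.

HB.instance Definition _ := GRing.Zmodule_isLmodule.Build S Q
  scaleA scale1 scaleDr scaleDl.

Lemma quotient_piD u v : quotient_pi (u + v) = quotient_pi u + quotient_pi v.
Proof. by rewrite [RHS]piD. Qed.

Lemma quotient_piZ a u : quotient_pi (a *: u) = a *: quotient_pi u.
Proof. by rewrite [RHS]piZ. Qed.

Lemma quotient_pi0 : quotient_pi 0 = 0.
Proof. by []. Qed.

Lemma quotient_pi_sum (I : Type) (r : seq I) (P : pred I) (F : I -> V) :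
  quotient_pi (\sum_(i <- r | P i) F i) = \sum_(i <- r | P i) quotient_pi (F i).
Proof. by apply: (big_morph quotient_pi quotient_piD quotient_pi0). Qed.

Lemma quotient_pi_eq0 u : quotient_pi u = 0 <-> N u.
Proof.
split=> [e|Nu]; last by apply: quotient_pi_eq; rewrite subr0.
by rewrite -[u]subr0; exact: quotient_pi_inj.
Qed.

End QuotientModule.

(** * Colorings of a diagram and its Alexander ideal *)

Section LocallyConstant.
Variables (R : realType) (X : Type).
Implicit Types (c : R -> X) (r s t : R).

Definition left_const c r x := exists2 e, 0 < e & forall t, r - e < t < r -> c t = x.
Definition right_const c r x := exists2 e, 0 < e & forall t, r < t < r + e -> c t = x.

Lemma left_const_ext c c' r x e : 0 < e -> (forall t, r - e < t < r -> c' t = c t) ->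
  left_const c r x -> left_const c' r x.
Proof.
move=> e0 cc' [d d0 cx]; exists (Num.min d e) => [|t /andP[t1 t2]].
  by rewrite lt_min d0.
have h1 : Num.min d e <= d by rewrite ge_min lexx.
have h2 : Num.min d e <= e by rewrite ge_min lexx orbT.
by rewrite cc' ?cx// t2 andbT; lra.
Qed.

Lemma right_const_ext c c' r x e : 0 < e -> (forall t, r < t < r + e -> c' t = c t) ->
  right_const c r x -> right_const c' r x.
Proof.
move=> e0 cc' [d d0 cx]; exists (Num.min d e) => [|t /andP[t1 t2]].
  by rewrite lt_min d0.
have h1 : Num.min d e <= d by rewrite ge_min lexx.
have h2 : Num.min d e <= e by rewrite ge_min lexx orbT.
by rewrite cc' ?cx// t1/=; lra.
Qed.

Lemma right_const_inj c r x y : right_const c r x -> right_const c r y -> x = y.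
Proof.
move=> [d d0 cx] [e e0 cy].
have h0 : 0 < Num.min d e by rewrite lt_min d0.
have h1 : Num.min d e <= d by rewrite ge_min lexx.
have h2 : Num.min d e <= e by rewrite ge_min lexx orbT.
by rewrite -(cx (r + Num.min d e / 2)) ?(cy (r + Num.min d e / 2))//; apply/andP; split; lra.
Qed.

(** Connectedness of the interval: the supremum of the points up to which c keeps the value c s is
    attained by left constancy, and could be exceeded by right constancy if it were not t. *)
Lemma locally_const_itv c s t : s <= t ->
  (forall r, s < r <= t -> left_const c r (c r)) ->
  (forall r, s <= r < t -> right_const c r (c r)) -> c t = c s.
Proof.
move=> st lc rc.
pose A := [set r | s <= r <= t /\ forall r', s <= r' <= r -> c r' = c s].
have As : A s.
  by split; [rewrite lexx|move=> r' r's; congr c; apply/eqP; rewrite eq_le andbC].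
have supA : has_sup A.
  by split; [exists s|exists t => r [/andP[]]].
set m := sup A.
have sm : s <= m by apply: sup_upper_bound.
have mt : m <= t by apply: sup_le_ub; [exists s|move=> r [/andP[]]].
have below r : s <= r -> r < m -> c r = c s.
  move=> sr rm; have mr : 0 < m - r by rewrite subr_gt0.
  have [a [_ Aa] am] := sup_adherent mr supA.
  by apply: Aa; rewrite sr/=; move: am; rewrite -/m; lra.
have cm : c m = c s.
  have [->//|ms] := eqVneq m s.
  have sm' : s < m by rewrite lt_neqAle eq_sym ms.
  have [e e0 ce] : left_const c m (c m) by apply: lc; rewrite sm' mt.
  have h1 : Num.min (e / 2) ((m - s) / 2) <= e / 2 by rewrite ge_min lexx.
  have h2 : Num.min (e / 2) ((m - s) / 2) <= (m - s) / 2 by rewrite ge_min lexx orbT.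
  have h0 : 0 < Num.min (e / 2) ((m - s) / 2) by rewrite lt_min; apply/andP; split; lra.
  by rewrite -(ce (m - Num.min (e / 2) ((m - s) / 2))) ?below//; try (apply/andP; split); lra.
have [mE|mt'] := eqVneq m t; first by rewrite -mE.
have mltt : m < t by rewrite lt_neqAle mt'.
have [e e0 ce] : right_const c m (c m) by apply: rc; rewrite sm mltt.
have h1 : Num.min (e / 2) (t - m) <= e / 2 by rewrite ge_min lexx.
have h2 : Num.min (e / 2) (t - m) <= t - m by rewrite ge_min lexx orbT.
have h0 : 0 < Num.min (e / 2) (t - m) by rewrite lt_min; apply/andP; split; lra.
have : A (m + Num.min (e / 2) (t - m)).
  split=> [|r' /andP[r1 r2]]; first by apply/andP; split; lra.
  have [lt|gt|->] := ltgtP r' m; [exact: below| |exact: cm].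
  by rewrite -cm ce//; apply/andP; split; lra.
by move=> /(sup_upper_bound supA); rewrite -/m => mm; exfalso; lra.
Qed.

End LocallyConstant.

Section FracPart.
Variable R : realType.
Implicit Types (r s : R).

Definition frac r := r - (Num.floor r)%:~R.

Lemma frac_itv r : 0 <= frac r < 1.
Proof. by have := floor_itv r; rewrite /frac intrD1 => /andP[? ?]; apply/andP; split; lra. Qed.

Lemma fracDz r (k : int) : frac (r + k%:~R) = frac r.
Proof. by rewrite /frac floorDrz ?intr_int// intrKfloor intrD; lra. Qed.

Lemma frac_id r : 0 <= r < 1 -> frac r = r.
Proof. by move=> r01; rewrite /frac (@floor_def _ r 0) ?subr0//. Qed.

Lemma frac_uniq r (k : int) : 0 <= r + k%:~R < 1 -> frac r = r + k%:~R.
Proof. by move=> rk; rewrite -(fracDz r k) frac_id. Qed.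

Lemma fracK r : r = frac r + (Num.floor r)%:~R.
Proof. by rewrite /frac subrK. Qed.

Lemma same_paramP r s : same_param r s <-> exists k : int, s = r + k%:~R.
Proof.
split=> [/intrP[k e]|[k ->]]; first by exists k; rewrite -e addrC subrK.
by apply/intrP; exists k; rewrite addrC addKr.
Qed.

Lemma same_param_refl r : same_param r r.
Proof. by apply/same_paramP; exists 0; rewrite addr0. Qed.

Lemma same_param_sym r s : same_param r s -> same_param s r.
Proof. by rewrite !same_paramP => -[k ->]; exists (- k); rewrite intrN addrK. Qed.

Lemma same_param_trans r s t : same_param r s -> same_param s t -> same_param r t.
Proof. by rewrite !same_paramP => -[k ->] [l ->]; exists (k + l); rewrite intrD addrA. Qed.

Lemma same_param_frac r : same_param r (frac r).
Proof. by apply/same_paramP; exists (- Num.floor r); rewrite intrN. Qed.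

Lemma periodicz (X : Type) (c : R -> X) : (forall t, c (t + 1) = c t) ->
  forall t (k : int), c (t + k%:~R) = c t.
Proof.
move=> c1; have cn t (n : nat) : c (t + n%:R) = c t.
  by elim: n => [|n IH]; rewrite ?addr0// -natr1 addrA c1.
by move=> t [n|n]; rewrite ?cn// NegzE intrN -[in RHS](subrK (n.+1%:R) t) cn.
Qed.

Lemma periodic_same (X : Type) (c : R -> X) : (forall t, c (t + 1) = c t) ->
  forall s t, same_param s t -> c t = c s.
Proof. by move=> c1 s t /same_paramP[k ->]; exact: periodicz. Qed.

End FracPart.

(** Both sides are the ideal of the cofactors in column k, because zero row sums make the cofactors
    along a row equal. The unit row at k is the relation killing generator k; it turns minors of
    size n - 1 into determinants of size n, as in a Fitting ideal. *)
Lemma minor_ideal (S : comNzRingType) (n : nat) (A : 'M[S]_n) (k : 'I_n) x :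
  (forall i, \sum_j A i j = 0) ->
  (exists c : {ffun 'I_n.-1 -> 'I_n} -> {ffun 'I_n.-1 -> 'I_n} -> S,
     x = \sum_f \sum_g c f g * \det (mxsub f g A)) <->
  ideal_gen (fun d => exists M : 'M[S]_n,
    (forall i, exists (P : 'rV_n) q, row i M = P *m A + q *: delta_mx 0 k) /\ d = \det M) x.
Proof.
case: n A k => [? []//|n] A k A1 /=; split=> [[c ->]|].
  apply: (@ideal_gen_sub _ (fun x => exists i, x = cofactor A i k)) => [g [i ->]|].
    by have [M [<- MP]] := cofactor_rowspan A k i; apply: ideal_gen_in; exists M.
  do 2!apply: ideal_gen_sum => ? _; apply: ideal_genM.
  exact: minor_in_cofactors.
pose I (x : S) := exists c : {ffun 'I_n -> 'I_n.+1} -> {ffun 'I_n -> 'I_n.+1} -> S,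
     x = \sum_f \sum_g c f g * \det (mxsub f g A).
have I0 : I 0.
  by exists (fun _ _ => 0); rewrite big1// => f _; rewrite big1// => g _; rewrite mul0r.
have ID u v : I u -> I v -> I (u + v).
  move=> [c ->] [d ->]; exists (fun f g => c f g + d f g).
  rewrite -big_split; apply: eq_bigr => f _; rewrite -big_split; apply: eq_bigr => g _.
  by rewrite mulrDl.
have IM r u : I u -> I (r * u).
  move=> [c ->]; exists (fun f g => r * c f g).
  rewrite mulr_sumr; apply: eq_bigr => f _; rewrite mulr_sumr; apply: eq_bigr => g _.
  by rewrite mulrA.
move=> /(_ I I0 ID IM); apply=> d [M [MP ->]].
apply: (det_rowspan A1 MP I0 ID IM) => d' [i ->].
pose f0 := finfun (lift i); pose g0 := finfun (lift k).
exists (fun f g => if (f == f0) && (g == g0) then (-1) ^+ (i + k) else 0).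
rewrite (bigD1 f0)//= [X in _ + X]big1 ?addr0; last first.
  by move=> f /negPf ff0; rewrite big1// => g _; rewrite ff0 mul0r.
rewrite (bigD1 g0)//= big1 ?addr0; last by move=> g /negPf gg0; rewrite gg0 andbF mul0r.
rewrite !eqxx /cofactor; congr (_ * \det _).
by apply/matrixP => a b; rewrite !mxE !ffunE.
Qed.

Lemma nth_lt_count (R : realType) (l : seq R) r (i : nat) : sorted <%R l ->
  (i < size l)%N -> (nth 0 l i < r) = (i < count (< r)%R l)%N.
Proof.
move=> ls il; apply/idP/idP => [ir|].
  rewrite -(count_le_nth 0 ls il); apply: sub_count => x /= xi.
  exact: le_lt_trans xi ir.
apply: contraTT; rewrite -leNgt -leqNgt => ri.
rewrite -(count_lt_nth 0 ls il); apply: sub_count => x /= xr.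
exact: lt_le_trans xr ri.
Qed.

(** * Colorings and the relations of the Alexander matrix *)

Section Coloring.
Variable R : realType.
Implicit Types (D : diagram R) (r s t u v : R).

Definition under D u := exists s, is_over D s u.

Definition strand_sign D s u : int := sgz (crossing_det D s u).

(** The Alexander quandle: the label leaving an undercrossing of sign e, for x the incoming label
    and y the over label. It is a row of the Alexander matrix solved for the outgoing arc. *)
Definition quandle_op (X : lmodType laurent) (e : int) (x y : X) : X :=
  tpow (- e) *: x + (1 - tpow (- e)) *: y.

(** At an undercrossing, the value is the label of the incoming arc. *)
Definition coloring D (X : lmodType laurent) (c : R -> X) : Prop :=
  [/\ forall t, c (t + 1) = c t, forall r, left_const c r (c r),
      forall r, ~ under D r -> right_const c r (c r)
    & forall s r, is_over D s r ->
        right_const c r (quandle_op (strand_sign D s r) (c r) (c s))].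

Definition based_coloring D s0 (X : lmodType laurent) (c : R -> X) : Prop :=
  coloring D c /\ c s0 = 0.

Lemma derive1_curve_periodic D t : derive1 (curve D) (t + 1) = derive1 (curve D) t.
Proof.
rewrite /derive1; set F := fun h => _; set G := fun h => _.
suff -> : F = G by [].
by apply/funext => h; rewrite /F /G addrA !curve_periodic.
Qed.

Lemma crossing_det_same D s s' t t' : same_param s s' -> same_param t t' ->
  crossing_det D s' t' = crossing_det D s t.
Proof.
move=> ss tt; rewrite /crossing_det.
by rewrite (periodic_same (derive1_curve_periodic D) ss)
  (periodic_same (derive1_curve_periodic D) tt).
Qed.

Lemma is_double_sym D s t : is_double (curve D) s t -> is_double (curve D) t s.
Proof. by move=> [e st]; split=> // /same_param_sym. Qed.

Lemma over_unique D s s' u : is_over D s u -> is_over D s' u -> same_param s s'.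
Proof.
move=> /over_double/is_double_sym su /over_double/is_double_sym s'u.
exact: curve_double su s'u.
Qed.

Lemma under_same D u v : same_param u v -> under D u -> under D v.
Proof. by move=> uv [s su]; exists s; apply: over_same_param su; first exact: same_param_refl. Qed.

Lemma under_finite D :
  finite_set [set t | 0 <= t < 1 /\ exists s, is_over D s t].
Proof.
apply: sub_finite_set (curve_finite D) => t [t01 [s st]]; split=> //.
by exists s; exact: over_double st.
Qed.

Lemma mem_under D u : (u \in under_params D) = `[< 0 <= u < 1 /\ under D u >].
Proof.
rewrite mem_sort; apply/idP/asboolP.
  by rewrite in_fset_set ?inE//; exact: under_finite.
by move=> h; rewrite in_fset_set ?inE//; exact: under_finite.
Qed.

Lemma under_sorted D : sorted <%R (under_params D).
Proof. by rewrite lt_sorted_uniq_le sort_le_sorted sort_uniq fset_uniq. Qed.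

Lemma under_param_itv D i : (i < n_crossings D)%N -> 0 <= under_param D i < 1.
Proof. by move=> /(mem_nth 0); rewrite mem_under => /asboolP[]. Qed.

Lemma under_param_under D i : (i < n_crossings D)%N -> under D (under_param D i).
Proof. by move=> /(mem_nth 0); rewrite mem_under => /asboolP[]. Qed.

Lemma under_paramE D u : 0 <= u < 1 -> under D u ->
  exists2 i, (i < n_crossings D)%N & u = under_param D i.
Proof.
move=> u01 uU; have : u \in under_params D by rewrite mem_under; apply/asboolP.
by move=> /(nthP 0)[i iu <-]; exists i.
Qed.

Lemma over_paramP D i : (i < n_crossings D)%N ->
  0 <= over_param D i < 1 /\ is_over D (over_param D i) (under_param D i).
Proof.
move=> iD; rewrite /over_param; case: xgetP => [x -> []//|].
have [s su] := under_param_under iD => /(_ (frac s)) []; split; first exact: frac_itv.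
by apply: over_same_param su; [exact: same_param_frac|exact: same_param_refl].
Qed.

(** Takes the values 0 to n; the value n, after the last undercrossing of a period, stands for arc 0
    of the next period, hence the later reductions mod n. *)
Definition arc_index D r := count (< frac r)%R (under_params D).

Lemma arc_index_le D r : (arc_index D r <= n_crossings D)%N.
Proof. exact: count_size. Qed.

Lemma arc_indexDz D r (k : int) : arc_index D (r + k%:~R) = arc_index D r.
Proof. by rewrite /arc_index fracDz. Qed.

Lemma over_arcE D i : (i < n_crossings D)%N ->
  over_arc D i = (arc_index D (over_param D i) %% n_crossings D)%N.
Proof. by move=> /over_paramP[s01 _]; rewrite /over_arc /arc_index frac_id. Qed.

Lemma lt_arc_index D r i : (i < n_crossings D)%N ->
  (under_param D i < frac r) = (i < arc_index D r)%N.
Proof. by move=> iD; rewrite nth_lt_count//; exact: under_sorted. Qed.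

Lemma seq_isolated (l : seq R) r : exists2 e, 0 < e &
  forall u, u \in l -> u != r -> e <= `|u - r|.
Proof.
elim: l => [|x l [e e0 IH]]; first by exists 1.
have [->|xr] := eqVneq x r.
  by exists e => // u; rewrite inE => /orP[/eqP->|/IH//]; rewrite eqxx.
exists (Num.min e `|x - r|) => [|u]; first by rewrite lt_min e0 normr_gt0 subr_eq0.
rewrite inE => /orP[/eqP-> _|/IH ue ur]; first by rewrite ge_min lexx orbT.
by rewrite ge_min ue.
Qed.

Lemma periodic_isolated (P : R -> Prop) r :
  (forall u v, same_param u v -> P u -> P v) -> finite_set [set t | 0 <= t < 1 /\ P t] ->
  exists2 e, 0 < e & forall u, P u -> u != r -> e <= `|u - r|.
Proof.
move=> Psame Pfin; pose l : seq R := fset_set [set t | 0 <= t < 1 /\ P t].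
have lE u : P u -> frac u \in l.
  move=> Pu; rewrite in_fset_set// inE /=; split; first exact: frac_itv.
  exact: Psame (same_param_frac u) Pu.
(* The translates by -1, 0 and 1 suffice: a point at distance less than 1 from r, moved back by the
   floor of r, lies between -1 and 2. *)
pose W := [seq x + k%:~R | x <- l, k <- [:: -1; 0; 1] : seq int].
have [e e0 eW] := seq_isolated W (frac r).
exists (Num.min e 1) => [|u uU ur]; first by rewrite lt_min e0 ltr01.
rewrite ge_min; have [|u1] := leP 1 `|u - r|; first by rewrite orbT.
rewrite orbF; pose v := u + (- Num.floor r)%:~R.
have vE : v - frac r = u - r by rewrite /v /frac intrN; lra.
rewrite -vE; apply: eW; last by rewrite -subr_eq0 vE subr_eq0.
rewrite (fracK v); apply/allpairsP; exists (frac v, Num.floor v); split => //=.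
  apply/lE/(Psame u) => //; apply/same_paramP; by exists (- Num.floor r).
have /andP[r0 r1] := frac_itv r.
have : -1 < v < 2 by move: u1; rewrite -vE ltr_norml => /andP[? ?]; apply/andP; split; lra.
move=> /andP[v1 v2]; have /andP[f1 f2] := floor_itv v.
have {}f1 : ((Num.floor v)%:~R : R) < 2%:~R by apply: le_lt_trans f1 v2.
have {}f2 : (((-1)%:~R : R) < (Num.floor v + 1)%:~R) by apply: lt_trans f2.
by move: f1 f2; rewrite !ltr_int !inE; lia.
Qed.

Lemma under_isolated D r : exists2 e, 0 < e &
  forall u, under D u -> u != r -> e <= `|u - r|.
Proof. by apply: periodic_isolated (under_finite D) => u v; exact: under_same. Qed.

Lemma coloring_const D (X : lmodType laurent) (c : R -> X) s t : coloring D c -> s <= t ->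
  (forall r, s <= r < t -> ~ under D r) -> c t = c s.
Proof.
move=> [c1 lc rc _] st nu; apply: locally_const_itv => // r rst.
by apply/rc/nu.
Qed.

(** A coloring is constant from r up to and including the next undercrossing, where by left
    constancy it still has the incoming label. *)
Lemma coloring_arc D (X : lmodType laurent) (c : R -> X) r : coloring D c ->
  (0 < n_crossings D)%N -> c r = c (under_param D (arc_index D r %% n_crossings D)%N).
Proof.
move=> cc n0; have [c1 _ _ _] := cc.
rewrite (periodic_same c1 (same_param_sym (same_param_frac r))).
have /andP[f0 f1] := frac_itv r; have := arc_index_le D r.
have ltE := @lt_arc_index D r; set f := frac r in f0 f1 ltE *.
set k := arc_index D r in ltE *; rewrite leq_eqVlt => /orP[/eqP kn|kn].
  (* Past the last undercrossing of the period, the next one is the first one translated by 1. *)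
  rewrite kn modnn.
  have /andP[u0 u1] := under_param_itv n0.
  rewrite -(periodicz c1 (under_param D 0) 1); apply/esym/(coloring_const cc); first by rewrite mulr1z; lra.
  move=> v /andP[fv vu] vU; have [v1|v1] := ltP v 1.
    have [j jn vE] : exists2 i, (i < n_crossings D)%N & v = under_param D i.
      by apply: under_paramE => //; apply/andP; split; lra.
    by move: fv; rewrite vE leNgt; rewrite ltE// kn jn.
  have [j jn vE] : exists2 i, (i < n_crossings D)%N & v - 1 = under_param D i.
    apply: under_paramE; first by apply/andP; split; move: vu; rewrite mulr1z; lra.
    by apply: under_same vU; apply/same_paramP; exists (-1); rewrite intrN.
  have : under_param D j < under_param D 0 by rewrite -vE; move: vu; rewrite mulr1z; lra.
  rewrite /under_param ltNge sorted_leq_nth// ?inE//.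
    exact: le_trans.
  by rewrite sort_le_sorted.
rewrite modn_small//; have ku : f <= under_param D k by rewrite leNgt ltE// ltnn.
apply/esym/(coloring_const cc) => // v /andP[fv vu] vU.
have /andP[u0 u1] := under_param_itv kn.
have [j jn vE] : exists2 i, (i < n_crossings D)%N & v = under_param D i.
  by apply: under_paramE => //; apply/andP; split; lra.
have kj : (k <= j)%N by rewrite leqNgt -ltE// -vE -leNgt.
have : under_param D k <= under_param D j.
  rewrite /under_param sorted_leq_nth ?inE//; first exact: le_trans.
  by rewrite sort_le_sorted.
by rewrite -vE leNgt vu.
Qed.

(** At an integer r the index drops from n, on the left, to 0; this is why only a congruence
    holds. *)
Lemma arc_index_left D r : exists2 e, 0 < e & forall t, r - e < t < r ->
  (arc_index D t = arc_index D r %[mod n_crossings D])%N.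
Proof.
have [e e0 eU] := under_isolated D r; have /andP[f0 f1] := frac_itv r.
have aE t : arc_index D t = arc_index D (t - (Num.floor r)%:~R) by rewrite -intrN arc_indexDz.
have [fr0|fr0] := eqVneq (frac r) 0.
  exists (Num.min e 1); first by rewrite lt_min e0 ltr01.
  move=> t /andP[t1 t2]; rewrite [X in _ = (X %% _)%N]/arc_index fr0.
  have h1 : Num.min e 1 <= e by rewrite ge_min lexx.
  have h2 : Num.min e 1 <= 1 by rewrite ge_min lexx orbT.
  have -> : count (< 0)%R (under_params D) = 0%N.
    apply/eqP; rewrite -leqn0 leqNgt -has_count -all_predC; apply/allP => u.
    by rewrite mem_under => /asboolP[/andP[u0 _] _]; rewrite /= -leNgt.
  have rE : r = (Num.floor r)%:~R by rewrite {1}(fracK r) fr0 add0r.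
  have tE : frac t = t - r + 1.
    rewrite (@frac_uniq _ _ (1 - Num.floor r)) intrD intrN -rE mulr1z; first lra.
    by apply/andP; split; lra.
  rewrite mod0n /arc_index (_ : count _ _ = n_crossings D) ?modnn//.
  apply/eqP; rewrite -all_count; apply/allP => u; rewrite mem_under => /asboolP[/andP[u0 u1] uU] /=.
  have /eU : under D (u + (Num.floor r - 1)%:~R).
    by apply: under_same uU; apply/same_paramP; exists (Num.floor r - 1).
  rewrite intrD intrN -rE tE mulr1z => /(_ _) h.
  have {}h : e <= `|u + (r - 1) - r| by apply: h; apply/eqP; lra.
  by move: h; rewrite (_ : u + (r - 1) - r = - (1 - u)); [rewrite normrN ger0_norm; lra|lra].
exists (Num.min e (frac r)); first by rewrite lt_min e0 lt_neqAle eq_sym fr0.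
move=> t /andP[t1 t2]; congr (_ %% _)%N.
have h1 : Num.min e (frac r) <= e by rewrite ge_min lexx.
have h2 : Num.min e (frac r) <= frac r by rewrite ge_min lexx orbT.
have tE : frac t = t - (Num.floor r)%:~R.
  rewrite (@frac_uniq _ _ (- Num.floor r)) intrN//.
  by move: h2 f1; rewrite /frac => h2 f1; apply/andP; split; lra.
apply: eq_in_count => u; rewrite mem_under => /asboolP[u01 uU] /=; rewrite tE.
apply/idP/idP => [ut|ur]; first by rewrite /frac; lra.
rewrite ltNge; apply/negP => ut.
have /eU : under D (u + (Num.floor r)%:~R).
  by apply: under_same uU; apply/same_paramP; exists (Num.floor r).
move: ur; rewrite /frac => ur /(_ _) h.
have {}h : e <= `|u + (Num.floor r)%:~R - r| by apply: h; apply/eqP; lra.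
by move: h; rewrite ler0_norm; lra.
Qed.

Lemma arc_index_right D r : exists2 e, 0 < e & forall t, r < t < r + e ->
  arc_index D t = count (<= frac r)%R (under_params D).
Proof.
have [e e0 eU] := under_isolated D r; have /andP[f0 f1] := frac_itv r.
exists (Num.min e (1 - frac r)); first by rewrite lt_min e0 subr_gt0.
move=> t /andP[t1 t2].
have h1 : Num.min e (1 - frac r) <= e by rewrite ge_min lexx.
have h2 : Num.min e (1 - frac r) <= 1 - frac r by rewrite ge_min lexx orbT.
have tE : frac t = t - (Num.floor r)%:~R.
  rewrite (@frac_uniq _ _ (- Num.floor r)) intrN//.
  by move: h2 f0; rewrite /frac => h2 f0; apply/andP; split; lra.
apply: eq_in_count => u; rewrite mem_under => /asboolP[u01 uU] /=; rewrite tE.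
apply/idP/idP => [ut|ur]; last by move: ur; rewrite /frac; lra.
rewrite leNgt; apply/negP => ur.
have /eU : under D (u + (Num.floor r)%:~R).
  by apply: under_same uU; apply/same_paramP; exists (Num.floor r).
move: ur; rewrite /frac => ur /(_ _) h.
have {}h : e <= `|u + (Num.floor r)%:~R - r| by apply: h; apply/eqP; lra.
by move: h; rewrite ger0_norm; lra.
Qed.

Lemma count_le_arc D r : ~ under D r ->
  count (<= frac r)%R (under_params D) = arc_index D r.
Proof.
move=> rU; apply: eq_in_count => u; rewrite mem_under => /asboolP[_ uU] /=.
rewrite le_eqVlt; case: eqVneq => //= e; case: rU; apply: under_same uU.
by rewrite e; exact/same_param_sym/same_param_frac.
Qed.

Lemma count_le_under D i : (i < n_crossings D)%N ->
  count (<= under_param D i)%R (under_params D) = i.+1.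
Proof. by move=> iD; rewrite count_le_nth//; exact: under_sorted. Qed.

Lemma left_const_same (X : Type) (c : R -> X) r r' x : (forall t, c (t + 1) = c t) ->
  same_param r r' -> left_const c r x -> left_const c r' x.
Proof.
move=> c1 /same_paramP[k ->] [e e0 ce]; exists e => // t /andP[t1 t2].
rewrite -(periodicz c1 t (- k)); apply: ce.
by rewrite intrN; apply/andP; split; lra.
Qed.

Lemma right_const_same (X : Type) (c : R -> X) r r' x : (forall t, c (t + 1) = c t) ->
  same_param r r' -> right_const c r x -> right_const c r' x.
Proof.
move=> c1 /same_paramP[k ->] [e e0 ce]; exists e => // t /andP[t1 t2].
rewrite -(periodicz c1 t (- k)); apply: ce.
by rewrite intrN; apply/andP; split; lra.
Qed.

(** With [coloring_relation], this identifies colorings with solutions of the Alexander relations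
    when there are crossings: the label of an arc is the value at the undercrossing where it
    ends. *)
Lemma coloring_of_vector D (X : lmodType laurent) (x : nat -> X) :
  (forall i, (i < n_crossings D)%N -> x (i.+1 %% n_crossings D)%N =
     quandle_op (crossing_sign D i) (x i) (x (over_arc D i))) ->
  coloring D (fun r => x (arc_index D r %% n_crossings D)%N).
Proof.
move=> xA; set c := fun r => _.
have c1 t : c (t + 1) = c t by rewrite /c -(arc_indexDz D t 1) mulr1z.
split=> // [r|r rU|s r sr].
- have [e e0 ae] := arc_index_left D r; exists e => // t /ae.
  by rewrite /c => ->.
- have [e e0 ae] := arc_index_right D r; exists e => // t /ae.
  by rewrite /c => ->; rewrite count_le_arc.
have fU : under D (frac r) by apply: under_same (same_param_frac r) _; exists s.
have [i iD iE] := under_paramE (frac_itv r) fU.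
have [s01 oi] := over_paramP iD.
have soi : is_over D s (under_param D i).
  by rewrite -iE; apply: over_same_param (same_param_refl s) (same_param_frac r) sr.
have -> : strand_sign D s r = crossing_sign D i.
  have ru : same_param r (under_param D i) by rewrite -iE; exact: same_param_frac.
  by rewrite /strand_sign /crossing_sign (crossing_det_same _ (over_unique soi oi) ru).
have -> : c r = x i.
  rewrite /c /arc_index iE count_lt_nth ?modn_small//.
  exact: under_sorted.
have -> : c s = x (over_arc D i).
  by rewrite (periodic_same c1 (over_unique oi soi)) /c over_arcE.
have [e e0 ae] := arc_index_right D r; exists e => // t /ae.
by rewrite /c => ->; rewrite iE count_le_under// xA.
Qed.

Lemma coloring_relation D (X : lmodType laurent) (c : R -> X) i : coloring D c ->
  (i < n_crossings D)%N -> c (under_param D (i.+1 %% n_crossings D)%N) =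
     quandle_op (crossing_sign D i) (c (under_param D i)) (c (under_param D (over_arc D i))).
Proof.
move=> cc iD; have [c1 _ _ cu] := cc; have [s01 oi] := over_paramP iD.
have n0 : (0 < n_crossings D)%N by apply: leq_ltn_trans iD.
rewrite over_arcE// -(coloring_arc (over_param D i) cc n0).
apply: right_const_inj (cu _ _ oi).
have [e e0 ae] := arc_index_right D (under_param D i); exists e => // t /ae.
rewrite frac_id ?under_param_itv// count_le_under// => aE.
by rewrite (coloring_arc t cc n0) aE.
Qed.

Definition alexander_action D (X : lmodType laurent) (x : nat -> X) i :=
  \sum_j alexander_matrix D i j *: x j.

Lemma over_arc_lt D i : (i < n_crossings D)%N -> (over_arc D i < n_crossings D)%N.
Proof. by move=> iD; rewrite over_arcE// ltn_mod (leq_ltn_trans _ iD). Qed.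

Lemma alexander_actionE D (X : lmodType laurent) (x : nat -> X) (i : 'I_(n_crossings D)) :
  alexander_action x i = quandle_op (crossing_sign D i) (x i) (x (over_arc D i))
    - x (i.+1 %% n_crossings D)%N.
Proof.
rewrite /alexander_action; under eq_bigr do rewrite mxE !scalerDl scaleNr.
have pick (a : laurent) (k : nat) (kD : (k < n_crossings D)%N) :
    \sum_(j < n_crossings D) (a *+ (j == k :> nat)) *: x j = a *: x k.
  rewrite (bigD1 (Ordinal kD))//= eqxx big1 ?addr0// => j.
  by rewrite -val_eqE /= => /negPf ->; rewrite scale0r.
have iD := ltn_ord i; have n0 : (0 < n_crossings D)%N by apply: leq_ltn_trans iD.
rewrite !big_split /= sumrN !(pick _ (nat_of_ord i), pick _ (i.+1 %% _)%N, pick _ (over_arc D i)) ?over_arc_lt ?ltn_mod//.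
by rewrite scale1r /quandle_op addrAC.
Qed.

(** Constant labels satisfy the crossing relations, since x acting on itself gives x. *)
Lemma alexander_matrix_rowsum D i : \sum_j alexander_matrix D i j = 0.
Proof.
have := alexander_actionE (fun=> 1 : laurent^o) i.
rewrite /alexander_action /quandle_op -scalerDl [tpow _ + _]addrC subrK scale1r subrr.
by move=> e; rewrite -[RHS]e; apply: eq_bigr => j _; rewrite -[LHS]mulr1.
Qed.

(** The relations holding in every coloring that vanishes at [s0] form the span [N] of the rows of
    the matrix and of the unit row of the arc of [s0]. That they lie in [N] is seen by evaluating
    them on the coloring by the basis vectors of the free module modulo [N]. *)
Theorem alexander_fitting D s0 x :
  alexander_ideal D x <->
  fitting (based_coloring D s0) (n_crossings D) (under_param D) x.
Proof.
rewrite /alexander_ideal /=.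
(* Without undercrossings both ideals are the whole ring, the empty determinant being 1. *)
have [n0|n0] := posnP (n_crossings D).
  split=> _; last first.
    exists (fun _ _ => x); move: (alexander_matrix D); rewrite n0 => A.
    have u1 : (forall f : {ffun 'I_0 -> 'I_0}, f = [ffun i => i]).
      by move=> f; apply/ffunP => -[].
    rewrite (bigD1 [ffun i => i])//= [X in _ + X]big1 ?addr0; last first.
      by move=> f /eqP; rewrite [f]u1.
    rewrite (bigD1 [ffun i => i])//= big1 ?addr0; last by move=> f /eqP; rewrite [f]u1.
    by rewrite det_mx00 mulr1.
  rewrite n0 -[x]mulr1; apply: ideal_genM; apply: ideal_gen_in; exists 1%:M.
  by split=> [[]//|]; rewrite det1.
pose k := Ordinal (ltn_pmod (arc_index D s0) n0).
rewrite (minor_ideal k _ (@alexander_matrix_rowsum D)).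
pose N (a : 'rV[laurent]_(n_crossings D)) := exists (P : 'rV_(n_crossings D)) q,
  a = P *m alexander_matrix D + q *: delta_mx 0 k.
have subN : submodule N.
  split; first by exists 0, 0; rewrite mul0mx scale0r addr0.
    move=> u v [P [q ->]] [P' [q' ->]]; exists (P + P'), (q + q').
    by rewrite mulmxDl scalerDl addrACA.
  move=> a u [P [q ->]]; exists (a *: P), (a * q).
  by rewrite scalerDr scalerA scalemxAl.
suff relN a : relation (based_coloring D s0) (under_param D) a <-> N a.
  split; apply: ideal_gen_sub => d [M [MP ->]]; apply: ideal_gen_in; exists M; split=> // i.
    by apply/relN.
  by have /relN := MP i.
split=> [aR|[P [q ->]] X c [cc c0]].
  pose x' (i : nat) := if insub i is Some j then quotient_pi subN (delta_mx 0 j) else 0.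
  have x'E (j : 'I_(n_crossings D)) : x' j = quotient_pi subN (delta_mx 0 j).
    by rewrite /x' valK.
  have sumE (b : 'rV_(n_crossings D)) : \sum_j b 0 j *: x' j = quotient_pi subN b.
    rewrite {2}(row_sum_delta b) quotient_pi_sum; apply: eq_bigr => j _.
    by rewrite x'E quotient_piZ.
  have x'A i : (i < n_crossings D)%N -> x' (i.+1 %% n_crossings D)%N =
      quandle_op (crossing_sign D i) (x' i) (x' (over_arc D i)).
    move=> iD; apply/esym/eqP; rewrite -subr_eq0; apply/eqP.
    rewrite -(alexander_actionE _ (Ordinal iD)) /alexander_action.
    transitivity (quotient_pi subN (row (Ordinal iD) (alexander_matrix D))).
      by rewrite -sumE; apply: eq_bigr => j _; rewrite [row _ _ _ _]mxE.
    apply/quotient_pi_eq0; exists (delta_mx 0 (Ordinal iD)), 0.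
    by rewrite scale0r addr0 -rowE.
  have cc := coloring_of_vector x'A.
  have c0 : x' (arc_index D s0 %% n_crossings D)%N = 0.
    rewrite -[(_ %% _)%N]/(val k) x'E; apply/quotient_pi_eq0.
    by exists 0, 1; rewrite mul0mx add0r scale1r.
  have := aR _ _ (conj cc c0).
  rewrite -(quotient_pi_eq0 subN) -sumE => h; rewrite -[RHS]h.
  apply: eq_bigr => j _; congr (_ *: x' _).
  rewrite /arc_index frac_id ?under_param_itv// count_lt_nth ?modn_small//.
  exact: under_sorted.
have rowA i : \sum_j alexander_matrix D i j *: c (under_param D j) = 0.
  rewrite -/(alexander_action (c \o under_param D) i) alexander_actionE /=.
  by rewrite -coloring_relation// subrr.
under eq_bigr do rewrite !mxE scalerDl scaler_suml.
rewrite big_split exchange_big /= big1 ?add0r; last first.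
  move=> i _; under eq_bigr do rewrite -scalerA.
  by rewrite -scaler_sumr rowA scaler0.
rewrite (bigD1 k)//= eqxx mulr1 -(coloring_arc s0 cc n0) c0 scaler0 add0r.
by rewrite big1// => j /negPf jk; rewrite jk mulr0 scale0r.
Qed.

End Coloring.

(** * Spanning families of parameters and comparison of Alexander ideals *)

Section Spanning.
Variable R : realType.
Implicit Types (D : diagram R) (r s t u v : R) (l : seq R).

(** The coefficients are the same for all modules and all colorings: the generator y is a
    combination of those in [l] in the universal coloring module. *)
Definition spanned D l y := exists g : nat -> laurent,
  forall (X : lmodType laurent) (c : R -> X), coloring D c ->
    c y = \sum_(j < size l) g j *: c (nth 0 l j).

Lemma spanned_gen D s0 l y : spanned D l y -> gen_by (based_coloring D s0) 0 l y.
Proof. by move=> [g gP]; apply/gen_byP; exists g => X c [cc _]; exact: gP. Qed.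

Lemma spanned_mem D l y : y \in l -> spanned D l y.
Proof.
move=> yl; exists (fun j => (j == index y l)%:R) => X c cc.
have il : (index y l < size l)%N by rewrite index_mem.
rewrite (bigD1 (Ordinal il))//= eqxx scale1r nth_index// big1 ?addr0// => j.
by rewrite -val_eqE /= => /negPf ->; rewrite scale0r.
Qed.

Lemma spanned_eq D l y z :
  (forall (X : lmodType laurent) (c : R -> X), coloring D c -> c y = c z) ->
  spanned D l z -> spanned D l y.
Proof. by move=> yz [g gP]; exists g => X c cc; rewrite (yz X c cc) gP. Qed.

Lemma spanned_op D l e y z w :
  (forall (X : lmodType laurent) (c : R -> X), coloring D c -> c y = quandle_op e (c z) (c w)) ->
  spanned D l z -> spanned D l w -> spanned D l y.
Proof.
move=> yzw [g gP] [h hP].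
exists (fun j => tpow (- e) * g j + (1 - tpow (- e)) * h j) => X c cc.
rewrite (yzw X c cc) /quandle_op (gP X c cc) (hP X c cc) !scaler_sumr -big_split /=.
by apply: eq_bigr => j _; rewrite [in RHS]scalerDl !scalerA.
Qed.

Lemma under_params_gen D s0 y : gen_by (based_coloring D s0) 0 (under_params D) y.
Proof.
have [n0|n0] := posnP (n_crossings D).
  (* The list is empty here: colorings are constant, and zero because of the base point. *)
  exists 0 => X c [cc c0].
  have noU u : ~ under D u.
    move=> uU; have fU : under D (frac u) by apply: under_same (same_param_frac u) uU.
    by have [i] := under_paramE (frac_itv u) fU; rewrite n0.
  have -> : c y = c s0.
    have [ys|sy] := leP y s0; first by apply/esym/(coloring_const cc).
    by apply: (coloring_const cc) => //; exact: ltW.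
  by rewrite c0 big1// => j _; rewrite mxE scale0r.
apply/gen_byP; exists (fun j => (j == arc_index D y %% n_crossings D)%N%:R) => X c [cc _].
rewrite (coloring_arc y cc n0) (bigD1 (Ordinal (ltn_pmod (arc_index D y) n0)))//=.
rewrite eqxx scale1r big1 ?addr0// => j.
by rewrite -val_eqE /= => /negPf ->; rewrite scale0r.
Qed.

(** A Fitting ideal can be computed from any list that generates all undercrossings, and then
    depends only on the relations over this list. *)
Lemma alexander_ideal_relation D D' s0 s0' l l' : size l = size l' ->
  (forall u, under D u -> spanned D l u) -> (forall u, under D' u -> spanned D' l' u) ->
  (forall a : 'rV_(size l), relation (based_coloring D s0) (nth 0 l) a <->
     relation (based_coloring D' s0') (fun i => nth 0 l' i) a) ->
  alexander_ideal D = alexander_ideal D'.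
Proof.
move=> sl lD lD' rel.
have genE D1 s1 l1 x : (forall u, under D1 u -> spanned D1 l1 u) ->
    fitting (based_coloring D1 s1) (n_crossings D1) (under_param D1) x <->
    fitting (based_coloring D1 s1) (size l1) (nth 0 l1) x.
  move=> sp; apply: fitting_generators => i iD.
    exact: under_params_gen.
  exact/spanned_gen/sp/under_param_under.
have idE D1 s1 l1 x : (forall u, under D1 u -> spanned D1 l1 u) ->
    alexander_ideal D1 x <-> fitting (based_coloring D1 s1) (size l1) (nth 0 l1) x.
  by move=> sp; apply: iff_trans (alexander_fitting D1 s1 x) (genE _ _ _ _ sp).
apply/seteqP; split=> x.
  move=> /(idE D s0 l x lD) xD; apply/(idE D' s0' l' x lD'); rewrite -sl; move: xD.
  apply: ideal_gen_sub => d [M [MR ->]]; apply: ideal_gen_in; exists M; split=> // i.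
  by apply/rel.
move=> /(idE D' s0' l' x lD'); rewrite -sl => xD; apply/(idE D s0 l x lD); move: xD.
apply: ideal_gen_sub => d [M [MR ->]]; apply: ideal_gen_in; exists M; split=> // i.
by apply/rel.
Qed.

(** If colorings can be carried over in both directions without change on a common list, both
    diagrams have the same relations over it. The base point belongs to the list so that vanishing
    there is preserved. *)
Lemma alexander_ideal_transfer D D' l s0 : s0 \in l ->
  (forall u, under D u -> spanned D l u) -> (forall u, under D' u -> spanned D' l u) ->
  (forall (X : lmodType laurent) (c : R -> X), coloring D c ->
     exists2 c' : R -> X, coloring D' c' & forall y, y \in l -> c' y = c y) ->
  (forall (X : lmodType laurent) (c' : R -> X), coloring D' c' ->
     exists2 c : R -> X, coloring D c & forall y, y \in l -> c y = c' y) ->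
  alexander_ideal D = alexander_ideal D'.
Proof.
move=> s0l lD lD' ext ext'; apply: (@alexander_ideal_relation D D' s0 s0 l l) => // a.
split=> aR X c [cc c0].
  have [c' cc' cE] := ext' X c cc; rewrite -[RHS](aR X c').
    by apply: eq_bigr => j _; rewrite cE// mem_nth.
  by split=> //; rewrite cE.
have [c' cc' cE] := ext X c cc; rewrite -[RHS](aR X c').
  by apply: eq_bigr => j _; rewrite cE// mem_nth.
by split=> //; rewrite cE.
Qed.

End Spanning.

(** * Arcs of the circle and modification of functions along them *)

Section Arcs.
Variable R : realType.
Implicit Types (a b r s t : R).

Definition red a r := a + frac (r - a).

Lemma red_itv a r : a <= red a r < a + 1.
Proof. by have /andP[? ?] := frac_itv (r - a); rewrite /red; apply/andP; split; lra. Qed.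

Lemma same_param_red a r : same_param r (red a r).
Proof.
apply/same_paramP; exists (- Num.floor (r - a)); rewrite /red /frac intrN; lra.
Qed.

Lemma red_same a r s : same_param r s -> red a s = red a r.
Proof.
move=> /same_paramP[k ->]; rewrite /red; congr (a + _).
by rewrite -[RHS](fracDz _ k); congr frac; lra.
Qed.

Lemma red_id a r : a <= r < a + 1 -> red a r = r.
Proof.
by move=> /andP[r1 r2]; rewrite /red frac_id; [lra|apply/andP; split; lra].
Qed.

Lemma int_lt1 (k : int) : (-1 : R) < k%:~R -> (k%:~R : R) < 1 -> k = 0.
Proof.
have -> : (-1 : R) = (-1)%:~R by rewrite intrN.
have -> : (1 : R) = 1%:~R by rewrite mulr1z.
by rewrite !ltr_int; lia.
Qed.

Lemma open_arcE a b r : a < b <= a + 1 -> a <= r < a + 1 ->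
  open_arc a b r <-> a < r < b.
Proof.
move=> /andP[ab b1] /andP[ar r1]; split=> [[k /andP[k1 k2]]|rab]; last first.
  by exists 0; rewrite addr0.
have k0 : k = 0 by apply: int_lt1; lra.
by move: k1 k2; rewrite k0 addr0 => -> ->.
Qed.

Lemma closed_arcE a b r : a <= b < a + 1 -> a <= r < a + 1 ->
  closed_arc a b r <-> a <= r <= b.
Proof.
move=> /andP[ab b1] /andP[ar r1]; split=> [[k /andP[k1 k2]]|rab]; last first.
  by exists 0; rewrite addr0.
have k0 : k = 0 by apply: int_lt1; lra.
by move: k1 k2; rewrite k0 addr0 => -> ->.
Qed.

Lemma open_arc_same a b r s : same_param r s -> open_arc a b r -> open_arc a b s.
Proof.
move=> /same_paramP[k ->] [j jP]; exists (j - k).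
by rewrite intrD intrN -[_ + k%:~R + _]addrA [k%:~R + _]addrC subrK.
Qed.

Lemma closed_arc_same a b r s : same_param r s -> closed_arc a b r -> closed_arc a b s.
Proof.
move=> /same_paramP[k ->] [j jP]; exists (j - k).
by rewrite intrD intrN -[_ + k%:~R + _]addrA [k%:~R + _]addrC subrK.
Qed.

Lemma open_closed_arc a b r : open_arc a b r -> closed_arc a b r.
Proof. by move=> [k /andP[k1 k2]]; exists k; rewrite !ltW. Qed.

Lemma closed_arc_in a b r : a <= r <= b -> closed_arc a b r.
Proof. by exists 0; rewrite addr0. Qed.

Lemma closed_arcP a b r : closed_arc a b r -> exists2 s, same_param r s & a <= s <= b.
Proof. by move=> [k kP]; exists (r + k%:~R) => //; apply/same_paramP; exists k. Qed.

Lemma closed_arc_compl a b r : a <= b < a + 1 -> ~ closed_arc a b r ->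
  exists2 e, 0 < e & forall t, r - e < t < r + e -> ~ closed_arc a b t.
Proof.
move=> ab nr; have /andP[ab1 ab2] := ab.
have /andP[r1 r2] := red_itv a r.
have br : b < red a r.
  rewrite ltNge; apply/negP => rb; apply: nr.
  apply: closed_arc_same (same_param_sym (same_param_red a r)) _.
  by apply: closed_arc_in; rewrite r1.
pose e := Num.min (red a r - b) (a + 1 - red a r).
have h1 : e <= red a r - b by rewrite ge_min lexx.
have h2 : e <= a + 1 - red a r by rewrite ge_min lexx orbT.
exists e => [|t /andP[t1 t2] tA]; first by rewrite lt_min !subr_gt0 br.
have [k rE] := (same_paramP _ _).1 (same_param_red a r).
have : closed_arc a b (t + k%:~R).
  by apply: closed_arc_same tA; apply/same_paramP; exists k.
have h : a <= t + k%:~R < a + 1 by apply/andP; split; lra.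
by move=> /(closed_arcE ab h)/andP[]; lra.
Qed.

Lemma closed_arc_left a b : a <= b < a + 1 ->
  exists2 e, 0 < e & forall t, a - e < t < a -> ~ closed_arc a b t.
Proof.
move=> ab; have /andP[ab1 ab2] := ab; exists (a + 1 - b); first lra.
move=> t /andP[t1 t2] tA.
have : closed_arc a b (t + 1%:~R) by apply: closed_arc_same tA; apply/same_paramP; exists 1.
have h : a <= t + 1%:~R < a + 1 by rewrite mulr1z; apply/andP; split; lra.
by move=> /(closed_arcE ab h)/andP[]; rewrite mulr1z; lra.
Qed.

Lemma closed_arc_right a b : a <= b < a + 1 ->
  exists2 e, 0 < e & forall t, b < t < b + e -> ~ closed_arc a b t.
Proof.
move=> ab; have /andP[ab1 ab2] := ab; exists (a + 1 - b); first lra.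
move=> t /andP[t1 t2]; have h : a <= t < a + 1 by apply/andP; split; lra.
by move=> /(closed_arcE ab h)/andP[]; lra.
Qed.

(** The parameter is first brought to [a, a + 1[, where the arc is the interval [a, b]; this keeps
    the result periodic. *)
Definition splice (X : Type) (c : R -> X) a b (g : R -> X) r :=
  if red a r <= b then g (red a r) else c r.

Lemma splice_periodic (X : Type) (c : R -> X) a b g : (forall t, c (t + 1) = c t) ->
  forall t, splice c a b g (t + 1) = splice c a b g t.
Proof.
move=> c1 t; rewrite /splice c1 (@red_same a t)//.
by apply/same_paramP; exists 1; rewrite mulr1z.
Qed.

Lemma splice_in (X : Type) (c : R -> X) a b g r : b < a + 1 -> a <= r <= b ->
  splice c a b g r = g r.
Proof.
move=> b1 /andP[ar rb]; rewrite /splice red_id ?rb//.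
by rewrite ar (le_lt_trans rb).
Qed.

Lemma splice_out (X : Type) (c : R -> X) a b g r : ~ closed_arc a b r ->
  splice c a b g r = c r.
Proof.
move=> nr; rewrite /splice ifF//; apply/negbTE/negP => rb; apply: nr.
apply: closed_arc_same (same_param_sym (same_param_red a r)) _.
by apply: closed_arc_in; rewrite rb andbT; have /andP[] := red_itv a r.
Qed.

Lemma step_left (X : Type) (f g : R -> X) p r :
  (r <= p -> left_const f r (f r)) -> (p < r -> left_const g r (g r)) ->
  left_const (fun t => if t <= p then f t else g t) r (if r <= p then f r else g r).
Proof.
have [rp|pr] := leP r p => lf lg.
  apply: (@left_const_ext _ _ _ _ _ _ 1) (lf isT) => //.
  by move=> t /andP[_ tr]; rewrite ifT// ltW// (lt_le_trans tr).
apply: (@left_const_ext _ _ _ _ _ _ (r - p)) (lg isT); first by rewrite subr_gt0.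
by move=> t /andP[pt _]; rewrite ifF//; apply/negbTE; rewrite -ltNge; lra.
Qed.

Lemma step_right (X : Type) (f g : R -> X) p r x :
  (r < p -> right_const f r x) -> (p <= r -> right_const g r x) ->
  right_const (fun t => if t <= p then f t else g t) r x.
Proof.
have [rp|pr] := ltP r p => lf lg.
  apply: (@right_const_ext _ _ _ _ _ _ (p - r)) (lf isT); first by rewrite subr_gt0.
  by move=> t /andP[_ pt]; rewrite ifT//; lra.
apply: (@right_const_ext _ _ _ _ _ _ 1) (lg isT) => //.
by move=> t /andP[rt _]; rewrite ifF//; apply/negbTE; rewrite -ltNge (le_lt_trans pr).
Qed.

Lemma cst_left (X : Type) (x : X) r : left_const (fun=> x) r x.
Proof. by exists 1. Qed.

Lemma cst_right (X : Type) (x : X) r : right_const (fun=> x) r x.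
Proof. by exists 1. Qed.

End Arcs.

(** * Crossing signs under the moves *)

Section Tangent.
Variable R : realType.
Local Notation plane := (R * R)%type.
Implicit Types (D : diagram R) (r s t u h : R) (g : R -> plane).

(** [F] is a filter of increments, in practice a one-sided neighborhood of 0. *)
Definition tangent (F : set_system R) g t (v : plane) : Prop :=
  (h^-1 * ((g (h + t)).1 - (g t).1) @[h --> F] --> v.1) /\
  (h^-1 * ((g (h + t)).2 - (g t).2) @[h --> F] --> v.2).

Lemma tangent_uniq (F : set_system R) (FF : ProperFilter F) g t v w :
  tangent F g t v -> tangent F g t w -> v = w.
Proof.
move=> [v1 v2] [w1 w2]; apply/eqP; rewrite -pair_eqE /=; apply/andP; split; apply/eqP.
  exact: (cvg_unique (@norm_hausdorff _ _) v1 w1).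
exact: (cvg_unique (@norm_hausdorff _ _) v2 w2).
Qed.

Lemma tangent_dnbhs g t : derivable g t 1 -> tangent 0^' g t (derive1 g t).
Proof.
move=> dg; pose f h := h^-1 *: (g (h + t) - g t).
have fE : f = (fun h => h^-1 *: ((g \o shift t) (h *: 1) - g t)).
  by apply/funext => h; rewrite /f /= /shift/= [h *: 1]mulr1.
have c : f h @[h --> 0^'] --> derive1 g t by move: dg; rewrite /derivable -fE.
split.
  exact: (@cvg_comp _ _ _ f fst _ (nbhs (derive1 g t)) _ c cvg_fst).
exact: (@cvg_comp _ _ _ f snd _ (nbhs (derive1 g t)) _ c cvg_snd).
Qed.

Lemma tangent_right g t : derivable g t 1 -> tangent 0^'+ g t (derive1 g t).
Proof.
by move=> /tangent_dnbhs[? ?]; split; apply: cvg_dnbhs_at_right.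
Qed.

Lemma tangent_left g t : derivable g t 1 -> tangent 0^'- g t (derive1 g t).
Proof.
by move=> /tangent_dnbhs[? ?]; split; apply: cvg_dnbhs_at_left.
Qed.

Lemma tangent_ext (F : set_system R) (FF : Filter F) g g' t v :
  g t = g' t -> (\forall h \near F, g (h + t) = g' (h + t)) ->
  tangent F g t v -> tangent F g' t v.
Proof.
move=> gt gh [v1 v2]; split.
  by apply: cvg_trans v1; apply: near_eq_cvg; near=> h; rewrite -gt -(near gh h).
by apply: cvg_trans v2; apply: near_eq_cvg; near=> h; rewrite -gt -(near gh h).
Unshelve. all: end_near. Qed.

Lemma derive1_eq_right g g' t e : derivable g t 1 -> derivable g' t 1 -> 0 < e ->
  (forall x, t <= x < t + e -> g x = g' x) -> derive1 g t = derive1 g' t.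
Proof.
move=> dg dg' e0 gg'; apply: tangent_uniq (tangent_right dg').
apply: tangent_ext (tangent_right dg); first by apply: gg'; rewrite lexx ltrDl.
have h0 : \forall h \near 0^'+, 0 < h :> R by exact: nbhs_right_gt.
have he : \forall h \near 0^'+, h < e :> R by exact: nbhs_right_lt.
near=> h; apply: gg'.
have : 0 < h by near: h. have : h < e by near: h.
by move=> ? ?; apply/andP; split; lra.
Unshelve. all: end_near. Qed.

Lemma derive1_eq_left g g' t e : derivable g t 1 -> derivable g' t 1 -> 0 < e ->
  (forall x, t - e < x <= t -> g x = g' x) -> derive1 g t = derive1 g' t.
Proof.
move=> dg dg' e0 gg'; apply: tangent_uniq (tangent_left dg').
apply: tangent_ext (tangent_left dg); first by apply: gg'; rewrite lexx ltrBlDr ltrDl e0.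
have h0 : \forall h \near 0^'-, h < 0 :> R by exact: nbhs_left_lt.
have he : \forall h \near 0^'-, - e < h :> R by apply: nbhs_left_gt; rewrite oppr_lt0.
near=> h; apply: gg'.
have : h < 0 by near: h. have : - e < h by near: h.
by move=> ? ?; apply/andP; split; lra.
Unshelve. all: end_near. Qed.

(** At an end of the arc the curves agree on one side only; this determines the tangent because both
    are differentiable there. *)
Lemma agree_off_derive1 D D' a b t : a < b < a + 1 -> agree_off a b D D' ->
  ~ open_arc a b t -> derive1 (curve D') t = derive1 (curve D) t.
Proof.
move=> /andP[ab b1] [cE _] nt.
have rt := same_param_red a t.
rewrite -(periodic_same (derive1_curve_periodic D) rt).
rewrite -(periodic_same (derive1_curve_periodic D') rt).
have {}nt : ~ open_arc a b (red a t) by move=> /(open_arc_same (same_param_sym rt)).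
have h1 : a < b <= a + 1 by rewrite ab ltW.
have := red_itv a t; move: nt; move: (red a t) => r nr ra; have /andP[ar r1] := ra.
have /negP := fun rab : a < r < b => nr ((open_arcE h1 ra).2 rab).
rewrite negb_and -!leNgt => /orP[ra'|br].
  have {ar ra'}re : r = a by apply/eqP; rewrite eq_le ra'.
  rewrite re; apply: (@derive1_eq_left _ _ _ (a + 1 - b)); rewrite ?subr_gt0//.
  - exact: curve_derivable.
  - exact: curve_derivable.
  move=> x /andP[x1 x2]; apply: cE.
  have [->|xa] := eqVneq x a; first by rewrite -{2}re.
  have {}xa : x < a by rewrite lt_neqAle xa.
  have xx : same_param x (x + 1) by apply/same_paramP; exists 1; rewrite mulr1z.
  have h2 : a <= x + 1 < a + 1 by apply/andP; split; lra.
  by move=> /(open_arc_same xx)/(open_arcE h1 h2)/andP[_]; lra.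
apply: (@derive1_eq_right _ _ _ (a + 1 - r)); rewrite ?subr_gt0//.
- exact: curve_derivable.
- exact: curve_derivable.
move=> x /andP[x1 x2]; apply: cE; have h2 : a <= x < a + 1 by apply/andP; split; lra.
by move=> /(open_arcE h1 h2)/andP[_]; lra.
Qed.

Lemma agree_off_det D D' a b s t : a < b < a + 1 -> agree_off a b D D' ->
  ~ open_arc a b s -> ~ open_arc a b t -> crossing_det D' s t = crossing_det D s t.
Proof.
by move=> ab DD' ns nt; rewrite /crossing_det !(agree_off_derive1 ab DD').
Qed.

Lemma tangent_reparam g g1 (phi : R -> R) s v :
  (forall t, g1 t = g (phi t)) -> continuous phi -> (forall x y, x < y -> phi x < phi y) ->
  derivable g (phi s) 1 -> tangent 0^'+ g1 s v ->
  derive1 g (phi s) != 0 -> v != 0 ->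
  exists2 l, 0 < l & v = l *: derive1 g (phi s).
Proof.
move=> g1E cphi phi_inc dg dg1; set w := derive1 g (phi s).
move=> w0 v0.
pose k h := phi (h + s) - phi s.
have k0 : k h @[h --> 0^'+] --> 0^'+.
  have kc : k h @[h --> 0^'+] --> 0.
    apply/cvgrPdist_lt => e e0.
    have /cvgrPdist_lt/(_ e e0)/nbhs_ballP[d /= d0 dP] := cphi s.
    near=> h; rewrite /k sub0r normrN distrC; apply: dP.
    rewrite /ball /= opprD addrCA subrr addr0 normrN ger0_norm.
      by near: h; exact: nbhs_right_lt.
    by rewrite ltW//; near: h; exact: nbhs_right_gt.
  move=> A [e /= e0 eA].
  have kpos : \forall h \near 0^'+, 0 < k h.
    near=> h; rewrite subr_gt0; apply: phi_inc; rewrite ltrDr; near: h.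
    exact: nbhs_right_gt.
  have knear : \forall h \near 0^'+, `|0 - k h| < e by move/cvgrPdist_lt: kc => /(_ e e0).
  rewrite -[_ A]/(\forall h \near 0^'+, A (k h)); near=> h.
  by apply: eA; [exact: (near knear h)|exact: (near kpos h)].
have [w1 w2] := tangent_right dg; have [v1 v2] := dg1.
rewrite -/w in w1 w2.
pose a1 : R := w.1; pose a2 : R := w.2; pose b1 : R := v.1; pose b2 : R := v.2.
have n0 : 0 < a1 * a1 + a2 * a2.
  rewrite lt_neqAle addr_ge0 -?expr2 ?sqr_ge0// andbT eq_sym; apply: contra w0 => /eqP e.
  have e1 : a1 = 0 by nra.
  have e2 : a2 = 0 by nra.
  by apply/eqP; rewrite [w]surjective_pairing -/a1 -/a2 e1 e2.
pose q1 h := (k h)^-1 * ((g (k h + phi s)).1 - (g (phi s)).1).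
pose q2 h := (k h)^-1 * ((g (k h + phi s)).2 - (g (phi s)).2).
have W1 : q1 h @[h --> 0^'+] --> a1 := cvg_comp _ _ k0 w1.
have W2 : q2 h @[h --> 0^'+] --> a2 := cvg_comp _ _ k0 w2.
pose p1 h := h^-1 * ((g1 (h + s)).1 - (g1 s).1).
pose p2 h := h^-1 * ((g1 (h + s)).2 - (g1 s).2).
have kn : \forall h \near 0^'+, k h != 0.
  near=> h; rewrite gt_eqF// subr_gt0; apply: phi_inc; rewrite ltrDr; near: h.
  exact: nbhs_right_gt.
have pq1 : \forall h \near 0^'+, p1 h = k h / h * q1 h.
  near=> h; rewrite /p1 /q1 !g1E /k subrK -/(k h).
  have kh : k h != 0 by near: h.
  by rewrite [RHS]mulrA [k h / h]mulrC -(mulrA h^-1) divff// mulr1.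
have pq2 : \forall h \near 0^'+, p2 h = k h / h * q2 h.
  near=> h; rewrite /p2 /q2 !g1E /k subrK -/(k h).
  have kh : k h != 0 by near: h.
  by rewrite [RHS]mulrA [k h / h]mulrC -(mulrA h^-1) divff// mulr1.
have V1 : p1 h @[h --> 0^'+] --> b1 := v1.
have V2 : p2 h @[h --> 0^'+] --> b2 := v2.
have FF : Filter (0 : R)^'+ by apply: within_filter.
have C1 : (fun _ : R => a1) @ (0 : R)^'+ --> a1 := @cvg_cst _ a1 R (0 : R)^'+ FF.
have C2 : (fun _ : R => a2) @ (0 : R)^'+ --> a2 := @cvg_cst _ a2 R (0 : R)^'+ FF.
have dc : q1 h * a1 + q2 h * a2 @[h --> 0^'+] --> a1 * a1 + a2 * a2.
  exact: (cvgD (cvgM W1 C1) (cvgM W2 C2)).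
have nc : p1 h * a1 + p2 h * a2 @[h --> 0^'+] --> b1 * a1 + b2 * a2.
  exact: (cvgD (cvgM V1 C1) (cvgM V2 C2)).
pose l := (b1 * a1 + b2 * a2) / (a1 * a1 + a2 * a2).
have lc : k h / h @[h --> 0^'+] --> l.
  have dv : (q1 h * a1 + q2 h * a2)^-1 @[h --> 0^'+] --> (a1 * a1 + a2 * a2)^-1.
    exact: (cvgV (lt0r_neq0 n0) dc).
  have P : (p1 h * a1 + p2 h * a2) * (q1 h * a1 + q2 h * a2)^-1 @[h --> 0^'+] --> l.
    exact: (cvgM nc dv).
  apply: cvg_trans P; apply: near_eq_cvg.
  have dn : \forall h \near 0^'+, q1 h * a1 + q2 h * a2 != 0.
    exact: (cvgr_neq0 _ dc (lt0r_neq0 n0)).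
  near=> h => /=; rewrite (near pq1 h)// (near pq2 h)//.
  have dh : q1 h * a1 + q2 h * a2 != 0 by near: h.
  by rewrite -(mulrA (k h / h)) -(mulrA (k h / h) (q2 h)) -mulrDr mulfK.
have vE : v = l *: w.
  apply/eqP; rewrite -pair_eqE /=; apply/andP; split; apply/eqP.
    apply: (cvg_unique (@norm_hausdorff _ _) v1).
    have P : k h / h * q1 h @[h --> 0^'+] --> l * a1 by exact: (cvgM lc W1).
    apply: cvg_trans P; apply: near_eq_cvg.
    by near=> h => /=; have := near pq1 h; rewrite /p1 /q1 => ->.
  apply: (cvg_unique (@norm_hausdorff _ _) v2).
  have P : k h / h * q2 h @[h --> 0^'+] --> l * a2 by exact: (cvgM lc W2).
  apply: cvg_trans P; apply: near_eq_cvg.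
  by near=> h => /=; have := near pq2 h; rewrite /p2 /q2 => ->.
(* The limit is nonzero because v is, and not negative because the ratios of increments are
   positive. *)
exists l => //; rewrite lt_neqAle; apply/andP; split.
  by apply: contra v0 => /eqP e; rewrite vE -e scale0r.
rewrite leNgt; apply/negP => l0.
have kneg : \forall h \near 0^'+, k h / h < 0 by exact: (cvgr_lt _ lc _ l0).
have [h [h0 kh]] : exists h, 0 < h /\ k h / h < 0.
  have [h hP] := @filter_ex _ (0 : R)^'+ _ _ (filterI (nbhs_right_gt (0 : R)) kneg).
  by exists h.
have : 0 < k h by rewrite subr_gt0; apply: phi_inc; rewrite ltrDr.
by move=> kpos; move: kh; rewrite ltNge ltW// divr_gt0.
Unshelve. all: end_near. Qed.

Lemma tangent_rotation (F : set_system R) (FF : Filter F) g t v theta :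
  tangent F g t v -> tangent F (fun s => rotation theta (g s)) t (rotation theta v).
Proof.
move=> [v1 v2]; pose a1 : R := v.1; pose a2 : R := v.2.
pose p1 h := h^-1 * ((g (h + t)).1 - (g t).1).
pose p2 h := h^-1 * ((g (h + t)).2 - (g t).2).
have V1 : p1 h @[h --> F] --> a1 := v1.
have V2 : p2 h @[h --> F] --> a2 := v2.
have C (c : R) : (fun _ : R => c) @ F --> c by exact: (@cvg_cst _ c R F FF).
split.
  have P : cos theta * p1 h - sin theta * p2 h @[h --> F] --> cos theta * a1 - sin theta * a2.
    exact: (cvgB (cvgM (C (cos theta)) V1) (cvgM (C (sin theta)) V2)).
  apply: cvg_trans P; apply: near_eq_cvg; apply: nearW => h.
  by rewrite /p1 /p2 /rotation /=; ring.
have P : sin theta * p1 h + cos theta * p2 h @[h --> F] --> sin theta * a1 + cos theta * a2.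
  exact: (cvgD (cvgM (C (sin theta)) V1) (cvgM (C (cos theta)) V2)).
apply: cvg_trans P; apply: near_eq_cvg; apply: nearW => h.
by rewrite /p1 /p2 /rotation /=; ring.
Qed.

Lemma wedge_rotation theta (u v : plane) :
  wedge (rotation theta u) (rotation theta v) = wedge u v.
Proof.
rewrite /wedge /rotation /=; have := cos2Dsin2 theta; set c := cos theta; set s := sin theta.
move=> cs; transitivity ((c ^+ 2 + s ^+ 2) * (u.1 * v.2 - u.2 * v.1)); first by ring.
by rewrite cs mul1r.
Qed.

Lemma rotation_eq0 theta (u : plane) : rotation theta u = 0 -> u = 0.
Proof.
move=> ru; have e1 : cos theta * u.1 - sin theta * u.2 = 0 := congr1 fst ru.
have e2 : sin theta * u.1 + cos theta * u.2 = 0 := congr1 snd ru.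
have cs := cos2Dsin2 theta.
have u1 : u.1 = (cos theta ^+ 2 + sin theta ^+ 2) * u.1 by rewrite cs mul1r.
have u2 : u.2 = (cos theta ^+ 2 + sin theta ^+ 2) * u.2 by rewrite cs mul1r.
rewrite [u]surjective_pairing; congr (_, _).
  rewrite u1 (_ : _ * _ = cos theta * (cos theta * u.1 - sin theta * u.2) +
    sin theta * (sin theta * u.1 + cos theta * u.2)); last by ring.
  by rewrite e1 e2 !mulr0 addr0.
rewrite u2 (_ : _ * _ = cos theta * (sin theta * u.1 + cos theta * u.2) -
  sin theta * (cos theta * u.1 - sin theta * u.2)); last by ring.
by rewrite e1 e2 !mulr0 subr0.
Qed.

Lemma wedgeZ (a b : R) (u v : plane) : wedge (a *: u) (b *: v) = a * b * wedge u v.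
Proof.
rewrite /wedge /=; change ((a * u.1) * (b * v.2) - (a * u.2) * (b * v.1) =
  a * b * (u.1 * v.2 - u.2 * v.1)); ring.
Qed.

Lemma wedge_comb (a b c d : R) (p q : plane) :
  wedge (a *: p + b *: q) (c *: p + d *: q) = wedge p q * (a * d - b * c).
Proof.
case: p => p1 p2; case: q => q1 q2; rewrite /wedge /=.
change ((a * p1 + b * q1) * (c * p2 + d * q2) - (a * p2 + b * q2) * (c * p1 + d * q1) =
  (p1 * q2 - p2 * q1) * (a * d - b * c)); ring.
Qed.

Lemma comb_pair (a b : R) (p q : plane) :
  a *: p + b *: q = (a * p.1 + b * q.1, a * p.2 + b * q.2).
Proof. by case: p => p1 p2; case: q. Qed.

Lemma sgz_pmul (x y : R) : 0 < x -> sgz (x * y) = sgz y.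
Proof. by move=> x0; rewrite sgzM (gtr0_sgz x0) mul1r. Qed.

Lemma reparam_sign D g1 (phi : R -> R) (v : R -> plane) s t : reparametrization phi ->
  (forall t, g1 t = curve D (phi t)) -> (forall t, tangent 0^'+ g1 t (v t)) ->
  (forall t, v t != 0) -> sgz (wedge (v s) (v t)) = strand_sign D (phi s) (phi t).
Proof.
move=> [cphi phi_inc _] g1E gv v0; rewrite /strand_sign /crossing_det.
have [a a0 ->] := tangent_reparam g1E cphi phi_inc (@curve_derivable _ D (phi s))
  (gv s) (@curve_immersed _ D (phi s)) (v0 s).
have [b b0 ->] := tangent_reparam g1E cphi phi_inc (@curve_derivable _ D (phi t))
  (gv t) (@curve_immersed _ D (phi t)) (v0 t).
by rewrite wedgeZ sgz_pmul// mulr_gt0.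
Qed.

Lemma same_diagram_sign D D' phi s t : reparametrization phi ->
  (forall t, curve D' t = curve D (phi t)) ->
  strand_sign D' s t = strand_sign D (phi s) (phi t).
Proof.
move=> rphi D'E; rewrite -(reparam_sign s t rphi D'E (fun t => tangent_right (@curve_derivable _ D' t))).
  by [].
by move=> u; exact: curve_immersed.
Qed.

Lemma rotation_sign D theta phi s t : reparametrization phi ->
  (forall t, rotation theta (curve D t) = curve D (phi t)) ->
  strand_sign D (phi s) (phi t) = strand_sign D s t.
Proof.
move=> rphi DE.
rewrite -(@reparam_sign D (fun u => rotation theta (curve D u)) phi
  (fun u => rotation theta (derive1 (curve D) u)) s t rphi DE).
- by rewrite wedge_rotation.
- move=> u; apply: tangent_rotation; exact/tangent_right/curve_derivable.
- by move=> u; apply/eqP => /rotation_eq0 /eqP; apply/negP/curve_immersed.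
Qed.

(** The sign at the crossing point x is multiplied by that of the Jacobian of [H 1]. The Jacobian of
    [H r] at x is continuous in r, equals 1 at r = 0 and never vanishes, so it is positive at r =
    1. *)
Lemma isotopy_sign D D' H s t : ambient_isotopy H ->
  (forall t, curve D' t = H 1 (curve D t)) ->
  curve D s = curve D t -> strand_sign D' s t = strand_sign D s t.
Proof.
move=> [[H0 _ cH] dH cDH DH0] D'E st.
pose e1 : plane := (1, 0); pose e2 : plane := (0, 1).
set x := curve D s in st.
pose L r (v : plane) : plane := 'D_v (H r) x.
have LE r (w : plane) : L r w = w.1 *: L r e1 + w.2 *: L r e2.
  rewrite /L !deriveE// -!linearZ -linearD; congr ('d _ _ _).
  rewrite [LHS]surjective_pairing; congr (_, _) => /=.
    by change (w.1 = w.1 * 1 + w.2 * 0); ring.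
  by change (w.2 = w.1 * 0 + w.2 * 1); ring.
have Llin r (u v : plane) : wedge (L r u) (L r v) = wedge (L r e1) (L r e2) * wedge u v.
  by rewrite (LE r u) (LE r v) wedge_comb.
pose J r := wedge (L r e1) (L r e2).
have dE r : derive1 (curve D') r = 'D_(derive1 (curve D) r) (H 1) (curve D r).
  have dD : differentiable (curve D) r by apply/derivable1_diffP/curve_derivable.
  have -> : curve D' = H 1 \o curve D by apply/funext => y; rewrite D'E.
  have dHr := dH 1 (curve D r).
  rewrite (derive1E (H 1 \o curve D)) (deriveE _ (differentiable_comp dD dHr)).
  rewrite (diff_comp dD dHr) (deriveE _ dHr) derive1E (deriveE _ dD).
  exact: erefl.
have e : wedge ('D_(derive1 (curve D) s) (H 1) x) ('D_(derive1 (curve D) t) (H 1) x) =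
    J 1 * wedge (derive1 (curve D) s) (derive1 (curve D) t) by exact: Llin.
rewrite /strand_sign /crossing_det (dE s) (dE t) -st -/x e sgz_pmul//.
have J0 : J 0 = 1.
  have H0E : H 0 = id by apply/funext.
  rewrite /J /L H0E !derive_id /wedge /=; ring.
(* The differential has columns p and q. If its determinant vanished, the vectors (- q.1, p.1) and
   (- q.2, p.2) would be in its kernel, hence zero; then p, the image of [e1], would be zero. *)
have Jn0 r : J r != 0.
  apply/eqP => Jr.
  have N (v : plane) : L r v = 0 -> v = 0.
    by move=> Lv; apply/eqP; apply: contraT => /(DH0 r x); rewrite -/(L r v) Lv eqxx.
  pose p := L r e1; pose q := L r e2.
  have Lc (a b : R) : L r (a, b) = (a * p.1 + b * q.1, a * p.2 + b * q.2).
    by rewrite -comb_pair; exact: (LE r (a, b)).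
  have Jr' : p.1 * q.2 - p.2 * q.1 = 0 := Jr.
  have Le1 : L r e1 = p by [].
  clearbody p q L; clear -N Lc Jr' Le1.
  have p1 : p.1 = 0.
    have : (- q.1, p.1) = 0 :> plane.
      apply: N; rewrite Lc.
      have -> : - q.1 * p.1 + p.1 * q.1 = 0 by ring.
      have -> : - q.1 * p.2 + p.1 * q.2 = 0 by rewrite -Jr'; ring.
      by [].
    by move=> /(congr1 snd).
  have p2 : p.2 = 0.
    have : (- q.2, p.2) = 0 :> plane.
      apply: N; rewrite Lc.
      have -> : - q.2 * p.1 + p.2 * q.1 = 0 by rewrite -[RHS]oppr0 -Jr'; ring.
      have -> : - q.2 * p.2 + p.2 * q.2 = 0 by ring.
      by [].
    by move=> /(congr1 snd).
  have : e1 = 0 :> plane by apply: N; rewrite Le1 [LHS]surjective_pairing p1 p2.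
  by move=> /(congr1 fst)/= /eqP; rewrite oner_eq0.
have Jc : continuous J.
  have Lcont (v : plane) : continuous (fun r => L r v).
    move=> r; apply: (@continuous_comp _ _ _ (fun r : R => (r, x))
      (fun z : R * plane => 'D_v (H z.1) z.2)); last exact: cDH.
    move=> A [[B C] /= [rB xC] BCA]; apply: filterS rB => y yB.
    by apply: BCA; split=> //; exact: nbhs_singleton xC.
  have L1 (v : plane) : continuous (fun r => (L r v).1).
    move=> r; apply: (@continuous_comp _ _ _ (fun r => L r v) fst); first exact: Lcont.
    exact: cvg_fst.
  have L2 (v : plane) : continuous (fun r => (L r v).2).
    move=> r; apply: (@continuous_comp _ _ _ (fun r => L r v) snd); first exact: Lcont.
    exact: cvg_snd.
  move=> r; rewrite /J /wedge.
  by apply: cvgB; apply: cvgM; (exact: L1 || exact: L2).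
rewrite ltNge; apply/negP => J1.
have [c _ Jc0] : exists2 c : R, c \in `[0, 1] & J c = 0.
  apply: IVT => //; first by apply: continuous_subspaceT.
  by rewrite J0 ge_min le_max ler01 J1 orbT.
by have := Jn0 c; rewrite Jc0 eqxx.
Qed.

End Tangent.

(** * Invariance of the Alexander ideal *)

Section QuandleOp.
Variable X : lmodType laurent.
Implicit Types (x y z : X) (e : int).

Lemma tpowN e : tpow (- e) * tpow e = 1.
Proof.
apply: val_inj; rewrite /= -expfzDr ?addNr ?expr0z//.
exact: tofracX_neq0.
Qed.

Lemma quandle_op_idem e x : quandle_op e x x = x.
Proof. by rewrite /quandle_op -scalerDl [tpow _ + _]addrC subrK scale1r. Qed.

Lemma quandle_opK e x y : quandle_op e (quandle_op (- e) x y) y = x.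
Proof.
rewrite /quandle_op scalerDr !scalerA opprK tpowN scale1r mulrBr mulr1 tpowN.
by rewrite -addrA -scalerDl subrKA subrr scale0r addr0.
Qed.

(** A normal form in which quandle identities become ring identities between the coefficients. *)
Definition comb3 (a b d : laurent) x y z : X := a *: x + b *: y + d *: z.

Lemma comb3_op e a b d a' b' d' x y z :
  quandle_op e (comb3 a b d x y z) (comb3 a' b' d' x y z) =
  comb3 (tpow (- e) * a + (1 - tpow (- e)) * a') (tpow (- e) * b + (1 - tpow (- e)) * b')
    (tpow (- e) * d + (1 - tpow (- e)) * d') x y z.
Proof.
rewrite /quandle_op /comb3 !scalerDr !scalerA !(scalerDl _ (tpow (- e) * _)).
by rewrite [LHS]addrACA [X in X + _ = _]addrACA.
Qed.

Lemma comb3_1 x y z : x = comb3 1 0 0 x y z.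
Proof. by rewrite /comb3 scale1r !scale0r !addr0. Qed.

Lemma comb3_2 x y z : y = comb3 0 1 0 x y z.
Proof. by rewrite /comb3 scale1r !scale0r addr0 add0r. Qed.

Lemma comb3_3 x y z : z = comb3 0 0 1 x y z.
Proof. by rewrite /comb3 scale1r !scale0r !add0r. Qed.

(** The two identities behind the third Reidemeister move: the strands labelled [z]
    and [y] pass under the strand labelled [x], and [z] passes under [y]. *)
Lemma quandle_op_move_same (g b : int) x y z :
  quandle_op g (quandle_op b z x) (quandle_op b y x) = quandle_op b (quandle_op g z y) x.
Proof.
pose F a b d := comb3 a b d x y z.
transitivity (quandle_op g (quandle_op b (F 0 0 1) (F 1 0 0)) (quandle_op b (F 0 1 0) (F 1 0 0))).
  by rewrite /F -comb3_1 -comb3_2 -comb3_3.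
transitivity (quandle_op b (quandle_op g (F 0 0 1) (F 0 1 0)) (F 1 0 0)); last first.
  by rewrite /F -comb3_1 -comb3_2 -comb3_3.
rewrite /F !comb3_op; move: (tpow (- g)) (tpow (- b)) => p q.
have -> : p * (q * 0 + (1 - q) * 1) + (1 - p) * (q * 0 + (1 - q) * 1) =
  q * (p * 0 + (1 - p) * 0) + (1 - q) * 1 by ring.
have -> : p * (q * 0 + (1 - q) * 0) + (1 - p) * (q * 1 + (1 - q) * 0) =
  q * (p * 0 + (1 - p) * 1) + (1 - q) * 0 by ring.
by have -> : p * (q * 1 + (1 - q) * 0) + (1 - p) * (q * 0 + (1 - q) * 0) =
  q * (p * 1 + (1 - p) * 0) + (1 - q) * 0 by ring.
Qed.

Lemma quandle_op_move_opp (g b : int) x y z :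
  quandle_op g (quandle_op b z x) y = quandle_op b (quandle_op g z (quandle_op (- b) y x)) x.
Proof.
rewrite -[y in LHS](quandle_opK b y x).
exact: quandle_op_move_same.
Qed.

End QuandleOp.

(** * Transport of colorings; the first and second Reidemeister moves *)

Section Transfer.
Variable R : realType.
Implicit Types (D : diagram R) (r s t u v : R).

Section Runs.
Variables (D : diagram R) (X : lmodType laurent) (c : R -> X).
Hypothesis cc : coloring D c.

Lemma coloring_same s t : same_param s t -> c t = c s.
Proof. by case: cc => c1 _ _ _; exact: periodic_same. Qed.

Lemma coloring_cross a b s t : a <= t < b ->
  (forall r, a <= r < b -> under D r -> r = t) -> is_over D s t ->
  c t = c a /\ (forall r, t < r <= b -> c r = quandle_op (strand_sign D s t) (c a) (c s)).
Proof.
move=> /andP[at_ tb] U st.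
have ta : c t = c a.
  apply: (coloring_const cc) => // r /andP[ar rt] rU.
  have rE : r = t by apply: U => //; rewrite ar (lt_trans rt).
  by move: rt; rewrite rE ltxx.
split=> // r /andP[tr rb]; case: cc => _ _ _ /(_ _ _ st)[e e0 ce].
pose t' := Num.min (t + e / 2) r.
have h1 : t' <= t + e / 2 by rewrite ge_min lexx.
have h2 : t' <= r by rewrite ge_min lexx orbT.
have h3 : t < t' by rewrite lt_min tr andbT ltrDl divr_gt0.
rewrite -ta -(ce t'); last by rewrite h3/=; lra.
apply: (coloring_const cc) => // r' /andP[r1 r2] r'U.
have r'E : r' = t by apply: U => //; apply/andP; split; lra.
by move: (lt_le_trans h3 r1); rewrite r'E ltxx.
Qed.

End Runs.

(** The conditions at a single parameter, which can be checked separately inside and outside a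
    move. *)
Definition local_coloring D (X : lmodType laurent) (c : R -> X) r : Prop :=
  [/\ left_const c r (c r), ~ under D r -> right_const c r (c r)
    & forall s, is_over D s r ->
        right_const c r (quandle_op (strand_sign D s r) (c r) (c s))].

Lemma local_coloringP D (X : lmodType laurent) (c : R -> X) :
  coloring D c <-> (forall t, c (t + 1) = c t) /\ (forall r, local_coloring D c r).
Proof.
split=> [[c1 lc rc oc]|[c1 lc]]; first by split=> // r; split=> [|nU|s sr]; [exact: lc|exact: rc|exact: oc].
by split=> // [r|r|s r]; have [lr rr orr] := lc r => //; exact: orr.
Qed.

Lemma local_coloring_same D (X : lmodType laurent) (c : R -> X) r r' :
  (forall t, c (t + 1) = c t) -> same_param r r' ->
  local_coloring D c r -> local_coloring D c r'.
Proof.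
move=> c1 rr' [lc rc oc]; have cr := periodic_same c1 rr'.
split=> [|nU|s sr]; rewrite cr.
- exact: left_const_same lc.
- apply: right_const_same (rc _) => //; apply: contra_not nU; exact: under_same.
have sr' : is_over D s r.
  by apply: over_same_param sr; [exact: same_param_refl|exact: same_param_sym].
rewrite (_ : strand_sign D s r' = strand_sign D s r); last first.
  by rewrite /strand_sign (crossing_det_same D (same_param_refl s) rr').
exact: right_const_same (oc _ sr').
Qed.

Lemma local_coloring_near D D' (X : lmodType laurent) (c c' : R -> X) r e : 0 < e ->
  (forall t, r - e < t < r + e -> c' t = c t) ->
  (under D r -> under D' r) ->
  (forall s, is_over D' s r ->
     [/\ is_over D s r, strand_sign D' s r = strand_sign D s r & c' s = c s]) ->
  local_coloring D c r -> local_coloring D' c' r.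
Proof.
move=> e0 cc' U O [lc rc oc].
have cr : c' r = c r by apply: cc'; apply/andP; split; lra.
have L x : left_const c r x -> left_const c' r x.
  apply: (left_const_ext e0) => t /andP[t1 t2]; apply: cc'.
  by apply/andP; split; lra.
have Rt x : right_const c r x -> right_const c' r x.
  apply: (right_const_ext e0) => t /andP[t1 t2]; apply: cc'.
  by apply/andP; split; lra.
split=> [|nU|s sr]; rewrite cr; first exact: L.
  by apply/Rt/rc; apply: contra_not nU.
by have [sr' -> ->] := O _ sr; exact/Rt/oc.
Qed.

(** Gluing along a strand: new labels g on [a, b], the old coloring c just outside. The left
    condition at a and the right condition at b are inherited from c, since g and c agree at these
    ends and b is not an undercrossing of either diagram. *)
Lemma local_coloring_strand D D' (X : lmodType laurent) (c c' g : R -> X) a b :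
  a < b -> (forall t, a <= t <= b -> c' t = g t) ->
  (exists2 e, 0 < e & forall t, a - e < t < a -> c' t = c t) ->
  (exists2 e, 0 < e & forall t, b < t < b + e -> c' t = c t) ->
  coloring D c -> ~ under D b -> ~ under D' b -> g a = c a -> g b = c b ->
  (forall r, left_const g r (g r)) ->
  (forall r, a <= r < b -> ~ under D' r -> right_const g r (g r)) ->
  (forall s r, a <= r < b -> is_over D' s r ->
     right_const g r (quandle_op (strand_sign D' s r) (g r) (c' s))) ->
  forall r, a <= r <= b -> local_coloring D' c' r.
Proof.
move=> ab c'g [e e0 ce] [d d0 cd] [_ lc rc _] Ub Ub' ga gb lg rg og r /andP[ar rb].
have gr : c' r = g r by apply: c'g; rewrite ar rb.
have c'R x : r < b -> right_const g r x -> right_const c' r x.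
  move=> rb'; apply: (@right_const_ext _ _ _ _ _ _ (b - r)); first by rewrite subr_gt0.
  by move=> t /andP[t1 t2]; apply: c'g; apply/andP; split; lra.
rewrite /local_coloring gr; split=> [|nU|s sr].
- have [->|ra] := eqVneq r a.
    by rewrite ga; apply: left_const_ext e0 ce (lc a).
  have {}ra : a < r by rewrite lt_neqAle eq_sym ra.
  apply: (@left_const_ext _ _ g _ _ _ (r - a)); rewrite ?subr_gt0//.
  by move=> t /andP[t1 t2]; apply: c'g; apply/andP; split; lra.
- have [rE|rb'] := eqVneq r b.
    by rewrite rE gb; apply: right_const_ext d0 cd (rc _ Ub).
  have {}rb' : r < b by rewrite lt_neqAle rb'.
  by apply: c'R => //; apply: rg => //; rewrite ar.
have rb' : r < b.
  by rewrite lt_neqAle rb andbT; apply/eqP => rE; apply: Ub'; exists s; rewrite -rE.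
by apply: c'R => //; apply: og => //; rewrite ar.
Qed.

Lemma same_param_eq a u t : same_param u t -> a <= u < a + 1 -> a <= t < a + 1 -> u = t.
Proof. by move=> ut ua ta; rewrite -(red_id ua) -(red_id ta) (red_same a ut). Qed.

Lemma arcs_disjoint a b c d r : b < c -> d < a + 1 ->
  closed_arc a b r -> closed_arc c d r -> False.
Proof.
move=> bc da [k /andP[k1 k2]] [l /andP[l1 l2]].
have /(@int_lt1 R) : (-1 : R) < (l - k)%:~R by rewrite intrD intrN; lra.
rewrite intrD intrN => lk; have {}lk : l - k = 0 by apply: lk; lra.
have lkE : l = k by lia.
by move: l1; rewrite lkE; lra.
Qed.

Lemma spanned_under D l y : frac y \in l -> spanned D l y.
Proof.
move=> yl; apply: spanned_eq (spanned_mem D yl) => X c cc.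
by apply: (coloring_same cc); exact/same_param_sym/same_param_frac.
Qed.

(** The action of y is injective and fixes y. *)
Lemma quandle_op_fix (X : lmodType laurent) e (x y : X) : quandle_op e x y = y -> x = y.
Proof. by move=> h; rewrite -(quandle_opK (- e) x y) opprK h quandle_op_idem. Qed.

(** The diagrams have the same functions as colorings: at a kink the over label is the incoming or
    the outgoing one, and by idempotence such a crossing changes no label. *)
Lemma alexander_ideal_r1 D D' a b s t : b < a + 1 -> a < s < b -> a < t < b ->
  (forall u, a <= u <= b -> ~ under D u) ->
  (forall w u, is_over D' w u <-> is_over D w u \/ same_param w s /\ same_param u t) ->
  (forall w u, is_over D w u -> strand_sign D' w u = strand_sign D w u) ->
  alexander_ideal D = alexander_ideal D'.
Proof.
move=> ba /andP[as_ sb] /andP[at_ tb] U O sgn.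
have st' : is_over D' s t by apply/O; right; split; exact: same_param_refl.
have uE u : a <= u < b -> under D' u -> u = t.
  move=> /andP[au ub] [w /O[wu|[_ ut]]]; first by case: (U u); [rewrite au ltW|exists w].
  by apply: (@same_param_eq a) ut _ _; apply/andP; split; lra.
have DD' (X : lmodType laurent) (c : R -> X) : coloring D c <-> coloring D' c.
  have c1E : coloring D c \/ coloring D' c -> forall t, c (t + 1) = c t by case=> -[].
  split=> cc; have [c1 lc] := (local_coloringP _ _).1 cc; apply/local_coloringP; split=> // r.
    have cst x : a <= x <= b -> c x = c a.
      move=> /andP[ax xb]; apply: (coloring_const cc) => // y /andP[ay yx]; apply: U.
      by rewrite ay (le_trans (ltW yx)).
    have [rt|rt] := pselect (same_param r t).
      apply: (local_coloring_same c1 (same_param_sym rt)).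
      have [lt rt' _] := lc t; split=> // [[]|w /O[wt|[ws _]]]; first by exists s.
        by case: (U t); [rewrite !ltW|exists w].
      rewrite (coloring_same cc (same_param_sym ws)) !cst ?ltW ?andbT ?ltW//.
      rewrite quandle_op_idem -(cst t); last by rewrite !ltW.
      by apply: rt'; apply: U; rewrite !ltW.
    refine (@local_coloring_near D D' X c c r 1 ltr01 _ _ _ (lc r)).
    - by [].
    - by move=> [w wr]; exists w; apply/O; left.
    - move=> w wr; have [wr'|[_ rt']] := (O _ _).1 wr; last by case: rt.
      by split; [exact: wr'|exact: sgn|].
  have tab : a <= t < b by rewrite ltW.
  have [ta tR] := coloring_cross cc tab uE st'.
  (* The overcrossing comes before t and has the incoming label, or after t and has the outgoing
     label; the latter then also equals the incoming one. *)
  have sE : c s = c a.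
    have [st|ts] := leP s t.
      apply: (coloring_const cc) => [|x /andP[ax xs] xU]; first exact: ltW.
      have xE : x = t by apply: uE => //; rewrite ax (lt_trans xs sb).
      by move: xs; rewrite xE ltNge st.
    by apply/esym/(@quandle_op_fix _ (strand_sign D' s t)); rewrite -(tR s) ?ts ?ltW.
  have [rt|rt] := pselect (same_param r t).
    apply: (local_coloring_same c1 (same_param_sym rt)).
    have [lt _ ot] := lc t; split=> // [_|w wt]; last first.
      by case: (U t); [rewrite !ltW|exists w].
    by have := ot _ st'; rewrite sE ta quandle_op_idem.
  refine (@local_coloring_near D' D X c c r 1 ltr01 _ _ _ (lc r)).
  - by [].
  - by move=> [w /O[wr|[_ rt']]]; [exists w|case: rt].
  - by move=> w wr; split; [apply/O; left|rewrite sgn|].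
have fU u : under D u -> frac u \in a :: under_params D.
  move=> uU; rewrite inE mem_under; apply/orP; right; apply/asboolP; split.
    exact: frac_itv.
  exact: under_same (same_param_frac u) uU.
apply: (@alexander_ideal_transfer _ D D' (a :: under_params D) a).
- by rewrite mem_head.
- by move=> u /fU; exact: spanned_under.
- move=> u [w /O[wu|[_ ut]]]; first by apply/spanned_under/fU; exists w.
  apply: spanned_eq (spanned_mem D' (mem_head a _)) => X c /DD' cc.
  rewrite -(coloring_same cc ut); apply: (coloring_const cc); first exact: ltW.
  by move=> r /andP[ar rt]; apply: U; rewrite ar (ltW (lt_trans rt tb)).
- by move=> X c /DD' cc; exists c.
- by move=> X c /DD' cc; exists c.
Qed.

(** The strand [c, d] passes under [a, b] at [v1] and [v2]. The label between is determined by those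
    at a and c, and the second crossing, of opposite sign, undoes the first, so colorings change
    only inside [c, d]. *)
Lemma alexander_ideal_r2 D D' a b c d o1 o2 v1 v2 :
  a < b < a + 1 -> c < d < c + 1 ->
  (forall r, closed_arc a b r -> closed_arc c d r -> False) ->
  a < o1 < b -> a < o2 < b -> c < v1 -> v1 < v2 -> v2 < d ->
  (forall u, closed_arc a b u \/ closed_arc c d u -> ~ under D u) ->
  (forall w u, is_over D w u -> ~ closed_arc c d w) ->
  (forall w u, is_over D' w u <-> [\/ is_over D w u, same_param w o1 /\ same_param u v1
     | same_param w o2 /\ same_param u v2]) ->
  (forall w u, is_over D w u -> strand_sign D' w u = strand_sign D w u) ->
  strand_sign D' o2 v2 = - strand_sign D' o1 v1 ->
  alexander_ideal D = alexander_ideal D'.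
Proof.
move=> /andP[ab ba] /andP[cd dc] disj /andP[ao1 o1b] /andP[ao2 o2b] cv1 v12 v2d U NW O sgn sgn2.
have abD r : a <= r <= b -> ~ under D r by move=> rab; apply: U; left; exact: closed_arc_in.
have cdD r : c <= r <= d -> ~ under D r by move=> rcd; apply: U; right; exact: closed_arc_in.
have O1 : is_over D' o1 v1 by apply/O; apply: Or32; split; exact: same_param_refl.
have O2 : is_over D' o2 v2 by apply/O; apply: Or33; split; exact: same_param_refl.
have abD' r : a <= r <= b -> ~ under D' r.
  move=> rab [w /O[wr|[_ rv]|[_ rv]]]; first by apply: (abD r) => //; exists w.
    apply: (disj v1); last by apply: closed_arc_in; apply/andP; split; lra.
    by apply: closed_arc_same rv _; exact: closed_arc_in.
  apply: (disj v2); last by apply: closed_arc_in; apply/andP; split; lra.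
  by apply: closed_arc_same rv _; exact: closed_arc_in.
have cdD' r w : c <= r <= d -> is_over D' w r ->
    same_param w o1 /\ r = v1 \/ same_param w o2 /\ r = v2.
  move=> rcd /O[wr|[wo rv]|[wo rv]]; first by case: (cdD r) => //; exists w.
    by left; split=> //; apply: (@same_param_eq c) rv _ _; apply/andP; split; lra.
  by right; split=> //; apply: (@same_param_eq c) rv _ _; apply/andP; split; lra.
have abN r : a <= r <= b -> ~ closed_arc c d r.
  by move=> rab; apply: disj; exact: closed_arc_in.
have cd1 : c <= d < c + 1 by rewrite ltW.
have const0 D1 (X : lmodType laurent) (f : R -> X) : coloring D1 f ->
    (forall r, a <= r <= b -> ~ under D1 r) -> forall r, a <= r <= b -> f r = f a.
  move=> fc nU r /andP[ar rb]; apply: (coloring_const fc) => // y /andP[ay yr].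
  by apply: nU; rewrite ay (le_trans (ltW yr)).
have runD' (X : lmodType laurent) (f : R -> X) : coloring D' f ->
    [/\ f v1 = f c, f v2 = quandle_op (strand_sign D' o1 v1) (f c) (f a) & f d = f c].
  move=> fc; have fa := const0 _ _ _ fc abD'.
  (* The midpoint leaves a single undercrossing on each side. *)
  pose m := (v1 + v2) / 2.
  have U1 r : c <= r < m -> under D' r -> r = v1.
    move=> /andP[cr rm] [w /cdD'[]]; rewrite /m in rm; first by apply/andP; split; lra.
      by case.
    by move=> [_ rE]; exfalso; lra.
  have U2 r : m <= r < d -> under D' r -> r = v2.
    move=> /andP[cr rm] [w /cdD'[]]; rewrite /m in cr; first by apply/andP; split; lra.
      by move=> [_ rE]; exfalso; lra.
    by case.
  have h1 : c <= v1 < m by rewrite /m; apply/andP; split; lra.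
  have h2 : m <= v2 < d by rewrite /m; apply/andP; split; lra.
  have [f1 f1'] := coloring_cross fc h1 U1 O1.
  have [f2 f2'] := coloring_cross fc h2 U2 O2.
  have fm : f m = quandle_op (strand_sign D' o1 v1) (f c) (f a).
    have hm : v1 < m <= m by rewrite lexx andbT /m; lra.
    by rewrite (f1' _ hm) (fa o1)// !ltW.
  have hd : v2 < d <= d by rewrite v2d lexx.
  have ho2 : a <= o2 <= b by rewrite !ltW.
  split=> //; first by rewrite f2.
  rewrite (f2' _ hd) fm (fa _ ho2) sgn2 -[X in quandle_op _ (quandle_op X _ _)]opprK.
  exact: quandle_opK.
have fU u : under D u -> frac u \in a :: c :: under_params D.
  move=> uU; rewrite !inE mem_under; apply/orP; right; apply/orP; right; apply/asboolP; split.
    exact: frac_itv.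
  exact: under_same (same_param_frac u) uU.
have agree (X : lmodType laurent) (f g : R -> X) : g c = f c ->
    forall y, y \in a :: c :: under_params D -> splice f c d g y = f y.
  move=> gc y; rewrite !inE => /orP[/eqP->|/orP[/eqP->|]].
  - by apply: splice_out; apply: abN; rewrite lexx ltW.
  - by rewrite splice_in ?lexx ?ltW.
  - rewrite mem_under => /asboolP[_ yU]; apply: splice_out => ycd.
    by apply: (U y) => //; right.
apply: (@alexander_ideal_transfer _ D D' (a :: c :: under_params D) a).
- by rewrite mem_head.
- by move=> u /fU; exact: spanned_under.
- have sa : spanned D' (a :: c :: under_params D) a by apply: spanned_mem; rewrite mem_head.
  have sc : spanned D' (a :: c :: under_params D) c by apply: spanned_mem; rewrite !inE eqxx orbT.
  move=> u [w /O[wu|[_ uv]|[_ uv]]]; first by apply/spanned_under/fU; exists w.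
    apply: spanned_eq sc => X f fc; rewrite -(coloring_same fc uv).
    by have [] := runD' _ _ fc.
  apply: (@spanned_op _ _ _ (strand_sign D' o1 v1) _ _ _ _ sc sa) => X f fc.
  by rewrite -(coloring_same fc uv); have [] := runD' _ _ fc.
- move=> X f fc; have [f1 lf] := (local_coloringP _ _).1 fc.
  have fa := const0 _ _ _ fc abD.
  have fd : f d = f c.
    apply: (coloring_const fc); first exact: ltW.
    by move=> r /andP[cr rd]; apply: cdD; rewrite cr ltW.
  pose y1 := quandle_op (strand_sign D' o1 v1) (f c) (f a).
  (* The new labels along [c, d]. The value at a jump is the left one, since at an undercrossing a
     coloring has the incoming label. *)
  pose g r := if r <= v1 then f c else if r <= v2 then y1 else f c.
  have gc : g c = f c by rewrite /g ltW.
  have gv1 : g v1 = f c by rewrite /g lexx.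
  have gv2 : g v2 = y1 by rewrite /g lexx leNgt v12.
  exists (splice f c d g); last exact: agree.
  apply/local_coloringP; split; first exact: splice_periodic.
  move=> r; have [rcd|rcd] := pselect (closed_arc c d r); last first.
    have [e e0 eN] := closed_arc_compl cd1 rcd.
    apply: (local_coloring_near e0 _ _ _ (lf r)) => [t /eN tN|[w wr]|w wr].
    + exact: splice_out.
    + by exists w; apply/O; apply: Or31.
    + move/O: wr => [wr|[_ rv]|[_ rv]].
      * by split; [exact: wr|exact: sgn|apply: splice_out; exact: NW wr].
      * case: rcd; apply: closed_arc_same (same_param_sym rv) _; apply: closed_arc_in.
        by apply/andP; split; lra.
      * case: rcd; apply: closed_arc_same (same_param_sym rv) _; apply: closed_arc_in.
        by apply/andP; split; lra.
  have [r' rr' r'cd] := closed_arcP rcd.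
  apply: (local_coloring_same (splice_periodic c d g f1) (same_param_sym rr')).
  have fo w o : a < o < b -> same_param w o -> splice f c d g w = f a.
    move=> /andP[ao ob] wo; rewrite -(periodic_same (splice_periodic c d g f1) wo).
    rewrite splice_out; first by rewrite fa// !ltW.
    by apply: abN; rewrite !ltW.
  apply: (@local_coloring_strand D D' X f (splice f c d g) g c d) => //.
  + by move=> t tcd; apply: splice_in.
  + have [e e0 eN] := closed_arc_left cd1.
    by exists e => // t /eN tN; apply: splice_out.
  + have [e e0 eN] := closed_arc_right cd1.
    by exists e => // t /eN tN; apply: splice_out.
  + by apply: cdD; rewrite lexx ltW.
  + move=> [w /cdD'[]]; first by rewrite lexx ltW.
      by move=> [_ rE]; lra.
    by move=> [_ rE]; lra.
  + by rewrite /g !ifF ?fd//; apply/negbTE; rewrite -ltNge; lra.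
  + move=> x; apply: step_left => _; first exact: cst_left.
    by apply: step_left => _; exact: cst_left.
  + move=> x /andP[cx xd] xU.
    apply: step_right => [xv|vx]; first by rewrite /g ltW//; exact: cst_right.
    have xv1 : v1 < x.
      rewrite lt_neqAle vx andbT; apply/eqP => xE; apply: xU; rewrite -xE.
      by exists o1.
    rewrite /g ifF; last by apply/negbTE; rewrite -ltNge.
    apply: step_right => [xv|v2x]; first by rewrite ltW//; exact: cst_right.
    have xv2 : v2 < x.
      rewrite lt_neqAle v2x andbT; apply/eqP => xE; apply: xU; rewrite -xE.
      by exists o2.
    by rewrite ifF; [exact: cst_right|apply/negbTE; rewrite -ltNge].
  + move=> w x /andP[cx xd] wx.
    have xcd : c <= x <= d by rewrite cx ltW.
    have [[wo xE]|[wo xE]] := cdD' _ _ xcd wx.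
      have -> : strand_sign D' w x = strand_sign D' o1 v1.
        by rewrite xE /strand_sign (crossing_det_same D' (same_param_sym wo) (same_param_refl v1)).
      rewrite (fo _ o1) ?ao1// xE gv1 -/y1.
      apply: step_right => [|_]; first by rewrite ltxx.
      by apply: step_right => [_|]; [exact: cst_right|rewrite leNgt v12].
    have -> : strand_sign D' w x = strand_sign D' o2 v2.
      by rewrite xE /strand_sign (crossing_det_same D' (same_param_sym wo) (same_param_refl v2)).
    rewrite (fo _ o2) ?ao2// xE gv2.
    have -> : quandle_op (strand_sign D' o2 v2) y1 (f a) = f c.
      rewrite /y1 sgn2 -[X in quandle_op _ (quandle_op X _ _)]opprK.
      exact: quandle_opK.
    apply: step_right => [|_]; first by rewrite ltNge ltW.
    by apply: step_right => [|_]; [rewrite ltxx|exact: cst_right].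
- move=> X f fc; have [f1 lf] := (local_coloringP _ _).1 fc.
  have [fv1 fv2 fd] := runD' _ _ fc.
  (* In [D] the strand has no undercrossing and keeps its incoming label throughout. *)
  exists (splice f c d (fun=> f c)); last exact: agree.
  apply/local_coloringP; split; first exact: splice_periodic.
  move=> r; have [rcd|rcd] := pselect (closed_arc c d r); last first.
    have [e e0 eN] := closed_arc_compl cd1 rcd.
    apply: (local_coloring_near e0 _ _ _ (lf r)) => [t /eN tN|[w wr]|w wr].
    + exact: splice_out.
    + move/O: wr => [wr|[_ rv]|[_ rv]]; first by exists w.
      * case: rcd; apply: closed_arc_same (same_param_sym rv) _; apply: closed_arc_in.
        by apply/andP; split; lra.
      * case: rcd; apply: closed_arc_same (same_param_sym rv) _; apply: closed_arc_in.
        by apply/andP; split; lra.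
    + split; [by apply/O; apply: Or31|by rewrite sgn|].
      by apply: splice_out; exact: NW wr.
  have [r' rr' r'cd] := closed_arcP rcd.
  apply: (local_coloring_same (splice_periodic c d _ f1) (same_param_sym rr')).
  apply: (@local_coloring_strand D' D X f (splice f c d (fun=> f c)) (fun=> f c) c d) => //.
  + by move=> t tcd; apply: splice_in.
  + have [e e0 eN] := closed_arc_left cd1.
    by exists e => // t /eN tN; apply: splice_out.
  + have [e e0 eN] := closed_arc_right cd1.
    by exists e => // t /eN tN; apply: splice_out.
  + move=> [w /cdD'[]]; first by rewrite lexx ltW.
      by move=> [_ rE]; lra.
    by move=> [_ rE]; lra.
  + by apply: cdD; rewrite lexx ltW.
  + by move=> x; exact: cst_left.
  + by move=> x _ _; exact: cst_right.
  + move=> w x /andP[cx xd] wx; case: (cdD x); first by rewrite cx ltW.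
    by exists w.
Qed.

End Transfer.

Section TwoStep.
Variables (R : realType) (X : Type) (p q : R) (x0 x1 x2 : X).
Hypothesis pq : p < q.

(** Labels along a strand with undercrossings at p and q; the value at each of them is the incoming
    label. *)
Definition two_step (r : R) := if r <= p then x0 else if r <= q then x1 else x2.

Lemma two_step_le r : r <= p -> two_step r = x0.
Proof. by rewrite /two_step => ->. Qed.

Lemma two_step_mid r : p < r -> r <= q -> two_step r = x1.
Proof. by move=> pr rq; rewrite /two_step leNgt pr rq. Qed.

Lemma two_step_gt r : q < r -> two_step r = x2.
Proof. by move=> qr; rewrite /two_step !leNgt qr (lt_trans pq qr). Qed.

Lemma two_step_left r : left_const two_step r (two_step r).
Proof.
apply: step_left => _; first exact: cst_left.
by apply: step_left => _; exact: cst_left.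
Qed.

Lemma two_step_right_p : right_const two_step p x1.
Proof.
apply: step_right => [|_]; first by rewrite ltxx.
by apply: step_right => [_|]; [exact: cst_right|rewrite leNgt pq].
Qed.

Lemma two_step_right_q : right_const two_step q x2.
Proof.
apply: step_right => [|_]; first by rewrite ltNge ltW.
by apply: step_right => [|_]; [rewrite ltxx|exact: cst_right].
Qed.

Lemma two_step_right r : r <> p -> r <> q -> right_const two_step r (two_step r).
Proof.
move=> /eqP rp /eqP rq; have [rp'|pr|/eqP] := ltgtP r p; last by rewrite (negPf rp).
  rewrite two_step_le ?ltW//; apply: step_right => [_|]; first exact: cst_right.
  by rewrite leNgt rp'.
have [rq'|qr|/eqP] := ltgtP r q; last by rewrite (negPf rq).
  rewrite two_step_mid ?ltW//; apply: step_right => [|_]; first by rewrite ltNge ltW.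
  by apply: step_right => [_|]; [exact: cst_right|rewrite leNgt rq'].
rewrite two_step_gt//; apply: step_right => [|_]; first by rewrite ltNge ltW.
by apply: step_right => [|_]; [rewrite ltNge ltW|exact: cst_right].
Qed.

End TwoStep.

Section Signs.
Variable R : realType.
Implicit Types x y z : R.

Lemma mul_sub_lt0l x y z : (x - y) * (x - z) < 0 -> (x < y) = ~~ (x < z).
Proof.
have [xy|xy|->] := ltgtP x y.
- rewrite nmulr_rlt0 ?subr_lt0// subr_gt0 => zx.
  by rewrite -leNgt ltW.
- by rewrite pmulr_rlt0 ?subr_gt0// subr_lt0 => ->.
- by rewrite subrr mul0r ltxx.
Qed.

Lemma mul_sub_lt0r x y z : (x - y) * (x - z) < 0 -> (y < x) = ~~ (z < x).
Proof.
have [xy|xy|->] := ltgtP x y.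
- by rewrite nmulr_rlt0 ?subr_lt0// subr_gt0 => ->.
- rewrite pmulr_rlt0 ?subr_gt0// subr_lt0 => zx.
  by rewrite -leNgt ltW.
- by rewrite subrr mul0r ltxx.
Qed.

Lemma mul_sub_pn x y z w : y < x -> z < w -> (x - y) * (z - w) < 0.
Proof. by move=> yx zw; rewrite pmulr_rlt0 ?subr_gt0// subr_lt0. Qed.

Lemma mul_sub_np x y z w : x < y -> w < z -> (x - y) * (z - w) < 0.
Proof. by move=> xy wz; rewrite nmulr_rlt0 ?subr_lt0// subr_gt0. Qed.

Lemma mul_sub_pp x y z w : y < x -> w < z -> 0 < (x - y) * (z - w).
Proof. by move=> yx wz; rewrite mulr_gt0 ?subr_gt0. Qed.

Lemma mul_sub_nn x y z w : x < y -> z < w -> 0 < (x - y) * (z - w).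
Proof. by move=> xy zw; rewrite nmulr_rgt0 subr_lt0. Qed.

End Signs.

Section Nearby.
Variable R : realType.
Implicit Types (x r t w z P Q : R).

Lemma strand_sign_same (D : diagram R) w z w' z' : same_param w w' -> z = z' ->
  strand_sign D w z = strand_sign D w' z'.
Proof.
move=> ww ->; rewrite /strand_sign.
by rewrite (crossing_det_same D (same_param_sym ww) (same_param_refl z')).
Qed.

Lemma left_near2 (U V : set R) x :
  (exists2 y, 0 < y & forall t, x - y < t < x -> ~ U t) ->
  (exists2 y, 0 < y & forall t, x - y < t < x -> ~ V t) ->
  exists2 y, 0 < y & forall t, x - y < t < x -> ~ U t /\ ~ V t.
Proof.
move=> [y y0 yN] [z z0 zN]; exists (Num.min y z) => [|t /andP[m3 m4]]; first by rewrite lt_min y0.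
have m1 : Num.min y z <= y by rewrite ge_min lexx.
have m2 : Num.min y z <= z by rewrite ge_min lexx orbT.
by split; [apply: yN|apply: zN]; rewrite m4 andbT; apply: le_lt_trans m3; rewrite lerB.
Qed.

Lemma right_near2 (U V : set R) x :
  (exists2 y, 0 < y & forall t, x < t < x + y -> ~ U t) ->
  (exists2 y, 0 < y & forall t, x < t < x + y -> ~ V t) ->
  exists2 y, 0 < y & forall t, x < t < x + y -> ~ U t /\ ~ V t.
Proof.
move=> [y y0 yN] [z z0 zN]; exists (Num.min y z) => [|t /andP[m3 m4]]; first by rewrite lt_min y0.
have m1 : Num.min y z <= y by rewrite ge_min lexx.
have m2 : Num.min y z <= z by rewrite ge_min lexx orbT.
by split; [apply: yN|apply: zN]; rewrite m3; apply: lt_le_trans m4 _; rewrite lerD2l.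
Qed.

Lemma closed_arc_compl_left P Q x : P <= Q < P + 1 -> ~ closed_arc P Q x ->
  exists2 y, 0 < y & forall t, x - y < t < x -> ~ closed_arc P Q t.
Proof.
move=> PQ nx; have [y y0 yN] := closed_arc_compl PQ nx; exists y => [//|t /andP[m1 m2]].
by apply: yN; rewrite m1 (lt_trans m2)// ltrDl.
Qed.

Lemma closed_arc_compl_right P Q x : P <= Q < P + 1 -> ~ closed_arc P Q x ->
  exists2 y, 0 < y & forall t, x < t < x + y -> ~ closed_arc P Q t.
Proof.
move=> PQ nx; have [y y0 yN] := closed_arc_compl PQ nx; exists y => [//|t /andP[m1 m2]].
by apply: yN; rewrite m2 andbT (lt_trans _ m1)// ltrBlDr ltrDl.
Qed.

Lemma closed_arc_compl2 P Q P' Q' r : P <= Q < P + 1 -> P' <= Q' < P' + 1 ->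
  ~ closed_arc P Q r -> ~ closed_arc P' Q' r ->
  exists2 y, 0 < y & forall t, r - y < t < r + y -> ~ closed_arc P Q t /\ ~ closed_arc P' Q' t.
Proof.
move=> h h' n n'; have [y y0 yN] := closed_arc_compl h n; have [z z0 zN] := closed_arc_compl h' n'.
exists (Num.min y z) => [|t /andP[m3 m4]]; first by rewrite lt_min y0.
have m1 : Num.min y z <= y by rewrite ge_min lexx.
have m2 : Num.min y z <= z by rewrite ge_min lexx orbT.
by split; [apply: yN|apply: zN]; apply/andP; split; lra.
Qed.

End Nearby.

(** * The third Reidemeister move *)

Section R3.
Variable R : realType.
Implicit Types (D : diagram R) (r s t u v w z : R).
Variables a b c d e f : R.
Hypotheses (hab : a < b < a + 1) (hcd : c < d < c + 1) (hef : e < f < e + 1).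
Hypothesis ab_cd : forall r, closed_arc a b r -> closed_arc c d r -> False.
Hypothesis ab_ef : forall r, closed_arc a b r -> closed_arc e f r -> False.
Hypothesis cd_ef : forall r, closed_arc c d r -> closed_arc e f r -> False.

Let A r := [\/ closed_arc a b r, closed_arc c d r | closed_arc e f r].

(** The strand [a, b] is the top one, [c, d] the middle one, [e, f] the bottom one. *)
Definition r3_tangle D s2 t2 s3 t3 u v : Prop :=
  [/\ (a < s2 < b) /\ (a < s3 < b), (c < t2 < d) /\ (c < u < d),
      (e < t3 < f) /\ (e < v < f), u <> t2 /\ v <> t3 &
      [/\ is_over D s2 t2, is_over D s3 t3, is_over D u v &
        forall w z, is_over D w z -> A z ->
          [\/ same_param w s2 /\ same_param z t2, same_param w s3 /\ same_param z t3
            | same_param w u /\ same_param z v]]].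

(** The triangle condition for the top strand, as a dependence of its two crossing signs on the
    orders of the crossings along the lower strands. It selects the quandle identity for equal or
    for opposite signs. *)
Definition r3_signs D s2 t2 s3 t3 u v : Prop :=
  (0 < (u - t2) * (v - t3) -> strand_sign D s2 t2 = strand_sign D s3 t3) /\
  ((u - t2) * (v - t3) < 0 -> strand_sign D s2 t2 = - strand_sign D s3 t3).

Let inab r : a <= r <= b -> closed_arc a b r. Proof. exact: closed_arc_in. Qed.
Let incd r : c <= r <= d -> closed_arc c d r. Proof. exact: closed_arc_in. Qed.
Let inef r : e <= r <= f -> closed_arc e f r. Proof. exact: closed_arc_in. Qed.

Section Tangle.
Variables (D : diagram R) (s2 t2 s3 t3 u v : R).
Hypothesis tD : r3_tangle D s2 t2 s3 t3 u v.

Lemma tangle_top r : closed_arc a b r -> ~ under D r.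
Proof.
case: tD => _ [t2cd _] [t3ef vef] _ [_ _ _ O] rab [w wr].
have [[_ rt]|[_ rt]|[_ rv]] := O _ _ wr (Or31 _ _ rab).
- by apply: (ab_cd rab); apply: closed_arc_same (same_param_sym rt) (incd _); rewrite !ltW; case/andP: t2cd.
- by apply: (ab_ef rab); apply: closed_arc_same (same_param_sym rt) (inef _); rewrite !ltW; case/andP: t3ef.
- by apply: (ab_ef rab); apply: closed_arc_same (same_param_sym rv) (inef _); rewrite !ltW; case/andP: vef.
Qed.

Lemma tangle_mid w r : c <= r <= d -> is_over D w r -> same_param w s2 /\ r = t2.
Proof.
case: tD => _ [/andP[ct td] _] [/andP[et tf] /andP[ev vf]] _ [_ _ _ O] rcd wr.
have /andP[cr rd] := rcd; have /andP[_ dc] := hcd.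
have [[ws rt]|[_ rt]|[_ rv]] := O _ _ wr (Or32 _ _ (incd rcd)).
- by split=> //; apply: (@same_param_eq R c) rt _ _; apply/andP; split; lra.
- by case: (cd_ef (incd rcd)); apply: closed_arc_same (same_param_sym rt) (inef _); rewrite !ltW.
- by case: (cd_ef (incd rcd)); apply: closed_arc_same (same_param_sym rv) (inef _); rewrite !ltW.
Qed.

Lemma tangle_bot w r : e <= r <= f -> is_over D w r ->
  same_param w s3 /\ r = t3 \/ same_param w u /\ r = v.
Proof.
case: tD => _ [/andP[ct td] _] [/andP[et tf] /andP[ev vf]] _ [_ _ _ O] ref wr.
have /andP[er rf] := ref; have /andP[_ fe] := hef.
have [[ws rt]|[wu rt]|[wu rv]] := O _ _ wr (Or33 _ _ (inef ref)).
- by case: (@cd_ef r); [apply: closed_arc_same (same_param_sym rt) (incd _); rewrite !ltW|exact: inef].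
- by left; split=> //; apply: (@same_param_eq R e) rt _ _; apply/andP; split; lra.
- by right; split=> //; apply: (@same_param_eq R e) rv _ _; apply/andP; split; lra.
Qed.

Variables (X : lmodType laurent) (h : R -> X).
Hypothesis hc : coloring D h.

Let al := strand_sign D s2 t2.
Let be := strand_sign D s3 t3.
Let ga := strand_sign D u v.

Lemma tangle_top_value r : a <= r <= b -> h r = h a.
Proof.
move=> /andP[ar rb]; apply: (coloring_const hc) => // y /andP[ay yr].
by apply: tangle_top; apply: inab; rewrite ay (le_trans (ltW yr)).
Qed.

Lemma tangle_mid_value : [/\ h t2 = h c, h d = quandle_op al (h c) (h a)
  & h u = if u < t2 then h c else quandle_op al (h c) (h a)].
Proof.
case: tD => [[/andP[as2 s2b] _] [/andP[ct td] /andP[cu ud]] _ [ut _] [k1 _ _ _]].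
have U r : c <= r < d -> under D r -> r = t2.
  by move=> /andP[cr rd] [w wr]; have [] // := @tangle_mid w r _ wr; rewrite cr ltW.
have tcd : c <= t2 < d by rewrite ltW.
have [h1 h2] := coloring_cross hc tcd U k1.
have hs2 : h s2 = h a by apply: tangle_top_value; rewrite !ltW.
split=> //; first by rewrite h2 ?td ?lexx// hs2.
case: ltgtP => [ut'|tu|//]; last by rewrite h2 ?tu ?ltW// hs2.
apply: (coloring_const hc) => [|r /andP[cr ru] rU]; first exact: ltW.
have rE : r = t2 by apply: U => //; rewrite cr (lt_trans ru).
by move: ru; rewrite rE ltNge ltW.
Qed.

Lemma tangle_bot_value : if t3 < v then
    [/\ h t3 = h e, h v = quandle_op be (h e) (h a)
      & h f = quandle_op ga (quandle_op be (h e) (h a)) (h u)]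
  else [/\ h v = h e, h t3 = quandle_op ga (h e) (h u)
      & h f = quandle_op be (quandle_op ga (h e) (h u)) (h a)].
Proof.
case: tD => [[_ /andP[as3 s3b]] _ [/andP[et tf] /andP[ev vf]] [_ vt] [_ k2 k3 _]].
have hs3 : h s3 = h a by apply: tangle_top_value; rewrite !ltW.
have U r : e <= r < f -> under D r -> r = t3 \/ r = v.
  move=> /andP[er rf] [w wr]; have [|[]|[]] := @tangle_bot w r _ wr; last by right.
    by rewrite er ltW.
  by left.
pose m := (t3 + v) / 2.
case: ltgtP => [tv|vt'|//]; last by move=> vt'; case: vt; rewrite vt'.
  have h1 : e <= t3 < m by rewrite /m; apply/andP; split; lra.
  have h2 : m <= v < f by rewrite /m; apply/andP; split; lra.
  have U1 r : e <= r < m -> under D r -> r = t3.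
    move=> /andP[er rm] /U[||rE]//; first by rewrite er; rewrite /m in rm; lra.
    by exfalso; move: rm; rewrite /m rE; lra.
  have U2 r : m <= r < f -> under D r -> r = v.
    move=> /andP[er rm] /U[|rE|]//; first by rewrite rm andbT; rewrite /m in er; lra.
    by exfalso; move: er; rewrite /m rE; lra.
  have [f1 f1'] := coloring_cross hc h1 U1 k2.
  have [f2 f2'] := coloring_cross hc h2 U2 k3.
  have hm : h m = quandle_op be (h e) (h a).
    by rewrite f1' ?hs3//; rewrite /m; apply/andP; split; lra.
  by split; rewrite ?f1 ?f2// f2' ?vf ?lexx// hm.
have h1 : e <= v < m by rewrite /m; apply/andP; split; lra.
have h2 : m <= t3 < f by rewrite /m; apply/andP; split; lra.
have U1 r : e <= r < m -> under D r -> r = v.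
  move=> /andP[er rm] /U[|rE|]//; first by rewrite er; rewrite /m in rm; lra.
  by exfalso; move: rm; rewrite /m rE; lra.
have U2 r : m <= r < f -> under D r -> r = t3.
  move=> /andP[er rm] /U[||rE]//; first by rewrite rm andbT; rewrite /m in er; lra.
  by exfalso; move: er; rewrite /m rE; lra.
have [f1 f1'] := coloring_cross hc h1 U1 k3.
have [f2 f2'] := coloring_cross hc h2 U2 k2.
have hm : h m = quandle_op ga (h e) (h u).
  by rewrite f1'//; rewrite /m; apply/andP; split; lra.
by split; rewrite ?f1 ?f2// f2' ?tf ?lexx// hm hs3.
Qed.

End Tangle.

Section Transfer.
Variables (D D' : diagram R) (s2 t2 s3 t3 s2' t2' s3' t3' u v : R).
Hypotheses (tD : r3_tangle D s2 t2 s3 t3 u v) (tD' : r3_tangle D' s2' t2' s3' t3' u v).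
Hypothesis sgD : r3_signs D s2 t2 s3 t3 u v.
Hypotheses (sg2 : strand_sign D' s2' t2' = strand_sign D s2 t2)
  (sg3 : strand_sign D' s3' t3' = strand_sign D s3 t3)
  (sguv : strand_sign D' u v = strand_sign D u v).
Hypotheses (rev2 : (u - t2) * (u - t2') < 0) (rev3 : (v - t3) * (v - t3') < 0).
Hypothesis outside : forall w z, ~ A z -> (is_over D' w z <-> is_over D w z).
Hypothesis outside_over : forall w z, is_over D w z -> ~ A z -> ~ A w.
Hypothesis outside_sign : forall w z, is_over D w z -> ~ A z ->
  strand_sign D' w z = strand_sign D w z.

(** The labels at the entrances a, c and e are kept and propagated through the new tangle. The
    labels agree directly at the exits b and d; at the exit f of the bottom strand, they agree by
    the quandle identities. *)
Lemma r3_transfer (X : lmodType laurent) (h : R -> X) : coloring D h ->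
  exists2 h' : R -> X, coloring D' h' &
    [/\ forall y, ~ A y -> h' y = h y, h' a = h a, h' c = h c & h' e = h e].
Proof.
move=> hc; have [h1 lh] := (local_coloringP _ _).1 hc.
have [[/andP[as2 s2b] /andP[as3 s3b]] [/andP[ct2 t2d] /andP[cu ud]]
  [/andP[et3 t3f] /andP[ev vf]] [ut2 vt3] [k1 k2 k3 K]] := tD.
have [[/andP[as2' s2b'] /andP[as3' s3b']] [/andP[ct2' t2d'] _]
  [/andP[et3' t3f'] _] [ut2' vt3'] [k1' k2' k3' K']] := tD'.
have [/andP[ab ba] /andP[cd dc] /andP[ef fe]] := And3 hab hcd hef.
have cd1 : c <= d < c + 1 by rewrite ltW.
have ef1 : e <= f < e + 1 by rewrite ltW.
pose al := strand_sign D s2 t2; pose be := strand_sign D s3 t3; pose ga := strand_sign D u v.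
have [ht2 hd hu] : [/\ h t2 = h c, h d = quandle_op al (h c) (h a)
  & h u = if u < t2 then h c else quandle_op al (h c) (h a)] := tangle_mid_value tD hc.
have hbot : if t3 < v then
    [/\ h t3 = h e, h v = quandle_op be (h e) (h a)
      & h f = quandle_op ga (quandle_op be (h e) (h a)) (h u)]
  else [/\ h v = h e, h t3 = quandle_op ga (h e) (h u)
      & h f = quandle_op be (quandle_op ga (h e) (h u)) (h a)] := tangle_bot_value tD hc.
have htop := tangle_top_value tD hc.
have [same opp] : (0 < (u - t2) * (v - t3) -> al = be) /\
  ((u - t2) * (v - t3) < 0 -> al = - be) := sgD.
have sal : strand_sign D' s2' t2' = al := sg2.
have sbe : strand_sign D' s3' t3' = be := sg3.
have sga : strand_sign D' u v = ga := sguv.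
clearbody al be ga.
pose y1 := quandle_op al (h c) (h a).
(* The middle strand has a single undercrossing. The second step is put at [t2' + 1], which is
   beyond d, and does not change the label. *)
pose gm := two_step t2' (t2' + 1) (h c) y1 y1.
have t2lt : t2' < t2' + 1 by rewrite ltrDl.
pose hu' := if u < t2' then h c else y1.
have gmu : gm u = hu'.
  rewrite /gm /hu'; have [lt|gt|e0] := ltgtP u t2'; last by case: ut2'.
    by apply: two_step_le; exact: ltW.
  by rewrite /two_step leNgt gt /=; case: ifP.
pose z1 := if t3' < v then quandle_op be (h e) (h a) else quandle_op ga (h e) hu'.
pose z2 := if t3' < v then quandle_op ga z1 hu' else quandle_op be z1 (h a).
pose p := Num.min t3' v; pose q := Num.max t3' v.
have pqE : if t3' < v then p = t3' /\ q = v else p = v /\ q = t3'.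
  rewrite /p /q; have [l|l|e0] := ltgtP t3' v; last by case: vt3'.
    by split.
  by split.
have pq : p < q.
  move: pqE; have [l|l|e0] := ltgtP t3' v; last by case: vt3'.
    by case=> -> ->.
  by case=> -> ->.
pose gb := two_step p q (h e) z1 z2.
(* The move reverses the orders along both lower strands, so the new orders determine the old ones.
   In each of the four cases the triangle condition tells whether [al] is [be] or its opposite. *)
have z2E : z2 = h f.
  move: hbot; rewrite /z2 /z1.
  have e2 : (u < t2) = ~~ (u < t2') by apply: mul_sub_lt0l.
  have e3 : (t3 < v) = ~~ (t3' < v) by apply: mul_sub_lt0r.
  rewrite e3 hu /hu' e2; case: (ltP t3' v) e3 => /= c3 e3; case: (ltP u t2') e2 => /= c2 e2.
  - have t2u : t2 < u by rewrite lt_neqAle leNgt e2 andbT eq_sym; apply/eqP.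
    have vt3l : v < t3 by rewrite lt_neqAle leNgt e3 andbT eq_sym; apply/eqP => e0; apply: vt3.
    have aE : al = - be by exact: opp (mul_sub_pn t2u vt3l).
    by case=> _ _ ->; rewrite /y1 aE; exact: (quandle_op_move_opp ga be (h a) (h c) (h e)).
  - have ut2l : u < t2 by rewrite e2.
    have vt3l : v < t3 by rewrite lt_neqAle leNgt e3 andbT eq_sym; apply/eqP => e0; apply: vt3.
    have aE : al = be by exact: same (mul_sub_nn ut2l vt3l).
    by case=> _ _ ->; rewrite /y1 aE; exact: (quandle_op_move_same ga be (h a) (h c) (h e)).
  - have t2u : t2 < u by rewrite lt_neqAle leNgt e2 andbT eq_sym; apply/eqP.
    have vt3l : t3 < v by rewrite e3.
    have aE : al = be by exact: same (mul_sub_pp t2u vt3l).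
    by case=> _ _ ->; rewrite /y1 aE; exact/esym/(quandle_op_move_same ga be (h a) (h c) (h e)).
  - have ut2l : u < t2 by rewrite e2.
    have vt3l : t3 < v by rewrite e3.
    have aE : al = - be by exact: opp (mul_sub_np ut2l vt3l).
    by case=> _ _ ->; rewrite /y1 aE; exact/esym/(quandle_op_move_opp ga be (h a) (h c) (h e)).
clear ut2 vt3 ut2' vt3' same opp rev2 rev3 sgD.
pose h2 := splice h c d gm.
pose h' := splice h2 e f gb.
have h21 : forall t, h2 (t + 1) = h2 t := splice_periodic c d gm h1.
have h'1 : forall t, h' (t + 1) = h' t := splice_periodic e f gb h21.
have h'cd r : c <= r <= d -> h' r = gm r.
  move=> rcd; rewrite -(splice_in h gm dc rcd).
  exact: (splice_out h2 gb (fun k => cd_ef (incd rcd) k)).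
have h'ef r : e <= r <= f -> h' r = gb r := @splice_in _ _ h2 e f gb r fe.
have h'out r : ~ closed_arc c d r -> ~ closed_arc e f r -> h' r = h r.
  by move=> n1 n2; rewrite -(splice_out h gm n1); exact: (splice_out h2 gb n2).
have h'ab r : closed_arc a b r -> h' r = h r.
  by move=> rab; apply: h'out => k; [exact: ab_cd rab k|exact: ab_ef rab k].
have noU' r : ~ closed_arc c d r -> ~ closed_arc e f r -> A r -> ~ under D' r.
  by move=> n1 n2 [rab|/n1[]|/n2[]]; exact: (tangle_top tD').
have noU r : ~ closed_arc c d r -> ~ closed_arc e f r -> A r -> ~ under D r.
  by move=> n1 n2 [rab|/n1[]|/n2[]]; exact: (tangle_top tD).
have cle : c <= c <= d by rewrite lexx ltW.
have dle : c <= d <= d by rewrite lexx ltW.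
have ele : e <= e <= f by rewrite lexx ltW.
have fle : e <= f <= f by rewrite lexx ltW.
have t2'p : t2' < d by [].
have pe : e < p by rewrite /p lt_min et3' ev.
have qf : q < f by rewrite /q gt_max t3f' vf.
have gmc : gm c = h c by apply: two_step_le; exact: ltW.
have gmd : gm d = h d by rewrite hd /gm /two_step leNgt t2d' /=; case: ifP.
have gbe : gb e = h e by apply: two_step_le; exact: ltW.
have gbf : gb f = h f by rewrite -z2E; apply: two_step_gt.
exists h'; last first.
  split.
  - by move=> y yA; apply: h'out => yy; apply: yA; [apply: Or32|apply: Or33].
  - by apply: h'ab; apply: inab; rewrite lexx ltW.
  - by rewrite (h'cd _ cle).
  - by rewrite (h'ef _ ele).
have h's3 w s : a < s -> s < b -> same_param w s -> h' w = h a.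
  move=> as_ sb ws; rewrite -(periodic_same h'1 ws).
  have sab : a <= s <= b by rewrite !ltW.
  by rewrite (h'ab _ (inab sab)) (htop _ sab).
have t2'cd : c <= t2' <= d by rewrite !ltW.
have t3'ef : e <= t3' <= f by rewrite !ltW.
have vef : e <= v <= f by rewrite !ltW.
have ucd : c <= u <= d by rewrite !ltW.
have h'u w : same_param w u -> h' w = hu'.
  by move=> wu; rewrite -(periodic_same h'1 wu) (h'cd _ ucd).
have ncef x : c <= x <= d -> ~ closed_arc e f x by move=> /incd xcd; exact: cd_ef.
have nefc x : e <= x <= f -> ~ closed_arc c d x by move=> /inef xef k; exact: cd_ef k xef.
apply/local_coloringP; split; first exact: h'1.
move=> r; have [rcd|rcd] := pselect (closed_arc c d r).
  have [r' rr' r'cd] := closed_arcP rcd.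
  apply: (local_coloring_same h'1 (same_param_sym rr')).
  refine (@local_coloring_strand _ D D' X h h' gm c d cd h'cd _ _ hc _ _ gmc gmd _ _ _ r' r'cd).
  - have [y y0 yN] := left_near2 (closed_arc_left cd1) (closed_arc_compl_left ef1 (ncef _ cle)).
    exists y; [exact: y0|move=> t ty; have [n1 n2] := yN t ty; exact: h'out].
  - have [y y0 yN] := right_near2 (closed_arc_right cd1) (closed_arc_compl_right ef1 (ncef _ dle)).
    exists y; [exact: y0|move=> t ty; have [n1 n2] := yN t ty; exact: h'out].
  - move=> [w wd]; have [_ dE] := tangle_mid tD dle wd.
    by move: t2d; rewrite -dE ltxx.
  - move=> [w wd]; have [_ dE] := tangle_mid tD' dle wd.
    by move: t2d'; rewrite -dE ltxx.
  - by move=> x; exact: two_step_left.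
  - move=> x _ xU; have xt : x <> t2' by move=> xE; apply: xU; rewrite xE; exists s2'.
    have [->|/eqP xq] := eqVneq x (t2' + 1); last exact: (two_step_right _ _ _ t2lt xt xq).
    have -> : gm (t2' + 1) = y1 by apply: two_step_mid; rewrite ?lexx.
    exact: two_step_right_q.
  - move=> w x /andP[cx xd] wx; have xcd : c <= x <= d by rewrite cx ltW.
    have [ws xE] := tangle_mid tD' xcd wx.
    rewrite (strand_sign_same D' ws xE) sal xE (h's3 _ _ as2' s2b' ws).
    have -> : gm t2' = h c by apply: two_step_le.
    exact: two_step_right_p.
have [ref|ref] := pselect (closed_arc e f r).
  have [r' rr' r'ef] := closed_arcP ref.
  apply: (local_coloring_same h'1 (same_param_sym rr')).
  refine (@local_coloring_strand _ D D' X h h' gb e f ef h'ef _ _ hc _ _ gbe gbf _ _ _ r' r'ef).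
  - have [y y0 yN] := left_near2 (closed_arc_compl_left cd1 (nefc _ ele)) (closed_arc_left ef1).
    exists y; [exact: y0|move=> t ty; have [n1 n2] := yN t ty; exact: h'out].
  - have [y y0 yN] := right_near2 (closed_arc_compl_right cd1 (nefc _ fle)) (closed_arc_right ef1).
    exists y; [exact: y0|move=> t ty; have [n1 n2] := yN t ty; exact: h'out].
  - move=> [w wf]; have [[_ fE]|[_ fE]] := tangle_bot tD fle wf.
      by move: t3f; rewrite -fE ltxx.
    by move: vf; rewrite -fE ltxx.
  - move=> [w wf]; have [[_ fE]|[_ fE]] := tangle_bot tD' fle wf.
      by move: t3f'; rewrite -fE ltxx.
    by move: vf; rewrite -fE ltxx.
  - by move=> x; exact: two_step_left.
  - move=> x _ xU.
    have xt : x <> t3' by move=> xE; apply: xU; rewrite xE; exists s3'.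
    have xv : x <> v by move=> xE; apply: xU; rewrite xE; exists u.
    have [xp xq] : x <> p /\ x <> q.
      move: pqE; case: ifP => _ [pE qE]; rewrite pE qE.
        split; [exact: xt|exact: xv].
      split; [exact: xv|exact: xt].
    exact: two_step_right.
  - move=> w x /andP[ex xf] wx; have xef : e <= x <= f by rewrite ex ltW.
    have gbp : gb p = h e by apply: two_step_le.
    have gbq : gb q = z1 by apply: two_step_mid.
    have [[ws xE]|[wu xE]] := tangle_bot tD' xef wx.
      rewrite (strand_sign_same D' ws xE) sbe xE (h's3 _ _ as3' s3b' ws).
      move: pqE gbp gbq; case: ifP => tv [pE qE] gbp gbq.
        have -> : gb t3' = h e by rewrite -pE.
        have -> : quandle_op be (h e) (h a) = z1 by rewrite /z1 tv.
        by rewrite -pE; exact: two_step_right_p.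
      have -> : gb t3' = z1 by rewrite -qE.
      have -> : quandle_op be z1 (h a) = z2 by rewrite /z2 tv.
      by rewrite -qE; exact: two_step_right_q.
    rewrite (strand_sign_same D' wu xE) sga xE (h'u _ wu).
    move: pqE gbp gbq; case: ifP => tv [pE qE] gbp gbq.
      have -> : gb v = z1 by rewrite -qE.
      have -> : quandle_op ga z1 hu' = z2 by rewrite /z2 tv.
      by rewrite -qE; exact: two_step_right_q.
    have -> : gb v = h e by rewrite -pE.
    have -> : quandle_op ga (h e) hu' = z1 by rewrite /z1 tv.
    by rewrite -pE; exact: two_step_right_p.
have [y y0 yN] := closed_arc_compl2 cd1 ef1 rcd ref.
refine (@local_coloring_near _ D D' X h h' r _ y0 _ _ _ (lh r)).
- move=> t ty; have [n1 n2] := yN t ty; exact: h'out.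
- move=> [w wr]; have [rA|rA] := pselect (A r).
    by case: (noU _ rcd ref rA); exists w.
  by exists w; apply/outside.
- move=> w wr; have [rA|rA] := pselect (A r).
    by case: (noU' _ rcd ref rA); exists w.
  have wr' : is_over D w r by apply/(outside _ rA).
  split; [exact: wr'|exact: outside_sign|].
  have wA := outside_over wr' rA.
  by apply: h'out => k; apply: wA; [apply: Or32|apply: Or33].
Qed.

End Transfer.

(** The three entrances and the undercrossings outside the tangle; all labels at undercrossings
    inside it are computed from the entrances. *)
Definition r3_points D := [:: a; c; e] ++ [seq y <- under_params D | ~~ `[< A y >]].

Let A_same r r' : same_param r r' -> A r -> A r'.
Proof.
move=> rr' [rA|rA|rA]; [apply: Or31|apply: Or32|apply: Or33];
  exact: closed_arc_same rA.
Qed.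

Lemma r3_points_mem D y : under D y -> ~ A y -> frac y \in r3_points D.
Proof.
move=> yU yA; have yf := same_param_frac y.
rewrite mem_cat mem_filter mem_under; apply/orP; right; apply/andP; split.
  by apply/negP => /asboolP fA; apply: yA; exact: A_same (same_param_sym yf) fA.
by apply/asboolP; split; [exact: frac_itv|exact: under_same yU].
Qed.

Lemma r3_points_agree D (X : lmodType laurent) (h h' : R -> X) :
  [/\ forall y, ~ A y -> h' y = h y, h' a = h a, h' c = h c & h' e = h e] ->
  forall y, y \in r3_points D -> h' y = h y.
Proof.
move=> [hA ha hc he] y; rewrite mem_cat mem_filter !inE => /orP[/orP[/eqP->|/orP[/eqP->|/eqP->]]|].
- exact: ha.
- exact: hc.
- exact: he.
by move=> /andP[/negP yA _]; apply: hA => yA'; apply: yA; apply/asboolP.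
Qed.

Lemma r3_spanned D D' s2 t2 s3 t3 u v : r3_tangle D s2 t2 s3 t3 u v ->
  (forall w z, is_over D w z -> ~ A z -> under D' z) ->
  forall y, under D y -> spanned D (r3_points D') y.
Proof.
move=> tD DD' y [w wy]; set l := r3_points D'.
have la : spanned D l a by apply: spanned_mem; rewrite mem_cat !inE eqxx.
have lc : spanned D l c by apply: spanned_mem; rewrite mem_cat !inE eqxx orbT.
have le : spanned D l e by apply: spanned_mem; rewrite mem_cat !inE eqxx !orbT.
have lu : spanned D l u.
  have [ut|tu] := ltP u t2.
    apply: spanned_eq lc => X h hc; have [_ _ ->] := tangle_mid_value tD hc.
    by rewrite ut.
  apply: (@spanned_op _ _ _ (strand_sign D s2 t2) _ _ _ _ lc la) => X h hc.
  by have [_ _ ->] := tangle_mid_value tD hc; rewrite ltNge tu.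
have [yA|yA] := pselect (A y); last first.
  by apply: spanned_under; exact: r3_points_mem (DD' _ _ wy yA) yA.
have eqv z : same_param y z -> spanned D l z -> spanned D l y.
  move=> yz; apply: spanned_eq => X h hc; exact/esym/(coloring_same hc).
have [_ _ _ _ [_ _ _ K]] := tD; have [[_ yt]|[_ yt]|[_ yv]] := K _ _ wy yA.
- apply: (eqv _ yt); apply: spanned_eq lc => X h hc.
  by have [-> _ _] := tangle_mid_value tD hc.
- apply: (eqv _ yt); have [tv|vt] := ltP t3 v.
    apply: spanned_eq le => X h hc.
    by have := tangle_bot_value tD hc; rewrite tv => -[-> _ _].
  apply: (@spanned_op _ _ _ (strand_sign D u v) _ _ _ _ le lu) => X h hc.
  by have := tangle_bot_value tD hc; rewrite ltNge vt => -[_ -> _].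
- apply: (eqv _ yv); have [tv|vt] := ltP t3 v.
    apply: (@spanned_op _ _ _ (strand_sign D s3 t3) _ _ _ _ le la) => X h hc.
    by have := tangle_bot_value tD hc; rewrite tv => -[_ -> _].
  apply: spanned_eq le => X h hc.
  by have := tangle_bot_value tD hc; rewrite ltNge vt => -[-> _ _].
Qed.

Lemma alexander_ideal_r3 D D' s2 t2 s3 t3 s2' t2' s3' t3' u v :
  r3_tangle D s2 t2 s3 t3 u v -> r3_tangle D' s2' t2' s3' t3' u v ->
  r3_signs D s2 t2 s3 t3 u v -> r3_signs D' s2' t2' s3' t3' u v ->
  strand_sign D' s2' t2' = strand_sign D s2 t2 ->
  strand_sign D' s3' t3' = strand_sign D s3 t3 ->
  strand_sign D' u v = strand_sign D u v ->
  (u - t2) * (u - t2') < 0 -> (v - t3) * (v - t3') < 0 ->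
  (forall w z, ~ A z -> (is_over D' w z <-> is_over D w z)) ->
  (forall w z, is_over D w z -> ~ A z -> ~ A w) ->
  (forall w z, is_over D w z -> ~ A z -> strand_sign D' w z = strand_sign D w z) ->
  alexander_ideal D = alexander_ideal D'.
Proof.
move=> tD tD' sD sD' g2 g3 guv rev2 rev3 out out_over out_sign.
apply: (@alexander_ideal_transfer _ D D' (r3_points D) a).
- by rewrite mem_cat !inE eqxx.
- by apply: (r3_spanned tD) => w z wz _; exists w.
- by apply: (r3_spanned tD') => w z wz zA; exists w; apply/(out _ _ zA).
- move=> X h hc; have [h' h'c h'E] := r3_transfer tD tD' sD g2 g3 guv rev2 rev3 out out_over out_sign hc.
  exists h'; [exact: h'c|exact: r3_points_agree h'E].
- move=> X h hc.
  have out' w z : ~ A z -> (is_over D w z <-> is_over D' w z) by move=> zA; apply: iff_sym; exact: out.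
  have out_over' w z : is_over D' w z -> ~ A z -> ~ A w.
    by move=> wz zA; exact: (out_over _ _ ((out _ _ zA).1 wz) zA).
  have out_sign' w z : is_over D' w z -> ~ A z -> strand_sign D w z = strand_sign D' w z.
    by move=> wz zA; exact/esym/(out_sign _ _ ((out _ _ zA).1 wz) zA).
  have rev2' : (u - t2') * (u - t2) < 0 by rewrite mulrC.
  have rev3' : (v - t3') * (v - t3) < 0 by rewrite mulrC.
  have [h' h'c h'E] := r3_transfer tD' tD sD' (esym g2) (esym g3) (esym guv) rev2' rev3' out' out_over' out_sign' hc.
  exists h'; [exact: h'c|exact: r3_points_agree h'E].
Qed.

End R3.

(** * Invariance under each of the moves *)

Section Moves.
Variable R : realType.
Implicit Types (D : diagram R) (r s t u v w z : R).

Lemma coloring_same_crossings D D' (X : lmodType laurent) (c : R -> X) :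
  (forall s t, is_over D' s t <-> is_over D s t) ->
  (forall s t, is_over D s t -> strand_sign D' s t = strand_sign D s t) ->
  coloring D c -> coloring D' c.
Proof.
move=> O sgn [c1 lc rc oc]; split=> [|||s r].
- exact: c1.
- exact: lc.
- by move=> r nU; apply: rc; apply: contra_not nU => -[s /O sr]; exists s.
- by move=> /O sr; rewrite sgn//; exact: oc.
Qed.

Lemma alexander_ideal_same_crossings D D' :
  (forall s t, is_over D' s t <-> is_over D s t) ->
  (forall s t, is_over D s t -> strand_sign D' s t = strand_sign D s t) ->
  alexander_ideal D = alexander_ideal D'.
Proof.
move=> O sgn; have fU u : under D u -> frac u \in 0 :: under_params D.
  move=> uU; rewrite inE mem_under; apply/orP; right; apply/asboolP.
  by split; [exact: frac_itv|exact: under_same (same_param_frac u) uU].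
have O' s t : is_over D s t <-> is_over D' s t by apply: iff_sym; exact: O.
have sgn' s t : is_over D' s t -> strand_sign D s t = strand_sign D' s t.
  by move=> /O st; rewrite sgn.
apply: (@alexander_ideal_transfer _ D D' (0 :: under_params D) 0).
- by rewrite mem_head.
- by move=> u /fU; exact: spanned_under.
- by move=> u [s /O su]; apply/spanned_under/fU; exists s.
- move=> X c cc; exists c; [exact: (coloring_same_crossings O sgn cc)|by []].
- move=> X c cc; exists c; [exact: (coloring_same_crossings O' sgn' cc)|by []].
Qed.

Lemma alexander_ideal_isotopy D D' : isotopy_move D D' ->
  alexander_ideal D = alexander_ideal D'.
Proof.
move=> [H [iH D'E O]]; apply: alexander_ideal_same_crossings; first exact: O.
by move=> s t /over_double[st _]; exact: isotopy_sign iH D'E st.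
Qed.

Lemma agree_off_sign D D' a b s t : a < b < a + 1 -> agree_off a b D D' ->
  ~ open_arc a b s -> ~ open_arc a b t -> strand_sign D' s t = strand_sign D s t.
Proof. by move=> ab DD' ns nt; rewrite /strand_sign (agree_off_det ab DD'). Qed.

(** No classical crossing has a parameter on the moved arc, and off the open arc the tangents, hence
    the signs, are unchanged. *)
Lemma alexander_ideal_detour D D' : detour_move D D' ->
  alexander_ideal D = alexander_ideal D'.
Proof.
move=> [a [b [ab DD' nc]]]; have [_ O] := DD'.
have nD s t : is_over D s t -> ~ open_arc a b s /\ ~ open_arc a b t.
  move=> st; split=> k; first by have [n _] := nc s t k; apply: n; left.
  by have [n _] := nc t s k; apply: n; right.
have nD' s t : is_over D' s t -> ~ open_arc a b s /\ ~ open_arc a b t.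
  move=> st; split=> k; first by have [_ n] := nc s t k; apply: n; left.
  by have [_ n] := nc t s k; apply: n; right.
apply: alexander_ideal_same_crossings => s t.
  by split=> st; [have [ns nt] := nD' _ _ st|have [ns nt] := nD _ _ st]; apply/O.
by move=> /nD[ns nt]; exact: agree_off_sign ab DD' ns nt.
Qed.

Lemma over_same_pair D p q w z : is_over D p q -> is_over D w z -> same_pair w z p q ->
  same_param w p /\ same_param z q.
Proof.
move=> pq wz [//|[wq zp]]; exfalso; apply: (over_asym pq).
exact: over_same_param wq zp wz.
Qed.

Lemma meets_over D B A w z : meets_in D B A -> is_over D w z -> A w <-> A z.
Proof. by move=> DB /over_double[e _]; rewrite -!DB e. Qed.

Lemma alexander_ideal_reidemeister1 D D' : reidemeister1 D D' ->
  alexander_ideal D = alexander_ideal D'.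
Proof.
move=> [a [b [B [ab _ DD' [mD mD'] [dD [s [t [sab tab st dD']]]]]]]].
have /andP[ab1 ab2] := ab; have [_ O] := DD'.
have nD w z : is_over D w z -> ~ closed_arc a b w /\ ~ closed_arc a b z.
  move=> wz; have nz : ~ closed_arc a b w.
    by move=> wA; apply: (dD w z (over_double wz)); apply/mD.
  by split=> [|zA]; [exact: nz|apply: nz; apply/(meets_over mD wz)].
have oc w : ~ closed_arc a b w -> ~ open_arc a b w.
  by move=> n k; apply: n; exact: open_closed_arc.
apply: (@alexander_ideal_r1 _ D D' a b s t ab2 sab tab).
- move=> u uab [w wu]; have [_] := nD _ _ wu; apply; exact: closed_arc_in.
- move=> w z; split=> [wz|[wz|[ws zt]]].
  + have [wA|wA] := pselect (closed_arc a b w).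
      right; apply: (over_same_pair st wz); apply: dD'; first exact: over_double.
      exact/mD'.
    have zA : ~ closed_arc a b z by move=> zA; apply: wA; apply/(meets_over mD' wz).
    by left; apply/(O _ _ (oc _ wA) (oc _ zA)).
  + by have [wA zA] := nD _ _ wz; apply/(O _ _ (oc _ wA) (oc _ zA)).
  + by apply: over_same_param st; apply: same_param_sym.
- by move=> w z /nD[wA zA]; apply: (agree_off_sign ab DD'); exact: oc.
Qed.

Lemma sgz_opp_of_lt (x y : R) : x * y < 0 -> sgz y = - sgz x.
Proof.
move=> xy; have [x0|x0|x0] := ltgtP x 0.
- by move: xy; rewrite nmulr_rlt0// => y0; rewrite (ltr0_sgz x0) (gtr0_sgz y0).
- by move: xy; rewrite pmulr_rlt0// => y0; rewrite (gtr0_sgz x0) (ltr0_sgz y0).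
- by move: xy; rewrite x0 mul0r ltxx.
Qed.

Lemma sgz_eq_of_gt (x y : R) : 0 < x * y -> sgz y = sgz x.
Proof.
move=> xy; have [x0|x0|x0] := ltgtP x 0.
- by move: xy; rewrite nmulr_rgt0// => y0; rewrite (ltr0_sgz x0) (ltr0_sgz y0).
- by move: xy; rewrite pmulr_rgt0// => y0; rewrite (gtr0_sgz x0) (gtr0_sgz y0).
- by move: xy; rewrite x0 mul0r ltxx.
Qed.

Lemma wedgeC (x y : R * R) : wedge y x = - wedge x y.
Proof. by rewrite /wedge; ring. Qed.

Lemma crossing_detC D s t : crossing_det D t s = - crossing_det D s t.
Proof. exact: wedgeC. Qed.

Lemma four_points (a b c d : R) : a < b -> b < c -> c < d -> d < a + 1 ->
  (a < b < a + 1) /\ (c < d < c + 1).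
Proof. by move=> *; split; apply/andP; split; lra. Qed.

Lemma half_itv (a b r : R) : a < r < b -> b < a + 1 -> a <= r < a + 1.
Proof. by move=> /andP[? ?] ?; apply/andP; split; lra. Qed.

Lemma alexander_ideal_reidemeister2 D D' : reidemeister2 D D' ->
  alexander_ideal D = alexander_ideal D'.
Proof.
move=> [a [b [c [d [B /= [[ab bc cd da] _ DD' [mD mD']
  [dD [s1 [s2 [t1 [t2 [[as1 s12 s2b] [t1cd t2cd] ov sgn dD']]]]]]]]]]]].
have /andP[ct1 t1d] := t1cd; have /andP[ct2 t2d] := t2cd.
have [_ O] := DD'; have [ab1 cd1] := four_points ab bc cd da.
have /andP[_ ba] := ab1.
pose A := closed_arc a b `|` closed_arc c d.
have nD w z : is_over D w z -> ~ A w /\ ~ A z.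
  move=> wz; have nz : ~ A w.
    by move=> wA; apply: (dD w z (over_double wz)); apply/mD.
  by split=> [|zA]; [exact: nz|apply: nz; apply/(meets_over mD wz)].
have oc w : ~ A w -> ~ open_arc a b w.
  by move=> n k; apply: n; left; exact: open_closed_arc.
have disj r : closed_arc a b r -> closed_arc c d r -> False by exact: arcs_disjoint.
have nU u : closed_arc a b u \/ closed_arc c d u -> ~ under D u.
  by move=> uA [w wu]; have [_] := nD _ _ wu; apply.
have nU' u : closed_arc c d u \/ closed_arc a b u -> ~ under D u.
  by move=> uA; apply: nU; case: uA; [right|left].
have sgnE w z : is_over D w z -> strand_sign D' w z = strand_sign D w z.
  by move=> /nD[wA zA]; apply: (agree_off_sign ab1 DD'); exact: oc.
have outD w z : is_over D w z -> is_over D' w z.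
  by move=> wz; have [wA zA] := nD _ _ wz; apply/O => //; exact: oc.
have inD' w z : is_over D' w z -> is_over D w z \/ 
    (same_pair w z s1 t1 \/ same_pair w z s2 t2).
  move=> wz; have [wA|wA] := pselect (A w).
    by right; apply: dD'; [exact: over_double|exact/mD'].
  have zA : ~ A z by move=> zA; apply: wA; apply/(meets_over mD' wz).
  by left; apply/(O _ _ (oc _ wA) (oc _ zA)).
(* In [alexander_ideal_r2] the crossings are ordered along the lower strand. If this is [c, d], they
   may have to be exchanged; if it is [a, b], the order is given by [s1 < s2] and the two strands
   exchange roles. *)
case: ov => -[k1 k2].
  have LE p1 q1 p2 q2 : (p1, q1, p2, q2) = (s1, t1, s2, t2) \/ (p1, q1, p2, q2) = (s2, t2, s1, t1) ->
      forall w z, is_over D' w z <-> [\/ is_over D w z, same_param w p1 /\ same_param z q1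
        | same_param w p2 /\ same_param z q2].
    move=> pq w z; have base : is_over D' w z <-> [\/ is_over D w z, same_param w s1 /\ same_param z t1
        | same_param w s2 /\ same_param z t2].
      split=> [wz|[/outD//|[ws zt]|[ws zt]]].
      - have [|[pr|pr]] := inD' _ _ wz; first exact: Or31.
          by apply: Or32; exact: over_same_pair k1 wz pr.
        by apply: Or33; exact: over_same_pair k2 wz pr.
      - by apply: over_same_param k1; exact: same_param_sym.
      - by apply: over_same_param k2; exact: same_param_sym.
    case: pq => -[-> -> -> ->]; rewrite base; first by [].
    by split=> -[?|?|?]; [exact: Or31|exact: Or33|exact: Or32|exact: Or31|exact: Or33|exact: Or32].
  have abs1 : a < s1 < b by rewrite as1 (lt_trans s12 s2b).
  have abs2 : a < s2 < b by rewrite s2b (lt_trans as1 s12).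
  have NW w z : is_over D w z -> ~ closed_arc c d w.
    by move=> /nD[wA _] wc; apply: wA; right.
  have [t12|t21|tt] := ltgtP t1 t2.
  - apply: (@alexander_ideal_r2 _ D D' a b c d s1 s2 t1 t2 ab1 cd1 disj abs1 abs2 ct1 t12 t2d nU NW).
    + by apply: LE; left.
    + exact: sgnE.
    + exact: sgz_opp_of_lt sgn.
  - apply: (@alexander_ideal_r2 _ D D' a b c d s2 s1 t2 t1 ab1 cd1 disj abs2 abs1 ct2 t21 t1d nU NW).
    + by apply: LE; right.
    + exact: sgnE.
    + by apply: sgz_opp_of_lt; rewrite mulrC.
  (* The same undercrossing cannot have two different over parameters. *)
  - exfalso; rewrite -tt in k2; have s12s := over_unique k1 k2.
    have i1 := half_itv abs1 ba; have i2 := half_itv abs2 ba.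
    by move: s12; rewrite (same_param_eq s12s i1 i2) ltxx.
have disj' r : closed_arc c d r -> closed_arc a b r -> False by move=> rc ra; exact: disj ra rc.
have NW w z : is_over D w z -> ~ closed_arc a b w by move=> /nD[wA _] wc; apply: wA; left.
apply: (@alexander_ideal_r2 _ D D' c d a b t1 t2 s1 s2 cd1 ab1 disj' t1cd t2cd as1 s12 s2b nU' NW).
- move=> w z; split=> [wz|[/outD//|[ws zt]|[ws zt]]].
  + have [|[pr|pr]] := inD' _ _ wz; first exact: Or31.
      by apply: Or32; apply: over_same_pair k1 wz _; case: pr => -[? ?]; [right|left].
    by apply: Or33; apply: over_same_pair k2 wz _; case: pr => -[? ?]; [right|left].
  + by apply: over_same_param k1; exact: same_param_sym.
  + by apply: over_same_param k2; exact: same_param_sym.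
- exact: sgnE.
- apply: sgz_opp_of_lt; rewrite (crossing_detC D' s1) (crossing_detC D' s2).
  by rewrite mulrNN.
Qed.

Lemma six_points (a b c d e f : R) : a < b -> b < c -> c < d -> d < e -> e < f < a + 1 ->
  [/\ a < b < a + 1, c < d < c + 1, e < f < e + 1 & [/\ d < a + 1, f < a + 1 & f < c + 1]].
Proof. by move=> ? ? ? ? /andP[? ?]; split; [| | |split]; try (apply/andP; split); lra. Qed.

Lemma strand_signs_of_det D s2 t2 s3 t3 u v :
  0 < ((u - t2) * crossing_det D s2 t2) * ((v - t3) * crossing_det D s3 t3) ->
  [/\ u <> t2, v <> t3 & r3_signs D s2 t2 s3 t3 u v].
Proof.
rewrite mulrACA => h.
have [n1 n2] : u - t2 != 0 /\ v - t3 != 0.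
  by split; apply/eqP => e; move: h; rewrite e ?mul0r ?mulr0 ?mul0r ltxx.
split; [by move=> e; rewrite e subrr eqxx in n1|by move=> e; rewrite e subrr eqxx in n2|].
split=> k; rewrite /strand_sign.
  by apply: sgz_eq_of_gt; rewrite mulrC; move: h; rewrite pmulr_rgt0.
apply: sgz_opp_of_lt; rewrite mulrC.
by move: h; rewrite nmulr_rgt0.
Qed.

Section R3FromDefinition.
Variables (D D' : diagram R) (a b c d e f : R) (B : set (R * R)).
Variables (s2 t2 s3 t3 s2' t2' s3' t3' u v : R).

Lemma r3_tangle_of_doubles D1 A p2 q2 p3 q3 x y c1 d1 e1 f1 :
  meets_in D1 B A ->
  (a < p2 < b) /\ (a < p3 < b) -> (c1 < q2 < d1) /\ (c1 < x < d1) ->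
  (e1 < q3 < f1) /\ (e1 < y < f1) -> x <> q2 -> y <> q3 ->
  is_over D1 p2 q2 -> is_over D1 p3 q3 -> is_over D1 x y ->
  (forall r, [\/ closed_arc a b r, closed_arc c1 d1 r | closed_arc e1 f1 r] -> A r) ->
  doubles_in D1 B (fun w z => [\/ same_pair w z x y, same_pair w z p2 q2 | same_pair w z p3 q3]) ->
  r3_tangle a b c1 d1 e1 f1 D1 p2 q2 p3 q3 x y.
Proof.
move=> mD h1 h2 h3 xq yq o2 o3 o1 AA dD; split; [exact: h1|exact: h2|exact: h3|by split|].
split; [exact: o2|exact: o3|exact: o1|] => w z wz zA.
have wB : B (curve D1 w) by apply/mD; apply/(meets_over mD wz); exact: AA.
have [k|k|k] := dD w z (over_double wz) wB.
- by apply: Or33; exact: over_same_pair o1 wz k.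
- by apply: Or31; exact: over_same_pair o2 wz k.
- by apply: Or32; exact: over_same_pair o3 wz k.
Qed.

End R3FromDefinition.

Lemma same_pairC w z u v : same_pair w z u v -> same_pair w z v u.
Proof. by case=> -[? ?]; [right|left]. Qed.

Lemma alexander_ideal_reidemeister3 D D' : reidemeister3 D D' ->
  alexander_ideal D = alexander_ideal D'.
Proof.
move=> [a [b [c [d [e [f [B /= [[ab bc cd de efa] _ DD' [mD mD']
  [u [v [s2 [t2 [s3 [t3 [s2' [t2' [s3' [t3'
  [[ucd vef uv] [[p1 p2 p3 p4] [p5 p6 p7 p8]] [k2 k3 [tri _ _] dD]
    [k2' k3' [tri' _ _] dD'] [_ rev2 rev3 sg2 sg3]]]]]]]]]]]]]]]]]]]].
have [ab1 cd1 ef1 [da fa fc]] := six_points ab bc cd de efa.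
have /andP[ef _] := efa.
set A := closed_arc a b `|` closed_arc c d `|` closed_arc e f in mD mD'.
have [_ O] := DD'.
have ab_cd r : closed_arc a b r -> closed_arc c d r -> False := arcs_disjoint bc da.
have ab_ef r : closed_arc a b r -> closed_arc e f r -> False :=
  arcs_disjoint (lt_trans bc (lt_trans cd de)) fa.
have cd_ef r : closed_arc c d r -> closed_arc e f r -> False := arcs_disjoint de fc.
have ef_cd r : closed_arc e f r -> closed_arc c d r -> False.
  by move=> k1 k4; exact: cd_ef k4 k1.
have A1 r : [\/ closed_arc a b r, closed_arc c d r | closed_arc e f r] -> A r.
  by case=> k; [left; left|left; right|right].
have A2 r : [\/ closed_arc a b r, closed_arc e f r | closed_arc c d r] -> A r.
  by case=> k; [left; left|right|left; right].
have A1' r : A r -> [\/ closed_arc a b r, closed_arc c d r | closed_arc e f r].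
  by case=> [[k|k]|k]; [apply: Or31|apply: Or32|apply: Or33].
have A2' r : A r -> [\/ closed_arc a b r, closed_arc e f r | closed_arc c d r].
  by case=> [[k|k]|k]; [apply: Or31|apply: Or33|apply: Or32].
have oc w : ~ A w -> ~ open_arc a b w.
  by move=> n k; apply: n; left; left; exact: open_closed_arc.
have out w z : ~ A z -> (is_over D' w z <-> is_over D w z).
  move=> zA; split=> wz.
    have wA : ~ A w by move=> wA; apply: zA; apply/(meets_over mD' wz).
    exact/(O _ _ (oc _ wA) (oc _ zA)).
  have wA : ~ A w by move=> wA; apply: zA; apply/(meets_over mD wz).
  exact/(O _ _ (oc _ wA) (oc _ zA)).
have out_over w z : is_over D w z -> ~ A z -> ~ A w.
  by move=> wz zA wA; apply: zA; apply/(meets_over mD wz).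
have out_sign w z : is_over D w z -> ~ A z -> strand_sign D' w z = strand_sign D w z.
  move=> wz zA; have wA := out_over _ _ wz zA.
  exact: agree_off_sign ab1 DD' (oc _ wA) (oc _ zA).
have [ut2 vt3 sD] := strand_signs_of_det tri.
have [ut2' vt3' sD'] := strand_signs_of_det tri'.
have na r : c < r < d \/ e < r < f -> ~ open_arc a b r.
  move=> k /open_closed_arc k'; case: k => k.
    by apply: ab_cd k' _; apply: closed_arc_in; case/andP: k => ? ?; rewrite !ltW.
  by apply: ab_ef k' _; apply: closed_arc_in; case/andP: k => ? ?; rewrite !ltW.
have nu : ~ open_arc a b u by apply: na; left.
have nv : ~ open_arc a b v by apply: na; right.
have g2 : strand_sign D' s2' t2' = strand_sign D s2 t2 := sgz_eq_of_gt sg2.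
have g3 : strand_sign D' s3' t3' = strand_sign D s3 t3 := sgz_eq_of_gt sg3.
have guv : strand_sign D' u v = strand_sign D u v := agree_off_sign ab1 DD' nu nv.
have gvu : strand_sign D' v u = strand_sign D v u := agree_off_sign ab1 DD' nv nu.
(* If u is over v, the middle strand is [c, d]; otherwise it is [e, f], and the two lower strands
   exchange roles. *)
case: uv => k1.
  have k1' : is_over D' u v by apply/(O _ _ nu nv).
  have tD := r3_tangle_of_doubles mD (conj p1 p3) (conj p2 ucd) (conj p4 vef) ut2 vt3 k2 k3 k1 A1 dD.
  have tD' := r3_tangle_of_doubles mD' (conj p5 p7) (conj p6 ucd) (conj p8 vef) ut2' vt3' k2' k3' k1' A1 dD'.
  apply: (alexander_ideal_r3 ab1 cd1 ef1 ab_cd ab_ef cd_ef tD tD' sD sD' g2 g3 guv rev2 rev3).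
  - move=> w z n; exact: (out _ _ (fun k => n (A1' _ k))).
  - move=> w z wz n k; exact: (out_over _ _ wz (fun k' => n (A1' _ k')) (A1 _ k)).
  - move=> w z wz n; exact: (out_sign _ _ wz (fun k => n (A1' _ k))).
have k1' : is_over D' v u by apply/(O _ _ nv nu).
have eD : doubles_in D B (fun w z => [\/ same_pair w z v u, same_pair w z s3 t3 | same_pair w z s2 t2]).
  move=> w z wz wB; have [k|k|k] := dD w z wz wB; [apply: Or31; exact: same_pairC|exact: Or33|exact: Or32].
have eD' : doubles_in D' B (fun w z => [\/ same_pair w z v u, same_pair w z s3' t3' | same_pair w z s2' t2']).
  move=> w z wz wB; have [k|k|k] := dD' w z wz wB; [apply: Or31; exact: same_pairC|exact: Or33|exact: Or32].
have [_ _ rD] : [/\ v <> t3, u <> t2 & r3_signs D s3 t3 s2 t2 v u].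
  apply: strand_signs_of_det; rewrite mulrC; exact: tri.
have [_ _ rD'] : [/\ v <> t3', u <> t2' & r3_signs D' s3' t3' s2' t2' v u].
  apply: strand_signs_of_det; rewrite mulrC; exact: tri'.
have tD := r3_tangle_of_doubles mD (conj p3 p1) (conj p4 vef) (conj p2 ucd) vt3 ut2 k3 k2 k1 A2 eD.
have tD' := r3_tangle_of_doubles mD' (conj p7 p5) (conj p8 vef) (conj p6 ucd) vt3' ut2' k3' k2' k1' A2 eD'.
apply: (alexander_ideal_r3 ab1 ef1 cd1 ab_ef ab_cd ef_cd tD tD' rD rD' g3 g2 gvu rev3 rev2).
- move=> w z n; exact: (out _ _ (fun k => n (A2' _ k))).
- move=> w z wz n k; exact: (out_over _ _ wz (fun k' => n (A2' _ k')) (A2 _ k)).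
- move=> w z wz n; exact: (out_sign _ _ wz (fun k => n (A2' _ k))).
Qed.

(** Commutation with the translation by 1 makes [phi] unbounded on both sides, so it is onto by the
    intermediate value theorem; the inverse is continuous by monotonicity. *)
Lemma reparametrization_inverse (phi : R -> R) : reparametrization phi ->
  exists psi, [/\ reparametrization psi, cancel phi psi & cancel psi phi].
Proof.
move=> [cphi phi_inc phi1].
have phin t (n : nat) : phi (t + n%:R) = phi t + n%:R.
  by elim: n => [|n IH]; rewrite ?addr0// -!natr1 !addrA phi1 IH.
have phin' t (n : nat) : phi (t - n%:R) = phi t - n%:R.
  by have := phin (t - n%:R) n; rewrite subrK => ->; rewrite addrK.
have phi_le x y : x <= y -> phi x <= phi y.
  by rewrite le_eqVlt => /orP[/eqP->//|/phi_inc/ltW].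
have surj y : exists t, phi t = y.
  pose n := (Num.truncn `|y - phi 0|).+1.
  have yn : `|y - phi 0| < n%:R by exact: truncnS_gt.
  move: yn; rewrite ltr_norml => /andP[y1 y2].
  have e1 : phi (0 - n%:R) <= y by rewrite phin'; lra.
  have e2 : y <= phi (0 + n%:R) by rewrite phin; lra.
  have le0 : 0 - n%:R <= 0 + n%:R :> R by have : (0 : R) <= n%:R := ler0n _ _; lra.
  have [t _ <-] : exists2 t, t \in `[0 - n%:R, 0 + n%:R] & phi t = y; last by exists t.
  apply: IVT => //; first exact: continuous_subspaceT.
  by rewrite ge_min e1 le_max e2 orbT.
have [psi psiK] : {psi : R -> R & forall y, phi (psi y) = y}.
  by exists (fun y => xget 0 [set t | phi t = y]) => y; case: xgetP => [//|n]; have [t /n] := surj y.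
have phi_inj : injective phi.
  move=> x y xy; have [lt|lt|//] := ltgtP x y.
    by have := phi_inc _ _ lt; rewrite xy ltxx.
  by have := phi_inc _ _ lt; rewrite xy ltxx.
have phiK : cancel phi psi by move=> t; apply: phi_inj.
have psi_inc x y : x < y -> psi x < psi y.
  by move=> xy; rewrite ltNge; apply/negP => /phi_le; rewrite !psiK leNgt xy.
exists psi; split => //; split => // [y|t]; last by apply: phi_inj; rewrite phi1 !psiK.
apply/cvgrPdist_lt => e e0.
have l1 : phi (psi y - e) < y by rewrite -{2}[y]psiK; apply: phi_inc; rewrite ltrBlDr ltrDl.
have l2 : y < phi (psi y + e) by rewrite -{1}[y]psiK; apply: phi_inc; rewrite ltrDl.
near=> z.
have z1 : phi (psi y - e) < z by near: z; exact: lt_nbhsr.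
have z2 : z < phi (psi y + e) by near: z; exact: lt_nbhsl.
have := psi_inc _ _ z1; have := psi_inc _ _ z2; rewrite !phiK => m1 m2.
by rewrite ltr_norml; apply/andP; split; lra.
Unshelve. all: end_near. Qed.

Lemma coloring_reparam D D' phi (X : lmodType laurent) (c : R -> X) : reparametrization phi ->
  (forall t, curve D' t = curve D (phi t)) ->
  (forall s t, is_over D' s t <-> is_over D (phi s) (phi t)) ->
  coloring D c -> coloring D' (c \o phi).
Proof.
move=> rphi D'E O [c1 lc rc oc]; have [psi [[cpsi psi_inc _] phiK psiK]] := reparametrization_inverse rphi.
have [cphi phi_inc phi1] := rphi.
have L r x : left_const c (phi r) x -> left_const (c \o phi) r x.
  move=> [e e0 ce]; exists (r - psi (phi r - e)).
    rewrite subr_gt0 -{2}[r]phiK; apply: psi_inc; by rewrite ltrBlDr ltrDl.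
  move=> t /andP[t1 t2]; apply: ce; rewrite phi_inc// andbT -[phi r - e]psiK.
  by apply: phi_inc; move: t1; rewrite subKr.
have Rt r x : right_const c (phi r) x -> right_const (c \o phi) r x.
  move=> [e e0 ce]; exists (psi (phi r + e) - r).
    rewrite subr_gt0 -{1}[r]phiK; apply: psi_inc; by rewrite ltrDl.
  move=> t /andP[t1 t2]; apply: ce; rewrite phi_inc//= -[phi r + e]psiK.
  by apply: phi_inc; move: t2; rewrite addrC subrK.
split=> [t|r|r nU|s r sr].
- by rewrite /= phi1 c1.
- exact: L (lc _).
- apply: Rt (rc _ _) => -[s sr]; apply: nU; exists (psi s).
  by apply/O; rewrite psiK.
- by rewrite (same_diagram_sign _ _ rphi D'E); apply: Rt; apply: oc; apply/O.
Qed.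

Lemma alexander_ideal_reparam D D' : same_diagram D D' ->
  alexander_ideal D = alexander_ideal D'.
Proof.
move=> [phi [rphi D'E O]]; have [psi [rpsi phiK psiK]] := reparametrization_inverse rphi.
have DE t : curve D t = curve D' (psi t) by rewrite D'E psiK.
have O' s t : is_over D s t <-> is_over D' (psi s) (psi t) by rewrite O !psiK.
(* The parameters of the two diagrams correspond by [phi], so the list for D is the image of the one
   for [D'], and the base point moves as well. *)
pose l' := 0 :: under_params D'; pose l := map phi l'.
have fU u : under D' u -> frac u \in l'.
  move=> uU; rewrite inE mem_under; apply/orP; right; apply/asboolP.
  by split; [exact: frac_itv|exact: under_same (same_param_frac u) uU].
have ll' : size l = size l' by rewrite size_map.
have nl i : (i < size l)%N -> nth 0 l i = phi (nth 0 l' i).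
  by rewrite ll' => il; rewrite (nth_map 0).
apply: (@alexander_ideal_relation _ D D' (phi 0) 0 l l').
- exact: ll'.
- move=> u [s /O' su].
  have [g gP] : spanned D' l' (psi u) by apply/spanned_under/fU; exists (psi s).
  exists g => X c cc.
  have -> : c u = (c \o phi) (psi u) by rewrite /= psiK.
  rewrite (gP X _ (coloring_reparam rphi D'E O cc)) -ll'; apply: eq_bigr => j _.
  by rewrite nl.
- by move=> u /fU; exact: spanned_under.
move=> x; split=> xR X c [cc c0].
  have cp0 : (c \o psi) (phi 0) = 0 by rewrite /= phiK.
  have e := xR X (c \o psi) (conj (coloring_reparam rpsi DE O' cc) cp0).
  rewrite -[RHS]e; apply: eq_bigr => j _.
  by rewrite nl//= phiK.
have := xR X (c \o phi) (conj (coloring_reparam rphi D'E O cc) c0) => e.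
rewrite -[RHS]e; apply: eq_bigr => j _.
by rewrite nl.
Qed.

Theorem alexander_ideal_equivalent D D' : virtually_equivalent D D' ->
  alexander_ideal D = alexander_ideal D'.
Proof.
elim=> {D D'} [D D'|//|D D' _ ->//|D D1 D2 _ -> _ ->//].
move=> [[h|h]|h|h|[h|h]].
- exact: alexander_ideal_reparam.
- exact: alexander_ideal_isotopy.
- exact: alexander_ideal_detour.
- exact: alexander_ideal_reidemeister1.
- exact: alexander_ideal_reidemeister2.
- exact: alexander_ideal_reidemeister3.
Qed.

End Moves.

(** * Symmetries of a periodic diagram *)

Section Reparametrizations.
Variable R : realType.
Implicit Types (phi psi : R -> R) (r s t u : R).

Lemma reparamDz phi t (k : int) : reparametrization phi -> phi (t + k%:~R) = phi t + k%:~R.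
Proof.
move=> [_ _ phi1].
have := @periodicz R R (fun x => phi x - x) _ t k => /(_ _) h.
have {}h : phi (t + k%:~R) - (t + k%:~R) = phi t - t.
  by apply: h => x; rewrite phi1; ring.
by move: h => /eqP; rewrite subr_eq => /eqP ->; ring.
Qed.

Lemma reparam_comp phi psi : reparametrization phi -> reparametrization psi ->
  reparametrization (phi \o psi).
Proof.
move=> [c1 i1 p1] [c2 i2 p2]; split=> [|s t st|t] /=.
- by move=> x; apply: continuous_comp; [exact: c2|exact: c1].
- by apply/i1/i2.
- by rewrite p2 p1.
Qed.

Lemma reparam_iter phi k : reparametrization phi -> reparametrization (iter k phi).
Proof.
move=> rphi; elim: k => [|k IH]; last exact: reparam_comp.
by split=> // x; exact: cvg_id.
Qed.

Lemma reparam_shift phi (k : int) : reparametrization phi ->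
  reparametrization (fun t => phi t + k%:~R).
Proof.
move=> [c1 i1 p1]; split=> [x|s t st|t]; last by rewrite p1; ring.
  by apply: cvgD; [exact: c1|exact: cvg_cst].
by rewrite ltrD2r i1.
Qed.

(** Either [phi t - t - l] has a zero, or it has constant sign, and then so has its
    sum along an orbit. *)
Lemma reparam_translation_number phi (q : nat) (l : int) : reparametrization phi ->
  (forall t, iter q phi t = t + (q%:Z * l)%:~R) -> (0 < q)%N ->
  exists t, phi t = t + l%:~R.
Proof.
move=> rphi phiq q0; have [cphi phi_inc _] := rphi.
pose g t := phi t - t.
have gc : continuous g by move=> x; apply: cvgB; [exact: cphi|exact: cvg_id].
have up t : (forall x, x + l%:~R < phi x) -> forall k, (0 < k)%N -> t + (k%:Z * l)%:~R < iter k phi t.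
  move=> h; elim=> [//|[|k] IH] _; first by rewrite mul1r; exact: h.
  rewrite iterS; apply: lt_trans (h _).
  have -> : (k.+2%:Z * l)%:~R = (k.+1%:Z * l)%:~R + l%:~R :> R.
    by rewrite -intrD -[in RHS](mul1r l) mulrA mulr1 -mulrDl; congr (_ * _)%:~R; lia.
  by rewrite addrA ltrD2r; exact: IH.
have down t : (forall x, phi x < x + l%:~R) -> forall k, (0 < k)%N -> iter k phi t < t + (k%:Z * l)%:~R.
  move=> h; elim=> [//|[|k] IH] _; first by rewrite mul1r; exact: h.
  rewrite iterS; apply: lt_trans (h _) _.
  have -> : (k.+2%:Z * l)%:~R = (k.+1%:Z * l)%:~R + l%:~R :> R.
    by rewrite -intrD -[in RHS](mul1r l) mulrA mulr1 -mulrDl; congr (_ * _)%:~R; lia.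
  by rewrite addrA ltrD2r; exact: IH.
apply: contrapT => nex.
have ne x : phi x != x + l%:~R by apply/eqP => e; apply: nex; exists x.
have [x1 hx1] : exists x, phi x < x + l%:~R.
  apply: contrapT => n1; have pos x : x + l%:~R < phi x.
    by rewrite lt_neqAle eq_sym ne leNgt; apply/negP => k; apply: n1; exists x.
  by have := up 0 pos q q0; rewrite phiq ltxx.
have [x2 hx2] : exists x, x + l%:~R < phi x.
  apply: contrapT => n1; have neg x : phi x < x + l%:~R.
    by rewrite lt_neqAle ne leNgt; apply/negP => k; apply: n1; exists x.
  by have := down 0 neg q q0; rewrite phiq ltxx.
have gx1 : g x1 < l%:~R by rewrite /g ltrBlDl.
have gx2 : l%:~R < g x2 by rewrite /g ltrBrDl.
have [c gcl] : exists c, g c = l%:~R.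
  have [x12|x21] := leP x1 x2.
    have [c _ <-] : exists2 c, c \in `[x1, x2] & g c = l%:~R; last by exists c.
    apply: IVT => //; first exact: continuous_subspaceT.
    by rewrite ge_min (ltW gx1) le_max (ltW gx2) orbT.
  have [c _ <-] : exists2 c, c \in `[x2, x1] & g c = l%:~R; last by exists c.
  apply: IVT => //; [exact: ltW|exact: continuous_subspaceT|].
  by rewrite ge_min (ltW gx1) le_max (ltW gx2) orbT.
by case/eqP: (ne c); rewrite -gcl /g addrC subrK.
Qed.

End Reparametrizations.

Section Rotations.
Variable R : realType.
Local Notation plane := (R * R)%type.

Lemma rotationD (x y : R) (w : plane) : rotation x (rotation y w) = rotation (x + y) w.
Proof. by rewrite /rotation /= cosD sinD; congr (_, _); ring. Qed.

Lemma rotation2pi (w : plane) : rotation (2 * pi) w = w.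
Proof.
have -> : 2 * pi = pi *+ 2 :> R by rewrite mulr_natl.
rewrite /rotation cos2pi sin2pi; case: w => a b /=.
by rewrite !mul1r !mul0r subr0 add0r.
Qed.

Lemma rotation0 (w : plane) : rotation 0 w = w.
Proof.
rewrite /rotation cos0 sin0; case: w => a b /=.
by rewrite !mul1r !mul0r subr0 add0r.
Qed.

Lemma rotation_fixed (theta : R) (w : plane) : 0 < theta -> theta <= pi ->
  rotation theta w = w -> w = 0.
Proof.
move=> t0 tpi rw; have c1 : cos theta != 1.
  apply/eqP => c1; have : theta = 0.
    apply: (@cos_inj R); last by rewrite c1 cos0.
      by rewrite in_itv /= tpi ltW.
    by rewrite in_itv /= lexx pi_ge0.
  by move=> e; rewrite e ltxx in t0.
have cs := cos2Dsin2 theta; set c := cos theta in c1 cs; set s := sin theta in cs.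
have e1 : c * w.1 - s * w.2 = w.1 by have := congr1 fst rw.
have e2 : s * w.1 + c * w.2 = w.2 by have := congr1 snd rw.
(* This is the determinant of the rotation minus the identity. *)
have d0 : 2 * (1 - c) != 0 by rewrite mulf_neq0 ?pnatr_eq0// subr_eq0 eq_sym.
have f1 : 2 * (1 - c) * w.1 = 0.
  transitivity ((1 - c) * (w.1 - (c * w.1 - s * w.2)) + s * (s * w.1 + c * w.2 - w.2)
      + (1 - (c ^+ 2 + s ^+ 2)) * w.1); first by ring.
  by rewrite e1 e2 cs !subrr !mulr0 mul0r !addr0.
have f2 : 2 * (1 - c) * w.2 = 0.
  transitivity ((1 - c) * (w.2 - (s * w.1 + c * w.2)) - s * (c * w.1 - s * w.2 - w.1)
      + (1 - (c ^+ 2 + s ^+ 2)) * w.2); first by ring.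
  by rewrite e1 e2 cs !subrr !mulr0 mul0r subr0 addr0.
rewrite [w]surjective_pairing; congr (_, _).
  by apply/eqP; move/eqP: f1; rewrite mulf_eq0 (negPf d0).
by apply/eqP; move/eqP: f2; rewrite mulf_eq0 (negPf d0).
Qed.

End Rotations.

Section Periodic.
Variable R : realType.
Implicit Types (D : diagram R) (r s t u : R).

(** If g took two values, it would also take the smaller one plus 1/2. *)
Lemma continuous_int_valued (g : R -> R) : continuous g ->
  (forall t, g t \is a Num.int) -> exists k : int, forall t, g t = k%:~R.
Proof.
move=> gc gi; have /intrP[k kE] := gi 0; exists k => t; rewrite -kE.
have half x y : g x < g y -> False.
  move=> xy; pose v := g x + 2^-1.
  have /intrP[a aE] := gi x; have /intrP[b bE] := gi y.
  have ab : (a < b)%R by rewrite -(ltr_int R) -aE -bE.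
  have ab1 : g x + 1 <= g y.
    by rewrite aE bE -[1]/(1%:~R) -intrD ler_int; lia.
  have [c gcv] : exists c, g c = v.
    have [xley|yx] := leP x y.
      have [c _ <-] : exists2 c, c \in `[x, y] & g c = v; last by exists c.
      apply: IVT => //; first exact: continuous_subspaceT.
      rewrite ge_min le_max /v; apply/andP; split; apply/orP; [left|right]; lra.
    have [c _ <-] : exists2 c, c \in `[y, x] & g c = v; last by exists c.
    apply: IVT => //; [exact: ltW|exact: continuous_subspaceT|].
    rewrite ge_min le_max /v; apply/andP; split; apply/orP; [right|left]; lra.
  have /intrP[d dE] := gi c.
  have : (a%:~R : R) < d%:~R by rewrite -dE -aE gcv /v; lra.
  have : (d%:~R : R) < (a + 1)%:~R by rewrite intrD -dE -aE gcv /v mulr1z; lra.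
  by rewrite !ltr_int; lia.
by case: (ltgtP (g t) (g 0)) => // /half.
Qed.

(** If [f t - t] were not an integer at some [t], then nearby points would be double. *)
Lemma curve_fiber_reparam D (f : R -> R) : reparametrization f ->
  (forall t, curve D (f t) = curve D t) -> exists k : int, forall t, f t = t + k%:~R.
Proof.
move=> [fc _ _] fD; pose g t := f t - t.
have gc : continuous g by move=> x; apply: cvgB; [exact: fc|exact: cvg_id].
suff gi t : g t \is a Num.int.
  have [k gk] := continuous_int_valued gc gi.
  by exists k => t; rewrite -(gk t) /g addrC subrK.
apply: contrapT => tN.
have [e e0 eP] : exists2 e, 0 < e & forall u, (exists s, is_double (curve D) s u) ->
    u != t -> e <= `|u - t|.
  apply: periodic_isolated (curve_finite D) => u v uv [s [su nsu]].
  exists s; split; first by rewrite su (periodic_same (@curve_periodic _ D) uv).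
  by move=> sv; apply: nsu; apply: same_param_trans sv _; exact: same_param_sym.
have gE := fracK (g t); have /andP[f0 f1] := frac_itv (g t).
have f0' : 0 < frac (g t).
  rewrite lt_neqAle f0 eq_sym andbT; apply/eqP => z.
  by apply: tN; rewrite gE z add0r intr_int.
set w := frac (g t) in gE f0 f1 f0'.
have [d d0 dP] : exists2 d, 0 < d & forall u, `|t - u| < d -> `|g t - g u| < Num.min w (1 - w).
  have w0 : 0 < Num.min w (1 - w) by rewrite lt_min f0' subr_gt0.
  have /cvgrPdist_lt/(_ _ w0) := gc t.
  by move=> /nbhs_ballP[d /= d0 dP]; exists d => // u tu; exact: dP.
(* The difference [f x - x] is still not an integer, so x and [f x] are different parameters of one
   point. Thus x is double, although it is closer to t than the radius e allows. *)
pose x := t + Num.min e d / 2.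
have m0 : 0 < Num.min e d by rewrite lt_min e0.
have me : Num.min e d <= e by rewrite ge_min lexx.
have md : Num.min e d <= d by rewrite ge_min lexx orbT.
have xt : x != t by rewrite -subr_eq0; apply/eqP; rewrite /x; lra.
have xd : `|t - x| < d by rewrite distrC ger0_norm /x; lra.
have := eP x; rewrite xt => /(_ _ isT); rewrite ger0_norm; last by rewrite /x; lra.
have h : exists s, is_double (curve D) s x.
  exists (f x); split; first exact: fD.
  move=> /same_param_sym/intrP[b bE]; rewrite -/(g x) in bE.
  have := dP _ xd; rewrite bE lt_min ltr_norml gE => /andP[/andP[h1 h2]] /ltr_distlCBl h3.
  have l1 : ((Num.floor (g t))%:~R : R) < b%:~R by lra.
  have l2 : (b%:~R : R) < (Num.floor (g t) + 1)%:~R by rewrite intrD mulr1z; lra.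
  move: l1 l2; rewrite !ltr_int; clear; lia.
by move=> /(_ h); rewrite /x; lra.
Qed.

Lemma iter_reparam_shift (f : R -> R) (l : int) q t : reparametrization f ->
  iter q (fun t => f t + l%:~R) t = iter q f t + (q%:Z * l)%:~R.
Proof.
move=> rf; elim: q => [|q IH]; first by rewrite mul0r addr0.
rewrite !iterS IH reparamDz// -addrA -intrD; congr (_ + _%:~R); lia.
Qed.

Lemma rotation_iter D theta (f : R -> R) k t :
  (forall t, rotation theta (curve D t) = curve D (f t)) ->
  rotation (theta *+ k) (curve D t) = curve D (iter k f t).
Proof.
move=> fD; elim: k => [|k IH]; first by rewrite rotation0.
by rewrite iterS -fD -IH rotationD mulrS.
Qed.

Lemma strand_sign_shift D s t (k : int) :
  strand_sign D (s + k%:~R) (t + k%:~R) = strand_sign D s t.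
Proof.
have e u : same_param u (u + k%:~R) by apply/same_paramP; exists k.
by rewrite /strand_sign (crossing_det_same D (e s) (e t)).
Qed.

Lemma is_over_shift D s t (k : int) :
  is_over D (s + k%:~R) (t + k%:~R) <-> is_over D s t.
Proof.
have e u : same_param u (u + k%:~R) by apply/same_paramP; exists k.
split; last exact: over_same_param.
by apply: over_same_param; exact/same_param_sym.
Qed.

Lemma bezout_prime (p : nat) (r : int) : prime p -> ~~ (p%:Z %| r)%Z ->
  exists (k : nat) (l : int), k%:Z * r = 1 + p%:Z * l.
Proof.
move=> pp pr; have cop : coprimez p r by rewrite coprimezE prime_coprime.
have /coprimezP[[u v] /= uv] := cop.
have p0 : p%:Z != 0 by case: p pp {pr cop uv}.
exists `|v %% p|%Z%N, (- u - (v %/ p)%Z * r); rewrite gez0_abs ?modz_ge0//.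
have := divz_eq v p; move: (v %/ p)%Z (v %% p)%Z => a b vE.
by rewrite vE in uv; rewrite -uv; ring.
Qed.

Lemma periodic_translation D p : prime p -> (forall t, curve D t != 0) ->
  rotation_invariant (2 * pi / p%:R) D ->
  exists psi, [/\ reparametrization psi, forall t, iter p psi t = t + 1,
    forall s t, is_over D (psi s) (psi t) <-> is_over D s t &
    forall s t, strand_sign D (psi s) (psi t) = strand_sign D s t].
Proof.
move=> pp D0 [phi [rphi rot oD]]; set theta := 2 * pi / p%:R in rot.
have p1 := prime_gt1 pp; have p0 := prime_gt0 pp.
have [r rE] : exists r : int, forall t, iter p phi t = t + r%:~R.
  apply: (@curve_fiber_reparam D _ (reparam_iter p rphi)) => t; rewrite -(rotation_iter p t rot).
  by rewrite -mulr_natr mulfVK ?pnatr_eq0 -?lt0n// rotation2pi.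
have pr : ~~ (p%:Z %| r)%Z.
  apply/negP => /dvdzP[l rl].
  have [t tE] : exists t, phi t = t + l%:~R.
    by apply: (reparam_translation_number rphi _ p0) => t; rewrite rE rl mulrC.
  (* Since p is at least 2, the angle is at most pi, and the origin is the only fixed point of the
     rotation. *)
  have /eqP := D0 t; apply; apply: (@rotation_fixed _ theta).
  - by rewrite divr_gt0 ?ltr0n// mulr_gt0 ?pi_gt0.
  - rewrite ler_pdivrMr ?ltr0n// mulrC ler_pM2l ?pi_gt0//.
    by rewrite (ler_nat R 2 p).
  by rewrite rot tE (periodicz (@curve_periodic _ D)).
(* With k r = 1 + p l, the k-th iterate of [phi] translated by - l has p-th iterate t + k r - p l =
   t + 1. *)
have [k [l kl]] := bezout_prime pp pr.
exists (fun t => iter k phi t + (- l)%:~R); split.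
- exact/reparam_shift/reparam_iter.
- move=> t; rewrite iter_reparam_shift; last exact: reparam_iter.
  rewrite -iterM mulnC iterM.
  have -> j : iter j (iter p phi) t = t + (j%:Z * r)%:~R.
    elim: j => [|j IH]; first by rewrite mul0r addr0.
    by rewrite iterS IH rE -addrA -intrD; congr (_ + _%:~R); lia.
  rewrite kl -addrA -intrD; congr (_ + _).
  by have -> : 1 + p%:Z * l + p%:Z * - l = 1 by ring.
- move=> s t; apply: (iff_trans (is_over_shift D _ _ _)).
  have oDk j : is_over D (iter j phi s) (iter j phi t) <-> is_over D s t.
    elim: j => [|j IH]; first exact: iff_refl.
    rewrite !iterS; exact: (iff_trans (iff_sym (oD _ _)) IH).
  exact: oDk.
- move=> s t; apply: (etrans (strand_sign_shift D _ _ _)).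
  have sDk j : strand_sign D (iter j phi s) (iter j phi t) = strand_sign D s t.
    elim: j => [|j IH]; first exact: erefl.
    rewrite !iterS; exact: (etrans (rotation_sign _ _ rphi rot) IH).
  exact: sDk.
Qed.

End Periodic.

(** Comparison by integer part, then by position in the period. The bounds on a and j make the
    encoding by q k + j respect this order, including the value a = k. *)
Lemma mixed_radix_lt (R : realType) (u f : R) (q b : int) (j a k : nat) :
  0 <= u < 1 -> 0 <= f < 1 -> (u < f) = (j < a)%N -> (a <= k)%N -> (j < k)%N ->
  (u + q%:~R < f + b%:~R) = (q * k%:Z + j%:Z < b * k%:Z + a%:Z).
Proof.
move=> /andP[u0 u1] /andP[f0 f1] ltE ak jk.
have [qb|qb|->] := ltgtP q b.
- have : (q + 1)%:~R <= b%:~R :> R by rewrite ler_int; lia.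
  rewrite intrD mulr1z => h; transitivity true; first by apply/idP; lra.
  apply/esym/idP; have : (q + 1) * k%:Z <= b * k%:Z by rewrite ler_pM2r; lia.
  by lia.
- have : (b + 1)%:~R <= q%:~R :> R by rewrite ler_int; lia.
  rewrite intrD mulr1z => h; transitivity false; first by apply/negbTE; rewrite -leNgt; lra.
  apply/esym/negbTE; rewrite -leNgt.
  have : (b + 1) * k%:Z <= q * k%:Z by rewrite ler_pM2r; lia.
  by lia.
- by rewrite ltrD2r ltE; lia.
Qed.

(** * Undercrossings on the universal cover and their shift by the symmetry *)

Section Lift.
Variable R : realType.
Variable D : diagram R.
Implicit Types (r s t u : R).
Let n := n_crossings D.

(** The undercrossings on the universal cover R of the circle, in increasing order. *)
Definition under_lift (i : int) : R := under_param D `|i %% n|%Z%N + (i %/ n)%Z%:~R.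

(** The index of the first lifted undercrossing that is not before r; mod n it is the index of the
    arc through r. *)
Definition index_lift r : int := Num.floor r * n%:Z + (arc_index D r)%:Z.

Hypothesis n0 : (0 < n)%N.

Lemma absz_mod_lt (i : int) : (`|i %% n|%Z%N < n)%N.
Proof.
have := ltz_pmod i (_ : 0 < n%:Z); have := modz_ge0 i (_ : n%:Z != 0); lia.
Qed.

Lemma under_lift_lt i r : (under_lift i < r) = (i < index_lift r).
Proof.
rewrite /under_lift /index_lift.
have iE : i = (i %/ n)%Z * n%:Z + `|i %% n|%Z%N%:Z.
  rewrite {1}(divz_eq i n); congr (_ + _); have := modz_ge0 i (_ : n%:Z != 0); lia.
have jn := absz_mod_lt i; have u01 := under_param_itv jn.
have ltE := lt_arc_index r jn; have an := arc_index_le D r; have rE := fracK r.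
rewrite {3}iE {1}rE; exact: mixed_radix_lt u01 (frac_itv r) ltE an jn.
Qed.

Lemma under_lift_mono : {mono under_lift : i j / i < j}.
Proof.
move=> i j; rewrite under_lift_lt; congr (_ < _).
rewrite /index_lift /arc_index /under_lift fracDz.
have jn := absz_mod_lt j; rewrite frac_id ?under_param_itv//.
rewrite count_lt_nth//; last exact: under_sorted.
have -> : Num.floor (under_param D `|(j %% n)%Z| + (j %/ n)%Z%:~R) = (j %/ n)%Z.
  apply: Num.Theory.floor_def; have /andP[u0 u1] := under_param_itv jn.
  by rewrite intrD mulr1z; apply/andP; split; lra.
rewrite {3}(divz_eq j n); congr (_ + _); have := modz_ge0 j (_ : n%:Z != 0); lia.
Qed.

Lemma under_lift_shift i (k : int) : under_lift (i + k * n%:Z) = under_lift i + k%:~R.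
Proof.
rewrite /under_lift (addrC i) modzMDl divzMDl; last by lia.
by rewrite intrD [in LHS](addrC k%:~R) addrA.
Qed.

Lemma under_under_lift i : under D (under_lift i).
Proof.
have := under_param_under (absz_mod_lt i); apply: under_same.
by apply/same_paramP; exists (i %/ n)%Z.
Qed.

Lemma under_liftP u : under D u -> exists i, u = under_lift i.
Proof.
move=> uU; have fU : under D (frac u) := under_same (same_param_frac u) uU.
have [i iD iE] := under_paramE (frac_itv u) fU.
exists (i%:Z + Num.floor u * n%:Z); rewrite under_lift_shift {1}(fracK u); congr (_ + _).
by rewrite iE /under_lift modz_small ?divz_small ?addr0//; lia.
Qed.

End Lift.

(** An order automorphism of the integers maps successors to successors. *)
Lemma int_translation (h : int -> int) : {mono h : i j / i < j} ->
  (forall j, exists i, h i = j) -> forall i, h i = i + h 0.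
Proof.
move=> hmono hsurj.
have hS i : h (i + 1) = h i + 1.
  have lt1 : h i < h (i + 1) by rewrite hmono; lia.
  have [ge1|] := leP (h (i + 1)) (h i + 1); first lia.
  have [j jE] := hsurj (h i + 1); rewrite -jE hmono => j1.
  have : h i < h j by lia.
  by rewrite hmono; lia.
elim/int_ind => [|i IH|i IH]; first by rewrite add0r.
  by rewrite -addn1 PoszD hS IH; lia.
by have := hS (- i.+1%:Z); rewrite (_ : - i.+1%:Z + 1 = - i%:Z) ?IH; lia.
Qed.

Lemma int_section_eq (a b : int) : (forall i : int, (i < a) = (i < b)) -> a = b.
Proof. by move=> h; have := h a; have := h b; rewrite !ltxx; lia. Qed.

Section LiftSymmetry.
Variables (R : realType) (D : diagram R) (psi : R -> R) (p : nat).
Hypotheses (n0 : (0 < n_crossings D)%N) (p0 : (0 < p)%N) (rpsi : reparametrization psi).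
Hypothesis psi_p : forall t, iter p psi t = t + 1.
Hypothesis psi_over : forall s t, is_over D (psi s) (psi t) <-> is_over D s t.
Let n := n_crossings D.

Lemma symmetry_mono : {mono psi : s t / s < t}.
Proof.
case: rpsi => _ inc _ s t; apply/idP/idP => [|/inc//]; apply: contraTT.
by rewrite -!leNgt le_eqVlt => /orP[/eqP->//|/inc/ltW].
Qed.

Lemma symmetry_under t : under D t -> under D (psi t).
Proof. by move=> [s st]; exists (psi s); apply/psi_over. Qed.

(** The inverse of [psi] is its (p - 1)-st iterate followed by t -> t - 1. *)
Lemma symmetry_under_surj u : under D u -> exists2 t, under D t & u = psi t.
Proof.
move=> uU; exists (iter p.-1 psi u + (-1)%:~R).
  have : under D (iter p.-1 psi u) by elim: p.-1 => //= k; exact: symmetry_under.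
  by apply: under_same; apply/same_paramP; exists (-1).
by rewrite (reparamDz _ _ rpsi) -iterS prednK// psi_p intrN mulr1z addrK.
Qed.

(** The symmetry induces an order automorphism of the lifted undercrossings, hence a shift of their
    indices; [index_lift] follows, being determined by the undercrossings before r. *)
Lemma symmetry_lift : exists m : int,
  (forall i, psi (under_lift D i) = under_lift D (i + m)) /\
  (forall r, index_lift D (psi r) = index_lift D r + m).
Proof.
have lmono := under_lift_mono n0.
have linj i j : under_lift D i = under_lift D j -> i = j.
  by move=> ij; apply: int_section_eq => k; rewrite -!lmono ij.
have hex i : exists j, psi (under_lift D i) = under_lift D j.
  exact/(under_liftP n0)/symmetry_under/under_under_lift.
have [h hE] := choice hex.
have hmono : {mono h : i j / i < j}.
  by move=> i j; rewrite -lmono -!hE symmetry_mono lmono.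
have hsurj j : exists i, h i = j.
  have [t tU jt] := symmetry_under_surj (under_under_lift n0 j).
  have [i iE] := under_liftP n0 tU; exists i.
  by apply: linj; rewrite -hE -iE -jt.
have hD := int_translation hmono hsurj; exists (h 0); split=> [i|r].
  by rewrite hE hD.
apply: int_section_eq => i; rewrite -under_lift_lt//.
have -> : i = i - h 0 + h 0 by lia.
by rewrite -(hD (i - h 0)) -hE symmetry_mono under_lift_lt// (hD (i - h 0)) ltrD2r.
Qed.

End LiftSymmetry.

(** The p-th iterate of [psi] shifts the lifted undercrossings by p m; being t -> t + 1, it shifts
    them by n. The over-arcs follow because an undercrossing determines its over parameter mod 1. *)
Lemma periodic_gauss_code (R : realType) (D : diagram R) p : prime p ->
  (forall t, curve D t != 0) -> rotation_invariant (2 * pi / p%:R) D ->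
  (0 < n_crossings D)%N ->
  exists2 m, n_crossings D = (p * m)%N & forall i, (i < n_crossings D)%N ->
    over_arc D ((i + m) %% n_crossings D) = ((over_arc D i + m) %% n_crossings D)%N /\
    crossing_sign D ((i + m) %% n_crossings D) = crossing_sign D i.
Proof.
move=> pp D0 Dinv n0; have p0 := prime_gt0 pp.
have [psi [rpsi psi_p psi_over psi_sign]] := periodic_translation pp D0 Dinv.
have [m [mE mN]] := symmetry_lift n0 p0 rpsi psi_p psi_over.
have nm : (n_crossings D)%:Z = p%:Z * m.
  have lmono := under_lift_mono n0.
  have iterE k i : iter k psi (under_lift D i) = under_lift D (i + k%:Z * m).
    elim: k => [|k IH]; first by rewrite mul0r addr0.
    by rewrite iterS IH mE; congr under_lift; lia.
  have : under_lift D (0 + p%:Z * m) = under_lift D (0 + 1 * (n_crossings D)%:Z).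
    by rewrite -iterE psi_p under_lift_shift.
  move=> e; apply: int_section_eq => k.
  by have := lmono k (0 + p%:Z * m); rewrite e lmono !add0r mul1r => <-.
have m_ge0 : 0 <= m by nia.
exists `|m|%N; first lia.
move=> i iD; set j := ((i + `|m|) %% n_crossings D)%N.
have jD : (j < n_crossings D)%N by rewrite ltn_mod.
have [s01 oi] := over_paramP iD; have [s'01 oj] := over_paramP jD.
have uE k : (k < n_crossings D)%N -> under_param D k = under_lift D k.
  by move=> kD; rewrite /under_lift modz_small ?divz_small ?addr0.
have uj : same_param (psi (under_param D i)) (under_param D j).
  rewrite uE// mE uE//; apply/same_paramP.
  exists (- ((i + `|m|) %/ n_crossings D)%N%:Z); rewrite -under_lift_shift//.
  congr under_lift; rewrite /j; have := divn_eq (i + `|m|) (n_crossings D); lia.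
have oij : is_over D (psi (over_param D i)) (under_param D j).
  by apply: over_same_param (same_param_refl _) uj _; apply/psi_over.
have ss := over_unique oij oj.
split.
  rewrite !over_arcE//.
  have idx r : (arc_index D r %% n_crossings D)%N%:Z = (index_lift D r %% n_crossings D)%Z.
    by rewrite /index_lift modzMDl modz_nat.
  have /same_paramP[k ->] := ss; rewrite arc_indexDz modnDml.
  apply/eqP; rewrite -eqz_nat idx mN -modz_nat; apply/eqP.
  by rewrite -modzDml -idx -modz_nat modzDml PoszD gez0_abs.
apply: etrans (psi_sign (over_param D i) (under_param D i)).
by rewrite /strand_sign -(crossing_det_same D ss uj).
Qed.

(** * Murasugi's condition *)

(** The matrix is the identity minus a cyclic shift. Its rows and columns sum to 0, so all cofactors
    are equal, and the last one is the determinant of a triangular matrix with ones on the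
    diagonal. *)
Lemma cyclic_cofactor (S : comNzRingType) n (i k : 'I_n) :
  cofactor (\matrix_(i < n, j < n) ((j == i :> nat)%:R - (j == i.+1 %% n :> nat)%N%:R : S)) i k = 1.
Proof.
case: n i k => [[]//|n] i k; set C := \matrix_(i, j) _.
have CE x y : C x y = (y == x)%:R - (y == ordS x)%:R by rewrite mxE.
have sum1 (j : 'I_n.+1) : \sum_l (l == j)%:R = 1 :> S.
  by rewrite (bigD1 j)//= eqxx big1 ?addr0// => l /negPf ->.
have row0 x : \sum_j C x j = 0.
  by under eq_bigr do rewrite CE; rewrite sumrB !sum1 subrr.
have kerC : (const_mx 1 : 'rV_n.+1) *m C = 0.
  apply/rowP => j; rewrite !mxE.
  under eq_bigr do rewrite mxE mul1r CE.
  have e : \sum_l (j == l)%:R = \sum_l (j == ordS l)%:R :> S.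
    by rewrite (reindex_inj (@ordS_inj n.+1)).
  by rewrite sumrB e subrr.
rewrite (cofactor_rowsum0 ord_max row0).
have := cofactor_left_kernel i ord_max ord_max kerC; rewrite !mxE !mul1r => ->.
rewrite /cofactor -signr_odd addnn odd_double expr0 mul1r -det_tr det_trig.
  rewrite big1// => j _; rewrite !mxE !lift_max eqxx modn_small ?ltnS//.
  by rewrite -[X in X == _]addn0 -addn1 eqn_add2l subr0.
apply/is_trig_mxP => x y xy; rewrite !mxE !lift_max modn_small ?ltnS//.
by rewrite ltn_eqF// ltn_eqF ?subrr// ltnW.
Qed.

Section Presentation.
Variables (S : nzRingType) (n : nat) (e : nat -> bool) (over : nat -> nat).

(** The flag b means a positive crossing. Once denominators are cleared, [in_coef] belongs to the
    incoming arc and minus [out_coef] to the outgoing one. *)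
Definition in_coef b : {poly S} := if b then 1 else 'X.
Definition out_coef b : {poly S} := if b then 'X else 1.

(** The rows of the Alexander matrix, multiplied by t at the positive crossings. *)
Definition alexander_entry (i j : nat) : {poly S} :=
  in_coef (e i) *+ (j == i) - out_coef (e i) *+ (j == i.+1 %% n)%N
  + (out_coef (e i) - in_coef (e i)) *+ (j == over i).

Lemma sum_pred1 (F : nat -> {poly S}) x : (x < n)%N -> \sum_(l < n) F l *+ (l == x :> nat) = F x.
Proof.
move=> xn; rewrite (bigD1 (Ordinal xn))//= eqxx mulr1n big1 ?addr0// => l.
by rewrite -val_eqE /= => /negPf ->.
Qed.

Lemma alexander_entry_rowsum i : (i < n)%N -> (over i < n)%N ->
  \sum_(j < n) alexander_entry i j = 0.
Proof.
move=> ilt olt; rewrite /alexander_entry big_split sumrB /=.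
rewrite !(sum_pred1 (fun=> _))// ?ltn_mod ?(leq_ltn_trans _ ilt)//.
by rewrite addrA subrK subrr.
Qed.

(** At t = 1 the over-arcs drop out, and only the cyclic succession of the arcs remains. *)
Lemma alexander_entry1 i j :
  (alexander_entry i j).[1] = (j == i)%:R - (j == i.+1 %% n)%N%:R.
Proof.
rewrite /alexander_entry !(hornerD, hornerN, hornerMn).
by rewrite /in_coef /out_coef; case: e; rewrite hornerX hornerC subrr mul0rn addr0.
Qed.

End Presentation.

Lemma alexander_entry_map (S T : nzRingType) (f : {rmorphism S -> T}) n e over i j :
  map_poly f (alexander_entry S n e over i j) = alexander_entry T n e over i j.
Proof.
rewrite /alexander_entry rmorphD rmorphB !rmorphMn rmorphB /in_coef /out_coef.
by case: e; rewrite /= rmorph1 map_polyX.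
Qed.

Section PeriodicPresentation.
Variables (S : nzRingType) (p m : nat) (e : nat -> bool) (over : nat -> nat).
Let n := (p * m)%N.
Hypotheses (p1 : (1 < p)%N) (m0 : (0 < m)%N).
Hypothesis over_lt : forall i, (i < n)%N -> (over i < n)%N.
Hypothesis over_shift : forall i, (i < n)%N -> over ((i + m) %% n)%N = ((over i + m) %% n)%N.
Hypothesis e_shift : forall i, (i < n)%N -> e ((i + m) %% n)%N = e i.
Let entry := alexander_entry S n e over.

Let n0 : (0 < n)%N. Proof. by rewrite muln_gt0 m0 (ltn_trans _ p1). Qed.

Lemma alexander_entry_shift i j : (i < n)%N -> (j < n)%N ->
  entry ((i + m) %% n)%N ((j + m) %% n)%N = entry i j.
Proof.
move=> ilt jlt; rewrite /entry /alexander_entry e_shift// over_shift//.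
have eqE x : (x < n)%N -> ((j + m) %% n == (x + m) %% n)%N = (j == x).
  by move=> xn; rewrite eqn_modDr !modn_small.
rewrite !eqE ?over_lt//; suff -> : (((i + m) %% n).+1 %% n = (i.+1 %% n + m) %% n)%N.
  by rewrite eqE// ltn_mod.
by rewrite -addn1 !modnDml addnAC addn1.
Qed.

Lemma alexander_entry_shift_iter k i j : (i < n)%N -> (j < n)%N ->
  entry ((i + k * m) %% n)%N ((j + k * m) %% n)%N = entry i j.
Proof.
move=> ilt jlt; elim: k => [|k IH]; first by rewrite !addn0 !modn_small.
rewrite -IH -[in RHS]alexander_entry_shift ?ltn_mod//.
by rewrite !modnDml mulSn -!addnA ![(m + _)%N]addnC.
Qed.

(** Shifting by p - i / m blocks brings row i into block 0. *)
Lemma alexander_entry_circ i j : (i < n)%N -> (j < n)%N ->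
  entry i j = entry (i %% m)%N (((j %/ m + (p - i %/ m)) %% p) * m + j %% m)%N.
Proof.
move=> ilt jlt; rewrite -(alexander_entry_shift_iter (p - i %/ m) ilt jlt).
have modE x r : (r < m)%N -> ((x * m + r) %% n = (x %% p) * m + r)%N.
  move=> rm; rewrite {1}(divn_eq x p) mulnDl -mulnA -addnA modnMDl modn_small//.
  rewrite (@leq_trans ((x %% p).+1 * m))//; first by rewrite mulSn addnC ltn_add2r.
  by rewrite leq_mul2r ltn_mod (ltn_trans _ p1) ?orbT.
have ip : (i %/ m <= p)%N by rewrite ltnW// ltn_divLR.
congr entry.
  rewrite {1}(divn_eq i m) addnAC -mulnDl addnC subnKC// addnC.
  by rewrite modE ?ltn_mod// modnn.
by rewrite {1}(divn_eq j m) addnAC -mulnDl modE ?ltn_mod.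
Qed.

End PeriodicPresentation.

Lemma polyX_factor (F : idomainType) (P : {poly F}) : P != 0 ->
  exists c (Q : {poly F}), Q`_0 != 0 /\ P = Q * 'X^c.
Proof.
move=> P0; have [c [Q]] := multiplicity_XsubC P 0.
by rewrite P0 /= subr0 rootE horner_coef0 => Q0 ->; exists c, Q.
Qed.

Section MurasugiCondition.
Variables (p m : nat) (e : nat -> bool) (over : nat -> nat).
Let n := (p * m)%N.
Hypotheses (pp : prime p) (m0 : (0 < m)%N).
Hypothesis over_lt : forall i, (i < n)%N -> (over i < n)%N.
Hypothesis over_shift : forall i, (i < n)%N -> over ((i + m) %% n)%N = ((over i + m) %% n)%N.
Hypothesis e_shift : forall i, (i < n)%N -> e ((i + m) %% n)%N = e i.

Let entry := alexander_entry 'F_p n e over.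
Let a k i j := entry i (k * m + j)%N.
Let B := \matrix_(i < n, j < n) entry i j.
Let quo := \matrix_(i < m, j < m) \sum_(k < p) a k i j.
Let speed i := \sum_(k < p) (\sum_(j < m) a k i j) *+ k.
Let delta (l : 'I_m) := \sum_(i < m) speed i * cofactor quo i l.

Let p1 : (1 < p)%N. Proof. exact: prime_gt1. Qed.
Let p0 : (0 < p)%N. Proof. exact: prime_gt0. Qed.
Let mn : (m < n)%N. Proof. by rewrite /n -[X in (X < _)%N]mul1n ltn_pmul2r. Qed.

Let block_eq k j x : (j < m)%N -> (k * m + j == x)%N = (k == x %/ m)%N && (j == x %% m)%N.
Proof.
move=> jm; apply/eqP/andP => [<-|[/eqP-> /eqP->]]; last by rewrite -divn_eq.
by rewrite divnMDl// divn_small// addn0 modnMDl modn_small.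
Qed.

Lemma quotient_at1 :
  map_mx (horner_eval 1) quo = \matrix_(i < m, j < m) ((j == i :> nat)%:R - (j == i.+1 %% m :> nat)%N%:R).
Proof.
have sum1 (x j : nat) : (x < n)%N -> (j < m)%N ->
    \sum_(k < p) (k * m + j == x)%N%:R = (j == x %% m)%N%:R :> 'F_p.
  move=> xn jm; have xp : (x %/ m < p)%N by rewrite ltn_divLR.
  rewrite (bigD1 (Ordinal xp))//= block_eq// eqxx big1 ?addr0// => k.
  by rewrite -val_eqE block_eq// /= => /negPf ->.
apply/matrixP => i j; rewrite !mxE horner_evalE horner_sum.
under eq_bigr do rewrite alexander_entry1.
have im := ltn_ord i; have in1 : (i.+1 < n)%N by exact: leq_ltn_trans mn.
by rewrite (modn_small in1) sumrB !sum1 ?(ltn_trans im)// (modn_small im).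
Qed.

(** At t = 1 the cofactors of the quotient are 1, and row i relates arc i to arc i + 1. These lie in
    the same block unless i = m - 1, so this row alone has nonzero speed, equal to -1. *)
Lemma delta_at1 l : (delta l).[1] = -1.
Proof.
rewrite /delta horner_sum.
transitivity (\sum_(i < m) - (i.+1 %/ m)%N%:R : 'F_p).
  apply: eq_bigr => i _; rewrite hornerM -[(cofactor _ _ _).[1]]horner_evalE -cofactor_map_mx.
  rewrite quotient_at1 cyclic_cofactor mulr1 /speed horner_sum.
  have im := ltn_ord i; have in1 : (i.+1 < n)%N by exact: leq_ltn_trans mn.
  transitivity (\sum_(l < n) (l %/ m)%N%:R * ((l == i :> nat)%:R - (l == i.+1 :> nat)%:R) : 'F_p).
    transitivity (\sum_(k < p) \sum_(j < m)
        (k%:R * ((k * m + j == i)%N%:R - (k * m + j == i.+1)%N%:R)) : 'F_p).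
      apply: eq_bigr => k _; rewrite hornerMn horner_sum -mulr_natl mulr_sumr.
      by apply: eq_bigr => j _; rewrite alexander_entry1 (modn_small in1).
    rewrite -(sum_blocks p m (fun k j => k%:R * ((k * m + j == i)%N%:R - (k * m + j == i.+1)%N%:R))).
    by apply: eq_bigr => x _; rewrite -!divn_eq.
  have pick (x : nat) : (x < n)%N ->
      \sum_(l < n) (l %/ m)%N%:R * (l == x :> nat)%:R = (x %/ m)%N%:R :> 'F_p.
    move=> xn; rewrite (bigD1 (Ordinal xn))//= eqxx mulr1 big1 ?addr0// => y.
    by rewrite -val_eqE /= => /negPf ->; rewrite mulr0.
  under eq_bigr do rewrite mulrBr.
  by rewrite sumrB !pick ?(ltn_trans im)// divn_small// sub0r.
case: (m) m0 => // m' _; rewrite big_ord_recr big1 /=; first by rewrite divnn add0r.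
by move=> i _; rewrite divn_small ?oppr0// ltnS.
Qed.

(** P stands for Delta mod p up to a unit; the last two hypotheses say that, up to powers of t, it
    generates the ideal of the cofactors in column k. *)
Lemma murasugi_condition (P : {poly 'F_p}) (k : 'I_n) : P`_0 != 0 -> (size P < p)%N ->
  (forall i, exists N Q, 'X^N * cofactor B i k = Q * P) ->
  (exists M (Q : 'I_n -> {poly 'F_p}), 'X^M * P = \sum_i Q i * cofactor B i k) ->
  size P = 1.
Proof.
move=> P0 szP G1 [M [Q G2]].
have modm (i : 'I_n) : (i %% m < m)%N by rewrite ltn_mod.
have cX (T : {poly 'F_p}) c : T`_0 != 0 -> coprimep T 'X^c.
  by move=> T0; rewrite coprimep_expr// -['X]subr0 coprimep_XsubC rootE horner_coef0.
pose l := Ordinal m0; pose w i := cofactor quo i l.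
have d0 : delta l != 0.
  apply/eqP => d0; have := delta_at1 l; rewrite d0 horner0 => /esym/eqP.
  by rewrite oppr_eq0 oner_eq0.
have rowsum i : (i < m)%N -> \sum_(k < p) \sum_(j < m) a k i j = 0.
  move=> im; have in' := ltn_trans im mn.
  rewrite -[RHS](@alexander_entry_rowsum 'F_p n e over i in' (over_lt in')).
  rewrite -(sum_blocks p m (fun k j => a k i j)).
  by apply: eq_bigr => x _; rewrite /a -divn_eq.
have wE (i : 'I_n) : cofactor B i k = w (Ordinal (modm i)) * delta l ^+ p.-1.
  have pR : p \in [pchar {poly 'F_p}] by rewrite pchar_poly pchar_Fp.
  have := @cofactor_murasugi _ p pR m a rowsum k i l d0.
  have -> : B = \matrix_(i < p * m, j < p * m)
      a ((j %/ m + (p - i %/ m)) %% p)%N (i %% m)%N (j %% m)%N.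
    by apply/matrixP => x y; rewrite !mxE; exact: alexander_entry_circ.
  by move=> ->; rewrite /w; congr (cofactor _ _ _ * _); exact: val_inj.
(* Powers of t are units for Laurent polynomials and are removed from [delta], so that d is prime to
   t and divisibility can be read between polynomials. *)
have [c [d [dn0 dE]]] := polyX_factor d0.
have dP : d ^+ p.-1 %| P.
  rewrite -(Gauss_dvdpr _ (_ : coprimep _ 'X^M)); last by apply: coprimep_expl; exact: cX.
  rewrite G2; apply: (big_ind (fun x => d ^+ p.-1 %| x)) => [|x y|i _]; [exact: dvdp0|exact: dvdp_add|].
  by rewrite wE dE exprMn; do 2![apply: dvdp_mull]; rewrite dvdp_mulr.
have Pn0 : P != 0 by apply: contraNneq P0 => ->; rewrite coef0.
have dn : d != 0 by apply: contraNneq dn0 => ->; rewrite coef0.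
(* (p - 1) deg d <= deg P < p - 1. *)
have size_d : size d = 1%N.
  have := dvdp_leq Pn0 dP; have := size_exp d p.-1.
  have := size_poly_gt0 d; rewrite dn.
  have := size_poly_gt0 (d ^+ p.-1); rewrite expf_neq0//.
  case: (size d) => [//|[//|s]] /= h1 h2 h3 h4.
  have h5 := leq_pmull p.-1 (ltn0Sn s); rewrite -h3 in h5.
  have := leq_ltn_trans h4 szP; have p1' := p1.
  by move: h1 h5; case: (size (d ^+ _)) => [//|z] _ /=; move: p1'; clear; case: p => [|[|q]]//; lia.
have [b b0 db] : exists2 b, b != 0 & d = b%:P by apply/size_poly1P; rewrite size_d.
(* As d is constant, P divides each cofactor of the quotient up to a power of t, hence also their
   combination [delta], a monomial. *)
have Pw i : exists N, P %| 'X^N * w i.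
  have in' : (i < n)%N := ltn_trans (ltn_ord i) mn.
  have [N [Qi QiE]] := G1 (Ordinal in'); exists (N + c * p.-1)%N.
  have iE : Ordinal (modm (Ordinal in')) = i by apply: val_inj; rewrite /= modn_small.
  rewrite -(@dvdpZr _ (b ^+ p.-1)) ?expf_neq0// -mul_polyC rmorphXn /= -db.
  apply/dvdpP; exists Qi; rewrite -QiE wE iE dE exprMn exprD exprM; ring.
have [N NP] := fin_all_exists Pw.
have : P %| 'X^(\sum_i N i) * delta l.
  rewrite mulr_sumr; apply: (big_ind (fun x => P %| x)) => [|x y|i _]; [exact: dvdp0|exact: dvdp_add|].
  rewrite (bigD1 i)//= exprD [speed i * _]mulrC mulrACA.
  exact: dvdp_mulr (NP i).
rewrite dE db mulrCA mul_polyC dvdpZr// -exprD -[X in _ %| X]mul1r.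
by rewrite Gauss_dvdpl ?cX// dvdp1 => /eqP.
Qed.

End MurasugiCondition.

(** * Laurent polynomials *)

Local Notation tofrac := (@FracField.tofrac _).

Section LaurentPolynomials.

Lemma poly_laurent_subproof (P : {poly int}) : tofrac P \in is_laurent.
Proof. by apply/asboolP; exists 0%N, P; rewrite expr0 divr1. Qed.

Definition poly_laurent (P : {poly int}) : laurent := Laurent (poly_laurent_subproof P).

Lemma poly_laurent_is_zmod_morphism : zmod_morphism poly_laurent.
Proof. by move=> P Q; apply: val_inj; rewrite /= tofracB. Qed.

Lemma poly_laurent_is_monoid_morphism : monoid_morphism poly_laurent.
Proof. by split=> [|P Q]; apply: val_inj; rewrite /= ?tofrac1 ?tofracM. Qed.

HB.instance Definition _ := GRing.isZmodMorphism.Build {poly int} laurent poly_laurent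
  poly_laurent_is_zmod_morphism.
HB.instance Definition _ := GRing.isMonoidMorphism.Build {poly int} laurent poly_laurent
  poly_laurent_is_monoid_morphism.

Lemma poly_laurent_inj : injective poly_laurent.
Proof. by move=> P Q /(congr1 val)/= /eqP; rewrite tofrac_eq => /eqP. Qed.

Lemma laurent_denominator (y : laurent) :
  exists (t : nat) (Y : {poly int}), y * poly_laurent 'X^t = poly_laurent Y.
Proof.
have /asboolP[t [Y yE]] := laurentP y; exists t, Y; apply: val_inj => /=.
rewrite yE tofracXn mulfVK// expf_neq0// tofracX_neq0//.
Qed.

Lemma laurent_denominators (I : finType) (y : I -> laurent) :
  exists (t : nat) (Y : I -> {poly int}),
    forall i, y i * poly_laurent 'X^t = poly_laurent (Y i).
Proof.
have [t tP] := fin_all_exists (fun i => laurent_denominator (y i)).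
have [Y YP] := fin_all_exists tP.
exists (\sum_i t i)%N, (fun i => Y i * 'X^(\sum_(j | j != i) t j)) => i.
by rewrite (bigD1 i)//= exprD !rmorphM /= mulrA YP.
Qed.

Lemma tpow1 : tpow 1 = poly_laurent 'X.
Proof. exact: val_inj. Qed.

Lemma tpowN1 : tpow (-1) * poly_laurent 'X = 1.
Proof. by apply: val_inj; rewrite /= mulVf// tofracX_neq0. Qed.

(** The normal form t^(c - s) P, where P is a polynomial not divisible by t. *)
Definition laurent_factor (g : laurent) (s c : nat) (P : {poly int}) :=
  P`_0 != 0 /\ laurent_val g = tofrac (P * 'X^c) / tofrac 'X ^+ s.

Lemma laurent_factorP g : g != 0 -> exists s c P, laurent_factor g s c P.
Proof.
move=> g0; have /asboolP[s [Q gE]] := laurentP g.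
have Q0 : Q != 0.
  apply: contraNneq g0 => Q0; apply/eqP/val_inj.
  by rewrite /= gE Q0 tofrac0 mul0r.
have [c [P [P0 QE]]] := polyX_factor Q0.
by exists s, c, P; split=> //; rewrite gE QE.
Qed.

Section Factor.
Variables (g : laurent) (s c : nat) (P : {poly int}).
Hypothesis gP : laurent_factor g s c P.

Lemma laurent_factorE : g * poly_laurent 'X^s = poly_laurent (P * 'X^c).
Proof.
apply: val_inj => /=; have [_ ->] := gP.
by rewrite tofracXn mulfVK// expf_neq0// tofracX_neq0.
Qed.

Lemma lcoef_factor j : lcoef g j = if j + s%:Z is Posz k then (P * 'X^c)`_k else 0.
Proof. by have [_] := gP; exact: lcoefE. Qed.

Lemma lcoef_factor_shift k : lcoef g (k%:Z + c%:Z - s%:Z) = P`_k.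
Proof. by rewrite lcoef_factor subrK -PoszD coefMXn ltnNge leq_addl addnK. Qed.

Lemma lcoef_factor_supp j : lcoef g j != 0 -> exists2 k, (k < size P)%N & lcoef g j = P`_k.
Proof.
rewrite lcoef_factor; case: (j + s%:Z) => [k|//].
rewrite coefMXn; case: ltnP => [_|ck Pk]; first by rewrite eqxx.
exists (k - c)%N => //; rewrite ltnNge; apply: contra Pk => /leq_sizeP/(_ _ (leqnn _)) ->.
exact: eqxx.
Qed.

Lemma size_factor_lspan : (size P <= (lspan g).+1)%N.
Proof.
have [P0 _] := gP; have Pn0 : P != 0 by apply: contraNneq P0 => ->; rewrite coef0.
have sP : (0 < size P)%N by rewrite size_poly_gt0.
have c0 : lcoef g (0%:Z + c%:Z - s%:Z) != 0 by rewrite lcoef_factor_shift.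
have c1 : lcoef g ((size P).-1%:Z + c%:Z - s%:Z) != 0.
  by rewrite lcoef_factor_shift -[_`_ _]/(lead_coef P) lead_coef_eq0.
(* The default value of [xget] is excluded, because the support of g provides a solution. *)
rewrite /lspan; case: xgetP => [d -> [m [_ _ supp]]|none].
  by have := supp _ c0; have := supp _ c1; lia.
exfalso; apply: (none (size P).-1); exists (c%:Z - s%:Z); split.
- by have := c0; rewrite add0r.
- by have := c1; rewrite (_ : _ - s%:Z = c%:Z - s%:Z + (size P).-1%:Z)//; lia.
- move=> j; rewrite lcoef_factor; case jE: (j + s%:Z) => [k|//].
  rewrite coefMXn; case: ltnP => [_|ck Pk]; first by rewrite eqxx.
  have : (k - c < size P)%N.
    rewrite ltnNge; apply: contra Pk => /leq_sizeP/(_ _ (leqnn _)) ->; exact: eqxx.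
  lia.
Qed.

Lemma laurent_factor_trivial : P = 1 \/ P = -1 -> trivial_laurent g.
Proof.
have X0 : tofrac ('X : {poly int}) != 0 by exact: tofracX_neq0.
have [_ gE] := gP; move=> P1; exists (c%:Z - s%:Z).
have tE : tofrac 'X^c / tofrac 'X ^+ s = laurent_val (tpow (c%:Z - s%:Z)).
  by rewrite /= expfzDr// -invr_expz tofracXn.
case: P1 gE => -> gE; [left|right]; apply: val_inj; rewrite /= gE.
  by rewrite mul1r tE.
by rewrite mulN1r tofracN mulNr tE.
Qed.

End Factor.
End LaurentPolynomials.

Lemma ideal_gen_family (S : comNzRingType) (I : finType) (f : I -> S) x :
  ideal_gen (fun d => exists i, d = f i) x -> exists q : I -> S, x = \sum_i q i * f i.
Proof.
move=> /(_ (fun x => exists q : I -> S, x = \sum_i q i * f i)); apply.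
- by exists (fun=> 0); rewrite big1// => i _; rewrite mul0r.
- move=> _ _ [q ->] [q' ->]; exists (fun i => q i + q' i).
  by rewrite -big_split; apply: eq_bigr => i _; rewrite mulrDl.
- move=> r _ [q ->]; exists (fun i => r * q i).
  by rewrite mulr_sumr; apply: eq_bigr => i _; rewrite mulrA.
- move=> _ [i ->]; exists (fun j => (j == i)%:R).
  by rewrite (bigD1 i)//= eqxx mul1r big1 ?addr0// => j /negPf ->; rewrite mul0r.
Qed.

Lemma minor_ideal_cofactors (S : comNzRingType) n (A : 'M[S]_n) (k : 'I_n) x :
  (forall i, \sum_j A i j = 0) ->
  (exists c : {ffun 'I_n.-1 -> 'I_n} -> {ffun 'I_n.-1 -> 'I_n} -> S,
     x = \sum_f \sum_g c f g * \det (mxsub f g A)) <->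
  ideal_gen (fun d => exists i, d = cofactor A i k) x.
Proof.
move=> A1; apply: (iff_trans (minor_ideal k x A1)).
case: n A k A1 => [? []//|n] A k A1; split; apply: ideal_gen_sub => d.
  by move=> [M [MP ->]]; exact: det_rowspan.
by move=> [i ->]; have [M [<- MP]] := cofactor_rowspan A k i; apply: ideal_gen_in; exists M.
Qed.

Lemma cofactor_scale_rows (S : comNzRingType) n (A B : 'M[S]_n) (u v : 'I_n -> S) i k :
  (forall x, v x * u x = 1) -> (forall x y, B x y = u x * A x y) ->
  exists r r', r' * r = 1 /\ cofactor B i k = r * cofactor A i k.
Proof.
case: n A B u v i k => [? ? ? ? []//|n] A B u v i k vu BA.
exists (\prod_x u (lift i x)), (\prod_x v (lift i x)); split.
  by rewrite -big_split big1//= => x _; rewrite vu.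
rewrite /cofactor mulrCA; congr (_ * _).
have -> : \prod_x u (lift i x) = \det (diag_mx (\row_x u (lift i x))).
  by rewrite det_diag; apply: eq_bigr => x _; rewrite mxE.
by rewrite -det_mulmx; congr (\det _); apply/matrixP => x y; rewrite mul_diag_mx !mxE BA.
Qed.

(** * The Alexander matrix and polynomial with denominators cleared *)

Section PolynomialPresentation.
Variables (R : realType) (D : diagram R).
Let n := n_crossings D.
Let entry (S : nzRingType) := alexander_entry S n (fun i => crossing_sign D i == 1) (over_arc D).
Definition alexander_poly_matrix (S : comNzRingType) := \matrix_(i < n, j < n) entry S i j.
Let B := alexander_poly_matrix int.

Lemma crossing_signE i : (i < n)%N -> crossing_sign D i = 1 \/ crossing_sign D i = -1.
Proof.
move=> iD; have [_ /over_double/curve_transverse det0] := over_paramP iD.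
rewrite /crossing_sign; case: sgzP => [d0|_|_]; [|by left|by right].
by move: det0; rewrite -[wedge _ _]/(crossing_det _ _ _) d0 eqxx.
Qed.

Lemma alexander_poly_matrix_scale (i j : 'I_n) :
  map_mx poly_laurent B i j =
  poly_laurent (out_coef int (crossing_sign D i == 1)) * alexander_matrix D i j.
Proof.
rewrite !mxE /entry /alexander_entry !rmorphD !rmorphN !rmorphMn !rmorphD !rmorphN.
have [->|->] := crossing_signE (ltn_ord i); rewrite /out_coef /in_coef /= ?rmorph1.
  rewrite mulrDr mulrBr !mulrnAr mulr1 mulrBr mulr1.
  by rewrite [_ * tpow _]mulrC tpowN1.
by rewrite opprK tpow1 !mul1r.
Qed.

Lemma alexander_cofactor_scale (i k : 'I_n) : exists r r', r' * r = 1 /\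
  poly_laurent (cofactor B i k) = r * cofactor (alexander_matrix D) i k.
Proof.
rewrite -cofactor_map_mx.
apply: (@cofactor_scale_rows _ _ _ _
  (fun i => poly_laurent (out_coef int (crossing_sign D i == 1)))
  (fun i => if crossing_sign D i == 1 then tpow (-1) else 1)).
  by move=> x; case: eqP => _; [exact: tpowN1|exact: etrans (mul1r _) (rmorph1 poly_laurent)].
exact: alexander_poly_matrix_scale.
Qed.

Lemma alexander_poly_cofactor1 (i k : 'I_n) : (cofactor B i k).[1] = 1.
Proof.
rewrite -horner_evalE -cofactor_map_mx -[RHS](cyclic_cofactor int i k).
by congr (cofactor _ _ _); apply/matrixP => x y; rewrite !mxE; exact: alexander_entry1.
Qed.

Lemma alexander_idealE k x : alexander_ideal D x <->
  ideal_gen (fun d => exists i, d = cofactor (alexander_matrix D) i k) x.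
Proof. exact: minor_ideal_cofactors (@alexander_matrix_rowsum _ D). Qed.

Lemma alexander_ideal_unit : n = 0%N -> alexander_ideal D 1.
Proof.
rewrite /n /alexander_ideal /=; move: (alexander_matrix D) => A n0.
move: A; rewrite n0 => A; exists (fun _ _ => 1).
have u1 (f : {ffun 'I_0 -> 'I_0}) : f = [ffun i => i] by apply/ffunP => -[].
rewrite (bigD1 [ffun i => i])//= [X in _ + X]big1 ?addr0; last by move=> f /eqP; rewrite [f]u1.
rewrite (bigD1 [ffun i => i])//= big1 ?addr0; last by move=> f /eqP; rewrite [f]u1.
by rewrite det_mx00 mulr1.
Qed.

Variable Delta : laurent.
Hypothesis DeltaP : alexander_ideal D = [set x | exists y, x = y * Delta].

Lemma alexander_cofactor_multiple (i k : 'I_n) :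
  exists y, poly_laurent (cofactor B i k) = y * Delta.
Proof.
have : alexander_ideal D (cofactor (alexander_matrix D) i k).
  by apply/(alexander_idealE k); apply: ideal_gen_in; exists i.
rewrite DeltaP => /= -[y yE]; have [r [_ [_ ->]]] := alexander_cofactor_scale i k.
by exists (r * y); rewrite yE mulrA.
Qed.

(** Delta divides 1 if there is no crossing, and otherwise a polynomial whose value at t = 1 is
    1. *)
Lemma alexander_polynomial_neq0 : Delta != 0.
Proof.
apply/eqP => Delta0; have [n0|n0] := posnP n.
  have := alexander_ideal_unit n0; rewrite DeltaP => /= -[y /eqP].
  by rewrite Delta0 mulr0 oner_eq0.
have := alexander_poly_cofactor1 (Ordinal n0) (Ordinal n0).
have [y] := alexander_cofactor_multiple (Ordinal n0) (Ordinal n0).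
rewrite Delta0 mulr0 -(rmorph0 poly_laurent) => /poly_laurent_inj ->.
by rewrite horner0.
Qed.

Variables (s c : nat) (P : {poly int}).
Hypothesis DeltaE : laurent_factor Delta s c P.

Lemma multiple_factor (Q : {poly int}) y : poly_laurent Q = y * Delta ->
  exists N Y, 'X^N * Q = Y * P.
Proof.
have [t [Y YE]] := laurent_denominator y; move=> QE.
exists (t + s)%N, (Y * 'X^c); apply: poly_laurent_inj.
transitivity (poly_laurent Y * poly_laurent (P * 'X^c)).
  by rewrite -(laurent_factorE DeltaE) -YE [LHS]rmorphM exprD rmorphM /= QE mulrC mulrACA.
by rewrite -rmorphM -mulrA ['X^c * P]mulrC.
Qed.

Lemma alexander_cofactor_factor (i k : 'I_n) : exists N Y, 'X^N * cofactor B i k = Y * P.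
Proof. by have [y] := alexander_cofactor_multiple i k; exact: multiple_factor. Qed.

Lemma alexander_factor_cofactor (k : 'I_n) :
  exists N (Y : 'I_n -> {poly int}), 'X^N * P = \sum_i Y i * cofactor B i k.
Proof.
have : alexander_ideal D Delta by rewrite DeltaP; exists 1; rewrite mul1r.
move=> /(alexander_idealE k)/ideal_gen_family[q qE].
have [r rP] := fin_all_exists (fun i => alexander_cofactor_scale i k).
have [r' r'P] := fin_all_exists rP.
(* The units r i, products of row factors, are inverted by r' i; a common power of t then clears all
   coefficients at once. *)
have [t [Y YE]] := laurent_denominators (fun i => q i * r' i).
exists (t + c)%N, (fun i => Y i * 'X^s); apply: poly_laurent_inj.
transitivity (poly_laurent 'X^t * (Delta * poly_laurent 'X^s)).
  by rewrite (laurent_factorE DeltaE) -rmorphM exprD -mulrA [P * _]mulrC.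
rewrite rmorph_sum {1}qE mulr_suml mulr_sumr; apply: eq_bigr => i _.
have [r'r cE] := r'P i; rewrite [RHS]rmorphM /= cE [poly_laurent (Y i * _)]rmorphM /= -YE.
transitivity (r' i * r i * (q i * cofactor (alexander_matrix D) i k *
  poly_laurent 'X^s * poly_laurent 'X^t)); first by rewrite r'r mul1r mulrC.
by ring.
Qed.

(** Up to a power of t, P divides a polynomial with value 1 at t = 1, so P(1) is a unit of the
    integers. *)
Lemma alexander_factor1 : P.[1] = 1 \/ P.[1] = -1.
Proof.
suff [Y YP] : exists Y : {poly int}, Y.[1] * P.[1] = 1.
  by move/intUnitRing.unitzPl: YP => /orP[/eqP|/eqP]; [left|right].
have [n0|n0] := posnP n.
  have := alexander_ideal_unit n0; rewrite DeltaP => /= -[y].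
  rewrite -(rmorph1 poly_laurent) => /multiple_factor[N [Y]] /(congr1 (horner^~ 1)).
  by rewrite hornerM hornerXn expr1n hornerM hornerC mulr1 => e; exists Y.
have [N [Y]] := alexander_cofactor_factor (Ordinal n0) (Ordinal n0).
move=> /(congr1 (horner^~ 1)); rewrite hornerM hornerXn expr1n mul1r alexander_poly_cofactor1 hornerM.
by move=> e; exists Y.
Qed.
End PolynomialPresentation.

(** * The theorem *)

Lemma intr_Fp_eq0 p (z : int) : prime p -> (z%:~R == 0 :> 'F_p) = (p%:Z %| z)%Z.
Proof.
move=> pp; have pF := pchar_Fp pp; rewrite dvdzE /=.
by case: z => k; rewrite ?NegzE ?rmorphN ?oppr_eq0 /= ?abszN -(dvdn_pcharf pF).
Qed.

Section Period.
Variables (R : realType) (D : diagram R) (p : nat).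
Hypotheses (pp : prime p) (D0 : forall t, curve D t != 0).
Hypothesis Dinv : rotation_invariant (2 * pi / p%:R) D.
Variables (Delta : laurent) (s c : nat) (P : {poly int}).
Hypothesis DeltaP : alexander_ideal D = [set x | exists y, x = y * Delta].
Hypothesis DeltaE : laurent_factor Delta s c P.
Hypothesis P_dvd : forall k, (p%:Z %| P`_k)%Z -> P`_k = 0.
Hypothesis size_P : (size P < p)%N.

Let red : {rmorphism {poly int} -> {poly 'F_p}} := map_poly (intr : int -> 'F_p).

Lemma periodic_reduction_size : size (red P) = 1%N.
Proof.
(* The nonzero constant term of P is not divisible by p, so reduction creates no new factor t. *)
have P0 : (red P)`_0 != 0.
  rewrite coef_map /= intr_Fp_eq0//; have [P0 _] := DeltaE.
  by apply: contra P0 => /P_dvd ->.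
have redX N : red 'X^N = 'X^N by rewrite rmorphXn /= map_polyX.
(* Without crossings the ideal is the whole ring, and P mod p divides a power of t. *)
have [n0|n0] := posnP (n_crossings D).
  have := alexander_ideal_unit n0; rewrite DeltaP => /= -[y].
  rewrite -(rmorph1 poly_laurent) => /(multiple_factor DeltaE)[N [Y]].
  rewrite mulr1 => /(congr1 red); rewrite rmorphM redX => e.
  apply/eqP; rewrite -dvdp1 -(@Gauss_dvdpr _ _ 'X^N) ?mulr1; last first.
    by rewrite coprimep_expr// -['X]subr0 coprimep_XsubC rootE horner_coef0.
  by rewrite e dvdp_mull.
have [m nE shift] := periodic_gauss_code pp D0 Dinv n0.
have m0 : (0 < m)%N by move: n0; rewrite nE muln_gt0 => /andP[].
pose e i := crossing_sign D i == 1.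
have BE : map_mx red (alexander_poly_matrix D int) = alexander_poly_matrix D 'F_p.
  by apply/matrixP => i j; rewrite !mxE; exact: alexander_entry_map.
pose k := Ordinal n0.
have G1 i : exists N Q, 'X^N * cofactor (alexander_poly_matrix D 'F_p) i k = Q * red P.
  have [N [Y]] := alexander_cofactor_factor DeltaP DeltaE i k.
  move/(congr1 red); rewrite (rmorphM red 'X^N) (rmorphM red Y) redX -cofactor_map_mx BE => e'.
  by exists N, (red Y).
have G2 : exists M (Q : 'I_(n_crossings D) -> {poly 'F_p}),
    'X^M * red P = \sum_i Q i * cofactor (alexander_poly_matrix D 'F_p) i k.
  have [N [Y]] := alexander_factor_cofactor DeltaP DeltaE k.
  move/(congr1 red); rewrite (rmorphM red 'X^N) redX rmorph_sum => e'.
  exists N, (fun i => red (Y i)); rewrite e'; apply: eq_bigr => i _.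
  by rewrite (rmorphM red (Y i)) -cofactor_map_mx BE.
have size_rP : (size (red P) < p)%N by apply: leq_ltn_trans size_P; exact: size_poly.
have over_lt i : (i < p * m)%N -> (over_arc D i < p * m)%N.
  by rewrite -nE; exact: over_arc_lt.
have over_sh i : (i < p * m)%N -> over_arc D ((i + m) %% (p * m))%N = ((over_arc D i + m) %% (p * m))%N.
  by rewrite -nE => /shift[].
have e_sh i : (i < p * m)%N -> e ((i + m) %% (p * m))%N = e i.
  by rewrite /e -nE => /shift[_ ->].
move: k G1 G2; rewrite /alexander_poly_matrix nE => k G1 G2.
exact: (murasugi_condition pp m0 over_lt over_sh e_sh P0 size_rP G1 G2).
Qed.

Lemma periodic_factor_unit : P = 1 \/ P = -1.
Proof.
have PC : P = (P`_0)%:P.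
  apply/polyP => -[|k]; rewrite coefC//=.
  apply: P_dvd; rewrite -intr_Fp_eq0// -[_%:~R](coef_map (intr : int -> 'F_p)).
  by apply/eqP; rewrite -/(red P) nth_default// periodic_reduction_size.
by have := alexander_factor1 DeltaP DeltaE; rewrite PC hornerC => -[->|->]; rewrite ?polyCN; [left|right].
Qed.

End Period.

Lemma same_alexander_ideal (R : realType) (K : virtual_knot R) D D' :
  diagram_of K D -> diagram_of K D' -> alexander_ideal D = alexander_ideal D'.
Proof.
have [D0 ->] := diagram_ofP K => DD DD'.
by rewrite -(alexander_ideal_equivalent DD) (alexander_ideal_equivalent DD').
Qed.

Theorem theorem6p4 (R : realType) (K : virtual_knot R) (Delta : laurent) :
  almost_classical K ->
  is_alexander_polynomial K Delta ->
  ~ trivial_laurent Delta ->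
  (forall p : nat, prime p -> has_period K p ->
     (exists j : int, lcoef Delta j <> 0 /\ (p%:Z %| lcoef Delta j)%Z) \/
     (p - 1 <= lspan Delta)%N) /\
  finite_set [set p : nat | prime p /\ has_period K p].
Proof.
move=> _ [D1 [KD1 DeltaD1]] Delta_nontrivial.
have [s [c [P DeltaE]]] := laurent_factorP (alexander_polynomial_neq0 DeltaD1).
have period p : prime p -> has_period K p ->
     (exists j : int, lcoef Delta j <> 0 /\ (p%:Z %| lcoef Delta j)%Z) \/
     (p - 1 <= lspan Delta)%N.
  move=> pp [_ [D [KD D0 Dinv]]]; have p0 := prime_gt0 pp.
  have [|span_lt] := leqP (p - 1) (lspan Delta); [by right|left].
  apply: contrapT => ndvd; apply/Delta_nontrivial/(laurent_factor_trivial DeltaE).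
  have DeltaD : alexander_ideal D = [set x | exists y, x = y * Delta].
    by rewrite -DeltaD1; exact: same_alexander_ideal KD KD1.
  apply: (periodic_factor_unit pp D0 Dinv DeltaD DeltaE) => [k pPk|].
    apply: contrapT => Pk; apply: ndvd; exists (k%:Z + c%:Z - s%:Z).
    by rewrite (lcoef_factor_shift DeltaE).
  by apply: leq_ltn_trans (size_factor_lspan DeltaE) _; lia.
(* A bound for the periods: p is at most the absolute value of a nonzero coefficient, or at most
   span + 1. The summand 2 makes the inequality strict. *)
split=> //; pose N := (\sum_(k < size P) absz (P`_k)%R + lspan Delta + 2)%N.
apply: (sub_finite_set _ (finite_II N)) => p [pp /(period p pp)[[j [/eqP j0 pj]]|]] /=.
  have [k kP jk] := lcoef_factor_supp DeltaE j0.
  have : (p <= absz (P`_k)%R)%N by rewrite dvdn_leq// -?jk// absz_gt0.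
  by rewrite /N (bigD1 (Ordinal kP))//=; lia.
by rewrite /N; lia.
Qed.
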